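(* (i) Let $a\in\mathbb{C}$, $c,c'\in\mathbb{C}\setminus\mathbb{Z}_{\leqslant 0}$, $\delta\in\bigl(0,\frac{\pi}{2}\bigr]$ and $$\mathbb{V}_{\Psi_2}=\left\{(x,y)\in\mathbb{C}^2: x\neq0,\ y\neq0,\ 0\leqslant\arg(x)\leqslant2\pi,\ |\arg(-y)|\leqslant\tfrac{\pi}{2}-\delta\right\}.$$ Then, for $(x,y)\in\mathbb{V}_{\Psi_2}$, $$\Psi_2[a;c,c';x,y]=\frac{1}{2\pi\mathrm{i}}\frac{\Gamma(c')}{\Gamma(a)}\int_{\mathfrak{L}_{\mathrm{i}\sigma\infty}}{}_1F_1\left[\begin{matrix}a+s\\c\end{matrix};x\right]\frac{\Gamma(a+s)}{\Gamma(c'+s)}\Gamma(-s)(-y)^s\,\mathrm{d}s,$$ where the path $\mathfrak{L}_{\mathrm{i}\sigma\infty}$, starting at $\sigma-\mathrm{i}\infty$ and ending at $\sigma+\mathrm{i}\infty$, is a vertical line indented if necessary to separate the poles of $\Gamma(a+s)$ from the poles of $\Gamma(-s)$. (ii) Let $a\in\mathbb{C}$ and $c,c',c'-a\in\mathbb{C}\setminus\mathbb{Z}_{\leqslant 0}$. When $(x,y)\in\mathbb{V}_{\Psi_2}$ and $|y|\to\infty$, we have $$\Psi_2[a;c,c';x,y]\sim\frac{\Gamma(c')}{\Gamma(c'-a)}\sum_{n=0}^{\infty}{}_1F_1\left[\begin{matrix}-n\\c\end{matrix};x\right]\frac{(a)_n(1+a-c')_n}{n!}(-y)^{-a-n}.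$$
   Context: The Humbert function $\Psi_2$ is defined for $a\in\mathbb{C}$, $c,c'\in\mathbb{C}\setminus\mathbb{Z}_{\leqslant 0}$ and all $x,y\in\mathbb{C}$ by $$\Psi_2[a;c,c';x,y]=\sum_{m,n=0}^{\infty}\frac{(a)_{m+n}}{(c)_m(c')_n}\frac{x^m}{m!}\frac{y^n}{n!},$$ where $(a)_n=a(a+1)\cdots(a+n-1)$, $(a)_0=1$, and ${}_1F_1\left[\begin{matrix}b\\c\end{matrix};z\right]=\sum_{n\geqslant0}\frac{(b)_n}{(c)_n}\frac{z^n}{n!}$. Here $\sigma$ is real, and $\sim$ denotes an asymptotic expansion. *)

(* Defs.v *)
From Stdlib Require Export Reals List Factorial.
From Coquelicot Require Export Coquelicot.
Open Scope R_scope.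
Open Scope C_scope.

(** * Elementary complex functions *)

Definition Cexp (z : C) : C := ((exp (Re z) * cos (Im z))%R, (exp (Re z) * sin (Im z))%R).

(** Principal argument, with values in (-PI, PI] for [z <> 0]. *)
Definition Arg (z : C) : R :=
  if Rle_dec 0 (Im z) then acos (Re z / Cmod z) else (- acos (Re z / Cmod z))%R.

Definition Clog (z : C) : C := (ln (Cmod z), Arg z).

(** Principal value of [z ^ s]; only used for [z <> 0]. *)
Definition Cpower (z s : C) : C := Cexp (s * Clog z).

Definition nonpos_integer (z : C) : Prop := exists k : nat, z = RtoC (- INR k).

(** * Special functions

    [lim] is total; it is the limit whenever the filter converges. *)

Definition Clim_seq (u : nat -> C) : C :=
  lim (T := C_CompleteNormedModule) (filtermap u eventually).

(** Rising factorial (Pochhammer symbol) [(a)_n]. *)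
Fixpoint poch (a : C) (n : nat) : C :=
  match n with
  | O => 1
  | S k => poch a k * (a + INR k)
  end.

(** Gauss's limit n! n^z / (z (z+1) ... (z+n)).  At a pole of Gamma the terms are
    eventually [w / 0 = 0], so [Gamma] takes the value 0 there and [/ Gamma z]
    is the entire function 1/Gamma at every [z]. *)
Definition Gamma (z : C) : C :=
  Clim_seq (fun n => INR (fact n) * Cpower (INR n) z / poch z (S n)).

Definition Hyp1F1 (b c z : C) : C :=
  Clim_seq (sum_n (fun n => poch b n / poch c n * (z ^ n / INR (fact n)))).

Definition Psi2_term (a c c' x y : C) (m n : nat) : C :=
  poch a (m + n) / (poch c m * poch c' n)
    * (x ^ m / INR (fact m)) * (y ^ n / INR (fact n)).

(** The double series is the limit of its rectangular partial sums as both bounds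
    tend to infinity independently. *)
Definition Psi2 (a c c' x y : C) : C :=
  lim (T := C_CompleteNormedModule)
    (filtermap
       (fun MN : nat * nat =>
          sum_n (fun m => sum_n (fun n => Psi2_term a c c' x y m n) (snd MN)) (fst MN))
       (filter_prod eventually eventually)).

(** The argument of [x] is any determination in [0, 2 PI]; that of [-y] is principal. *)
Definition V_Psi2 (delta : R) (x y : C) : Prop :=
  x <> 0 /\ y <> 0 /\
  (exists theta : R, (0 <= theta <= 2 * PI)%R /\ x = Cmod x * Cexp (Ci * theta)) /\
  (Rabs (Arg (- y)) <= PI / 2 - delta)%R.

(** * Integration paths *)

Definition path_derive (g : R -> C) (t : R) : C :=
  (Derive (fun u => Re (g u)) t, Derive (fun u => Im (g u)) t).

Definition piecewise_C1 (g : R -> C) : Prop :=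
  (forall t : R, continuous g t) /\
  (exists l : list R, forall t : R, ~ In t l ->
     ex_derive (K := R_AbsRing) (V := C_R_NormedModule) g t /\
     continuous (path_derive g) t) /\
  (forall t : R,
     (exists v : C, filterlim (path_derive g) (at_left t) (locally v)) /\
     (exists v : C, filterlim (path_derive g) (at_right t) (locally v))).

(** A simple path from [sigma - i oo] to [sigma + i oo] that differs from the
    vertical line [Re s = sigma] only on a bounded parameter interval.  The
    indentation need not be a graph over the imaginary axis: when [a] is real,
    negative and not an integer, the real poles of Gamma(a+s) and of Gamma(-s)
    interlace and the path has to cross the real axis several times. *)
Definition indented_vertical_line (sigma : R) (g : R -> C) : Prop :=
  piecewise_C1 g /\
  (forall t u : R, g t = g u -> t = u) /\
  (exists T : R, forall t : R, (T <= Rabs t)%R -> g t = (sigma, t)).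

Definition joined_off_path (g : R -> C) (p q : C) : Prop :=
  exists h : R -> C,
    (forall t : R, continuous h t) /\ h 0%R = p /\ h 1%R = q /\
    (forall t u : R, (0 <= t <= 1)%R -> h t <> g u).

(** The two sides of the path are the connected components of its complement;
    the left one contains every point further left than the whole path. *)
Definition left_of_path (g : R -> C) (p : C) : Prop :=
  exists q : C, (forall u : R, (Re q < Re (g u))%R) /\ joined_off_path g p q.

Definition right_of_path (g : R -> C) (p : C) : Prop :=
  exists q : C, (forall u : R, (Re (g u) < Re q)%R) /\ joined_off_path g p q.

(** The poles of Gamma are the nonpositive integers. *)
Definition separates_poles (a : C) (g : R -> C) : Prop :=
  (forall s : C, nonpos_integer (a + s) -> left_of_path g s) /\
  (forall s : C, nonpos_integer (- s) -> right_of_path g s).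

Definition is_path_integral (f : C -> C) (g : R -> C) (I : C) : Prop :=
  is_RInt_gen (V := C_R_NormedModule) (fun t => f (g t) * path_derive g t)
    (Rbar_locally m_infty) (Rbar_locally p_infty) I.

(** * Asymptotic expansions *)

Definition Cmod_infty (P : C -> Prop) : Prop :=
  exists M : R, forall y : C, (M < Cmod y)%R -> P y.

(** Poincare expansion of [f] with coefficients [coef] in the asymptotic scale
    [phi] along the filter [F]; [is_domin F u v] means [v = o(u)]. *)
Definition asymptotic_expansion (F : (C -> Prop) -> Prop)
    (f : C -> C) (coef : nat -> C) (phi : nat -> C -> C) : Prop :=
  (forall N : nat,
     is_domin (U := C_NormedModule) (V := C_NormedModule) F (phi N) (phi (S N))) /\
  (forall N : nat,
     is_domin (U := C_NormedModule) (V := C_NormedModule) F (phi N)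
       (fun y => f y - sum_n (fun n => coef n * phi n y) N)).

(* Main.v *)
Require Import Defs.
From Stdlib Require Import Lra Lia Psatz Compare_dec Classical FunctionalExtensionality.

(** The proof follows Barnes. With [x] and [y] fixed, the integrand
    [1F1 (a + s; c; x) Gamma (a + s) Gamma (- s) / Gamma (c' + s) (- y)^s] has simple poles at
    the nonnegative integers [k] and at the points [- a - j]. Its residue at [k] is, up to the
    factor [- Gamma a / Gamma c'], the [k]-th term of the double series once the sum over [m]
    has been carried out ([Psi2_series], [right_residue_eq]); its residue at [- a - j] is, up
    to [Gamma a / Gamma c'], the [j]-th term of the asymptotic expansion ([left_residue_eq]).
    Moving the path to the right therefore gives the integral representation. If the path is
    the vertical line [Re s = - Re a - n - 1/2], the first [n + 1] points [- a - j] lie on the wrong side and have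
    to be compensated, while the integral itself is [O (|y|^(- Re a - n - 1/2))]; this is the
    expansion. Both parts thus come from one statement, [barnes_truncated], in which the
    first [J] points [- a - j] are on the right of the path.

    The integral over an arc of the path, closed by three sides of a rectangle, is computed by
    the residue theorem ([residue_theorem], [contour_value]). Holomorphy is replaced by uniform
    approximation by polynomials on a disc ([poly_approx]): Cauchy's formula is elementary for
    polynomials, it passes to uniform limits, and the functions in question are such limits by
    construction. The reciprocal Gamma function [RG] is the limit of the reciprocals of
    Gauss's products, and the recurrence moves all poles outside a given disc except for an
    explicit finite product of linear factors, to which partial fractions apply.

    The path is an arbitrary simple curve, and the two sides are defined by arcs avoiding it.
    The winding number of the closed contour is constant along such an arc
    ([wind_constant_along]), because the logarithm of [(s - p') / (s - p)] is single-valued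
    for [p'] near [p]. It is [0] for points on the left and [- 1] for points on the right that
    the rectangle encloses ([wind_left], [wind_right]).

    The estimates rest on [kernel_bound]. On vertical lines Gamma is compared with its values
    on the real axis through the product of the [1 + t^2 / (u + k)^2], whose logarithm is
    squeezed by an integral; this gives the decay [exp (- PI / 2 |t|)] up to any small
    exponential. The recurrence then produces [K^k / k!] at distance [k] to the right, so that
    the far side of the rectangle disappears in the limit, and the angle condition on [- y]
    leaves [exp (- delta / 2 |t|)] on the horizontal sides.

    When [a] is a nonpositive integer, [Gamma (a + s)] and [Gamma (- s)] share poles. No path
    separates them ([not_left_and_right]), and the double series is a polynomial in [y] that
    coincides with its expansion ([Psi2_polynomial]). *)

(** * Complex numbers, limits and sums *)

Lemma Cmod_le_Re_Im (z : C) : (Cmod z <= Rabs (Re z) + Rabs (Im z))%R.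
Proof.
  replace z with (RtoC (Re z) + RtoC (Im z) * Ci).
  - eapply Rle_trans; [apply Cmod_triangle|].
    rewrite Cmod_mult, !Cmod_R, Cmod_Ci.
    replace (Re (Re z + Im z * Ci)) with (Re z) by (simpl; ring).
    replace (Im (Re z + Im z * Ci)) with (Im z) by (simpl; ring). lra.
  - destruct z; unfold Cplus, Cmult, RtoC, Ci, Re, Im; simpl; f_equal; ring.
Qed.

Lemma Im_le_Cmod (z : C) : (Rabs (Im z) <= Cmod z)%R.
Proof. eapply Rle_trans; [apply Rmax_r|apply Rmax_Cmod]. Qed.

Lemma Cmod_sub_comm (x y : C) : Cmod (x - y) = Cmod (y - x).
Proof. rewrite <- Cmod_opp. f_equal. ring. Qed.

Lemma Cmod_triangle_sub (x y : C) : (Cmod (x - y) <= Cmod x + Cmod y)%R.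
Proof. eapply Rle_trans; [apply Cmod_triangle|]. rewrite Cmod_opp. lra. Qed.

Lemma Cmod_triangle_rev (x y : C) : (Cmod x - Cmod y <= Cmod (x - y))%R.
Proof.
  generalize (Cmod_triangle (x - y) y). replace (x - y + y) with x by ring. lra.
Qed.

Lemma Cmod_inv_total (z : C) : Cmod (/ z) = (/ Cmod z)%R.
Proof.
  destruct (Ceq_dec z 0) as [->|H]; [|now apply Cmod_inv].
  replace (/ 0) with (RtoC 0).
  - now rewrite Cmod_0, Rinv_0.
  - unfold Cinv, RtoC; simpl; f_equal; unfold Rdiv; ring.
Qed.

Lemma Cinv_0 : / RtoC 0 = 0.
Proof. unfold Cinv, RtoC; simpl; f_equal; unfold Rdiv; ring. Qed.

Lemma Cinv_mult_total (x y : C) : / (x * y) = / x * / y.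
Proof.
  destruct (Ceq_dec x 0) as [->|Hx]; [now rewrite Cmult_0_l, Cinv_0, Cmult_0_l|].
  destruct (Ceq_dec y 0) as [->|Hy]; [now rewrite Cmult_0_r, Cinv_0, Cmult_0_r|].
  field. now split.
Qed.

Lemma Cinv_inv_total (x : C) : / / x = x.
Proof.
  destruct (Ceq_dec x 0) as [->|Hx]; [now rewrite !Cinv_0|]. field. auto.
Qed.

Lemma INR_C_neq0 (n : nat) : n <> O -> RtoC (INR n) <> 0.
Proof. intros H E. apply RtoC_inj in E. now apply (not_0_INR n). Qed.

Lemma fact_C_neq0 (n : nat) : RtoC (INR (fact n)) <> 0.
Proof. apply INR_C_neq0, fact_neq_0. Qed.

Lemma Cmod_INR (n : nat) : Cmod (INR n) = INR n.
Proof. rewrite Cmod_R. apply Rabs_right, Rle_ge, pos_INR. Qed.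

Lemma C_eq_of_Re_Im (x y : C) : Re x = Re y -> Im x = Im y -> x = y.
Proof. destruct x, y; simpl; intros; subst; easy. Qed.

Lemma C_eq_of_close (x y : C) :
  (forall eps : R, (0 < eps)%R -> (Cmod (x - y) <= eps)%R) -> x = y.
Proof.
  intros H. apply Ceq_minus, Cmod_eq_0.
  destruct (Req_dec (Cmod (x - y)) 0) as [E|E]; [easy|].
  assert (P := Cmod_ge_0 (x - y)).
  specialize (H (Cmod (x - y) / 2)%R). lra.
Qed.

(** Unlike [sum_n], these can be empty. *)
Fixpoint csum (u : nat -> C) (n : nat) : C :=
  match n with O => 0 | S k => csum u k + u k end.

Fixpoint cprod (u : nat -> C) (n : nat) : C :=
  match n with O => 1 | S k => cprod u k * u k end.

Lemma sum_n_csum (u : nat -> C) (n : nat) : sum_n u n = csum u (S n).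
Proof.
  induction n as [|n IH].
  - rewrite sum_O. simpl. ring.
  - rewrite sum_Sn, IH. reflexivity.
Qed.

Lemma csum_ext (u v : nat -> C) n :
  (forall k, (k < n)%nat -> u k = v k) -> csum u n = csum v n.
Proof.
  induction n as [|n IH]; intros H; simpl; [easy|].
  rewrite IH; [|intros; apply H; lia]. rewrite (H n); [easy|lia].
Qed.

Lemma csum_plus (u v : nat -> C) n : csum (fun k => u k + v k) n = csum u n + csum v n.
Proof. induction n as [|n IH]; simpl; [ring|rewrite IH; ring]. Qed.

Lemma csum_scal (c : C) (u : nat -> C) n : csum (fun k => c * u k) n = c * csum u n.
Proof. induction n as [|n IH]; simpl; [ring|rewrite IH; ring]. Qed.

Lemma csum_split (u : nat -> C) n m : csum u (n + m) = csum u n + csum (fun k => u (n + k)%nat) m.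
Proof.
  induction m as [|m IH]; simpl; [rewrite Nat.add_0_r; ring|].
  rewrite Nat.add_succ_r. simpl. rewrite IH. ring.
Qed.

Lemma csum_zero (u : nat -> C) n : (forall k, (k < n)%nat -> u k = 0) -> csum u n = 0.
Proof.
  induction n as [|n IH]; intros H; simpl; [easy|].
  rewrite IH, H; [ring|lia|intros; apply H; lia].
Qed.

Lemma csum_first (u : nat -> C) n : csum u (S n) = u O + csum (fun k => u (S k)) n.
Proof. rewrite <- Nat.add_1_l, csum_split. simpl. ring. Qed.

Lemma csum_rev (u : nat -> C) n : csum u n = csum (fun k => u (n - 1 - k)%nat) n.
Proof.
  induction n as [|n IH]; [easy|].
  rewrite (csum_first (fun k => u (S n - 1 - k)%nat)).
  replace (S n - 1 - 0)%nat with n by lia.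
  cbn [csum]. rewrite IH, Cplus_comm. f_equal. apply csum_ext.
  intros k Hk. f_equal. lia.
Qed.

Lemma csum_switch (u : nat -> nat -> C) n m :
  csum (fun i => csum (u i) m) n = csum (fun j => csum (fun i => u i j) n) m.
Proof.
  induction n as [|n IH]; simpl.
  - symmetry. now apply csum_zero.
  - rewrite IH. symmetry. apply csum_plus.
Qed.

(** Plain convergence is the case of a singleton [D]. *)
Definition unif_cv {X : Type} (D : X -> Prop) (u : nat -> X -> C) (l : X -> C) : Prop :=
  forall eps : R, (0 < eps)%R ->
    exists N, forall n x, (N <= n)%nat -> D x -> (Cmod (u n x - l x) <= eps)%R.

Lemma lim_eq (F : (C -> Prop) -> Prop) (l : C) :
  ProperFilter F ->
  (forall eps : R, (0 < eps)%R -> F (fun z => (Cmod (z - l) <= eps)%R)) ->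
  lim (T := C_CompleteNormedModule) F = l.
Proof.
  intros PF H. apply C_eq_of_close. intros eps He.
  assert (HF : cauchy (T := C_CompleteNormedModule) F).
  { intros e. exists l. generalize (H (e / 2)%R (is_pos_div_2 e)).
    apply filter_imp. intros z Hz. apply (C_NormedModule_mixin_compat1 l z e).
    change (minus z l) with (z - l). assert (P := cond_pos e). lra. }
  assert (E4 : (0 < eps / 4)%R) by lra.
  generalize (complete_cauchy (T := C_CompleteNormedModule) F PF HF (mkposreal _ E4)).
  intros F1. generalize (H (eps / 4)%R E4). intros F2.
  destruct (filter_ex _ (filter_and _ _ F1 F2)) as [z [B1 B2]].
  set (L := lim (T := C_CompleteNormedModule) F) in *.
  assert (B3 := C_NormedModule_mixin_compat2 L z (mkposreal _ E4) B1).
  change (minus z L) with (z - L) in B3. simpl in B3.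
  replace (L - l) with ((z - l) - (z - L)) by ring.
  eapply Rle_trans; [apply Cmod_triangle_sub|].
  assert (sqrt 2 <= 2)%R.
  { rewrite <- (sqrt_square 2) at 2 by lra. apply sqrt_le_1_alt. lra. }
  nra.
Qed.

Lemma Clim_seq_eq (u : nat -> C) (l : C) :
  (forall eps : R, (0 < eps)%R -> exists N, forall n, (N <= n)%nat ->
     (Cmod (u n - l) <= eps)%R) ->
  Clim_seq u = l.
Proof.
  intros H. apply lim_eq; [apply filtermap_proper_filter, eventually_filter|].
  intros eps He. destruct (H eps He) as [N HN]. now exists N.
Qed.

Lemma unif_cv_Clim {X : Type} (D : X -> Prop) u (l : X -> C) x :
  unif_cv D u l -> D x -> Clim_seq (fun n => u n x) = l x.
Proof.
  intros H Hx. apply Clim_seq_eq. intros eps He.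
  destruct (H eps He) as [N HN]. exists N. auto.
Qed.

Lemma unif_cv_unique {X : Type} (D : X -> Prop) u (l l' : X -> C) x :
  unif_cv D u l -> unif_cv D u l' -> D x -> l x = l' x.
Proof.
  intros H H' Hx. rewrite <- (unif_cv_Clim D u l x H Hx). now apply (unif_cv_Clim D).
Qed.

Lemma unif_cv_sub {X : Type} (D D' : X -> Prop) u (l : X -> C) :
  unif_cv D u l -> (forall x, D' x -> D x) -> unif_cv D' u l.
Proof.
  intros H HD eps He. destruct (H eps He) as [N HN]. exists N. auto.
Qed.

Lemma unif_cv_ext_loc {X : Type} (D : X -> Prop) u v (l : X -> C) (n0 : nat) :
  (forall n x, (n0 <= n)%nat -> D x -> u n x = v n x) -> unif_cv D u l -> unif_cv D v l.
Proof.
  intros E H eps He. destruct (H eps He) as [N HN]. exists (max n0 N).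
  intros n x Hn Hx. rewrite <- E; [apply HN|..]; try easy; lia.
Qed.

Lemma unif_cv_mult {X : Type} (D : X -> Prop) u v (l m : X -> C) (B : R) :
  (forall x, D x -> (Cmod (l x) <= B)%R) -> (forall x, D x -> (Cmod (m x) <= B)%R) ->
  unif_cv D u l -> unif_cv D v m -> unif_cv D (fun n x => u n x * v n x) (fun x => l x * m x).
Proof.
  intros Hl Hm Hu Hv eps He.
  set (B' := (Rabs B + 1)%R).
  assert (HB : (B <= B' /\ 1 <= B')%R).
  { unfold B'. assert (A := Rle_abs B). assert (A' := Rabs_pos B). lra. }
  set (d := Rmin 1 (eps / (3 * B'))).
  assert (Hd : (0 < d)%R).
  { unfold d. apply Rmin_case; [lra|]. apply Rdiv_lt_0_compat; lra. }
  assert (Hd1 : (d <= 1)%R) by apply Rmin_l.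
  assert (Hd2 : (3 * B' * d <= eps)%R).
  { assert (A : (d <= eps / (3 * B'))%R) by apply Rmin_r.
    apply Rmult_le_compat_l with (r := (3 * B')%R) in A; [|lra].
    replace (3 * B' * (eps / (3 * B')))%R with eps in A by (field; lra). lra. }
  destruct (Hu d Hd) as [N1 H1]. destruct (Hv d Hd) as [N2 H2].
  exists (max N1 N2). intros n x Hn Hx.
  assert (H1' : (Cmod (u n x - l x) <= d)%R) by (apply H1; [lia|easy]).
  assert (H2' : (Cmod (v n x - m x) <= d)%R) by (apply H2; [lia|easy]).
  replace (u n x * v n x - l x * m x)
    with ((u n x - l x) * (v n x - m x) + (l x * (v n x - m x) + (u n x - l x) * m x)) by ring.
  eapply Rle_trans; [apply Cmod_triangle|].
  eapply Rle_trans; [apply Rplus_le_compat_l, Cmod_triangle|].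
  rewrite !Cmod_mult.
  assert (P1 := Cmod_ge_0 (u n x - l x)). assert (P2 := Cmod_ge_0 (v n x - m x)).
  assert (P3 := Cmod_ge_0 (l x)). assert (P4 := Cmod_ge_0 (m x)).
  specialize (Hl x Hx). specialize (Hm x Hx).
  nra.
Qed.

Lemma unif_cv_scal {X : Type} (D : X -> Prop) v (c m : X -> C) (B : R) :
  (forall x, D x -> (Cmod (c x) <= B)%R) ->
  unif_cv D v m -> unif_cv D (fun n x => c x * v n x) (fun x => c x * m x).
Proof.
  intros Hc Hv eps He. set (B' := (Rabs B + 1)%R).
  assert (HB : (B <= B' /\ 1 <= B')%R).
  { unfold B'. assert (A := Rle_abs B). assert (A' := Rabs_pos B). lra. }
  destruct (Hv (eps / B')%R) as [N HN]; [apply Rdiv_lt_0_compat; lra|].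
  exists N. intros n x Hn Hx. specialize (HN n x Hn Hx).
  replace (c x * v n x - c x * m x) with (c x * (v n x - m x)) by ring.
  rewrite Cmod_mult.
  replace eps with (B' * (eps / B'))%R by (field; lra).
  specialize (Hc x Hx).
  apply Rmult_le_compat; try apply Cmod_ge_0; lra.
Qed.

Lemma unif_cv_inv {X : Type} (D : X -> Prop) u (l : X -> C) (d : R) (n0 : nat) :
  (0 < d)%R ->
  (forall n x, (n0 <= n)%nat -> D x -> (d <= Cmod (u n x))%R) ->
  unif_cv D u l ->
  (forall x, D x -> (d <= Cmod (l x))%R) /\ unif_cv D (fun n x => / u n x) (fun x => / l x).
Proof.
  intros Hd Hu Hc.
  assert (HL : forall x, D x -> (d <= Cmod (l x))%R).
  { intros x Hx. apply Rnot_lt_le. intros Hlt.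
    destruct (Hc ((d - Cmod (l x)) / 2)%R) as [N HN]; [lra|].
    specialize (HN (max n0 N) x ltac:(lia) Hx).
    specialize (Hu (max n0 N) x ltac:(lia) Hx).
    assert (A := Cmod_triangle_rev (u (max n0 N) x) (l x)). lra. }
  split; [easy|]. intros eps He.
  destruct (Hc (eps * (d * d))%R) as [N HN]; [apply Rmult_lt_0_compat; nra|].
  exists (max n0 N). intros n x Hn Hx.
  specialize (HN n x ltac:(lia) Hx). specialize (Hu n x ltac:(lia) Hx).
  specialize (HL x Hx).
  assert (U0 : u n x <> 0) by (apply Cmod_gt_0; lra).
  assert (L0 : l x <> 0) by (apply Cmod_gt_0; lra).
  replace (/ u n x - / l x) with (- (u n x - l x) * / (u n x * l x)) by (field; now split).
  rewrite Cmod_mult, Cmod_opp, Cmod_inv_total, Cmod_mult.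
  apply Rmult_le_reg_r with (Cmod (u n x) * Cmod (l x))%R; [nra|].
  rewrite Rmult_assoc, Rinv_l by nra. rewrite Rmult_1_r.
  eapply Rle_trans; [apply HN|]. apply Rmult_le_compat_l; [lra|].
  apply Rmult_le_compat; lra.
Qed.

(** If the increments are dominated by those of a null sequence [b], the sequence is
    uniformly Cauchy; geometric tails and [A / n] are the two instances used. *)
Lemma unif_cv_telescope {X : Type} (D : X -> Prop) (u : nat -> X -> C) (b : nat -> R) (n0 : nat) :
  (forall n, (n0 <= n)%nat -> (0 <= b n)%R) ->
  (forall eps : R, (0 < eps)%R -> exists n, (n0 <= n)%nat /\ (b n <= eps)%R) ->
  (forall n x, (n0 <= n)%nat -> D x -> (Cmod (u (S n) x - u n x) <= b n - b (S n))%R) ->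
  unif_cv D u (fun x => Clim_seq (fun n => u n x)) /\
  (forall n x, (n0 <= n)%nat -> D x ->
     (Cmod (Clim_seq (fun n => u n x) - u n x) <= b n)%R).
Proof.
  intros Hb Hb0 Hu.
  assert (HT : forall x n k, (n0 <= n)%nat -> D x ->
    (Cmod (u (n + k)%nat x - u n x) <= b n - b (n + k)%nat)%R).
  { intros x n k Hn Hx. induction k as [|k IH].
    - rewrite Nat.add_0_r. replace (u n x - u n x) with (RtoC 0) by ring. rewrite Cmod_0. lra.
    - rewrite Nat.add_succ_r.
      replace (u (S (n + k)) x - u n x)
        with ((u (S (n + k)) x - u (n + k)%nat x) + (u (n + k)%nat x - u n x)) by ring.
      eapply Rle_trans; [apply Cmod_triangle|].
      assert (A := Hu (n + k)%nat x ltac:(lia) Hx). lra. }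
  assert (HL : forall x, D x -> exists l, forall eps : R, (0 < eps)%R ->
     exists N, forall n, (N <= n)%nat -> (Cmod (u n x - l) <= eps)%R).
  { intros x Hx.
    set (F := filtermap (fun n => u n x) eventually).
    assert (PF : ProperFilter F) by apply filtermap_proper_filter, eventually_filter.
    assert (HF : cauchy (T := C_CompleteNormedModule) F).
    { intros e. destruct (Hb0 (e / 2)%R (is_pos_div_2 e)) as [n [Hn Hbn]].
      exists (u n x). exists n. intros m Hm.
      apply (C_NormedModule_mixin_compat1 (u n x) (u m x) e).
      change (minus (u m x) (u n x)) with (u m x - u n x).
      replace m with (n + (m - n))%nat by lia.
      assert (A := HT x n (m - n)%nat Hn Hx). assert (A' := Hb (n + (m - n))%nat ltac:(lia)).
      assert (P := cond_pos e). lra. }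
    exists (lim (T := C_CompleteNormedModule) F). intros eps He.
    assert (E4 : (0 < eps / 2)%R) by lra.
    destruct (complete_cauchy (T := C_CompleteNormedModule) F PF HF (mkposreal _ E4)) as [N HN].
    exists N. intros n Hn. specialize (HN n Hn).
    set (L := lim (T := C_CompleteNormedModule) F) in *.
    assert (B3 := C_NormedModule_mixin_compat2 L (u n x) (mkposreal _ E4) HN).
    change (minus (u n x) L) with (u n x - L) in B3. simpl in B3.
    assert (sqrt 2 <= 2)%R.
    { rewrite <- (sqrt_square 2) at 2 by lra. apply sqrt_le_1_alt. lra. }
    nra. }
  assert (HB : forall n x, (n0 <= n)%nat -> D x ->
     (Cmod (Clim_seq (fun n => u n x) - u n x) <= b n)%R).
  { intros n x Hn Hx. destruct (HL x Hx) as [l Hl].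
    rewrite (Clim_seq_eq _ l Hl). apply le_epsilon. intros eps He.
    destruct (Hl eps He) as [N HN].
    assert (A := HT x n N Hn Hx). specialize (HN (n + N)%nat ltac:(lia)).
    assert (A' := Hb (n + N)%nat ltac:(lia)).
    replace (l - u n x) with ((u (n + N)%nat x - u n x) - (u (n + N)%nat x - l)) by ring.
    eapply Rle_trans; [apply Cmod_triangle_sub|]. lra. }
  split; [|exact HB].
  intros eps He. destruct (Hb0 eps He) as [n [Hn Hbn]]. exists n. intros m x Hm Hx.
  rewrite Cmod_sub_comm. eapply Rle_trans; [apply HB; [lia|easy]|].
  assert (A := fun k (Hk : (n0 <= k)%nat) => Rle_trans _ _ _ (Cmod_ge_0 _) (Hu k x Hk Hx)).
  clear -A Hm Hn Hbn. induction Hm as [|m Hm IH]; [easy|].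
  specialize (A m ltac:(lia)). lra.
Qed.

(** * Complex-valued functions of a real variable and the exponential *)

(** Componentwise, so that the real mean value theorem and the real fundamental theorem of
    calculus apply. *)
Definition deriv_at (f : R -> C) (t : R) (v : C) : Prop :=
  is_derive (fun u => Re (f u)) t (Re v) /\ is_derive (fun u => Im (f u)) t (Im v).

Lemma deriv_at_ext (f g : R -> C) t (v w : C) : (forall u, f u = g u) -> v = w -> deriv_at f t v -> deriv_at g t w.
Proof.
  intros E <- [H1 H2]. split; [eapply is_derive_ext; [|exact H1]|eapply is_derive_ext; [|exact H2]];
  intros u; simpl; now rewrite E.
Qed.

Lemma deriv_at_const c t : deriv_at (fun _ => c) t 0.
Proof. split; simpl; apply @is_derive_const. Qed.

Lemma deriv_at_plus (f g : R -> C) t (v w : C) : deriv_at f t v -> deriv_at g t w -> deriv_at (fun u => f u + g u) t (v + w).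
Proof. intros [A B] [A' B']. split; simpl; now apply @is_derive_plus. Qed.

Lemma deriv_at_mult f g t v w :
  deriv_at f t v -> deriv_at g t w -> deriv_at (fun u => f u * g u) t (v * g t + f t * w).
Proof.
  intros [A B] [A' B'].
  assert (M := fun f g x df dg Hf Hg =>
    @is_derive_mult R_AbsRing f g x df dg Hf Hg Rmult_comm).
  unfold mult, plus in M; simpl in M.
  split.
  - apply is_derive_ext with
      (f := fun u => (Re (f u) * Re (g u) - Im (f u) * Im (g u))%R); [reflexivity|].
    replace (Re (v * g t + f t * w)) with
      ((Re v * Re (g t) + Re (f t) * Re w) - (Im v * Im (g t) + Im (f t) * Im w))%R
      by (unfold Re, Im; simpl; ring).
    apply @is_derive_minus; now apply M.
  - apply is_derive_ext with
      (f := fun u => (Re (f u) * Im (g u) + Im (f u) * Re (g u))%R); [reflexivity|].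
    replace (Im (v * g t + f t * w)) with
      ((Re v * Im (g t) + Re (f t) * Im w) + (Im v * Re (g t) + Im (f t) * Re w))%R
      by (unfold Re, Im; simpl; ring).
    apply @is_derive_plus; now apply M.
Qed.

Lemma deriv_at_scal c f t v : deriv_at f t v -> deriv_at (fun u => c * f u) t (c * v).
Proof.
  intros H. apply (deriv_at_ext (fun u => c * f u) _ t (0 * f t + c * v)); [easy|ring|].
  apply deriv_at_mult; [apply deriv_at_const|easy].
Qed.

Lemma deriv_at_id t : deriv_at RtoC t 1.
Proof. split; simpl; [apply @is_derive_id|apply @is_derive_const]. Qed.

Lemma deriv_at_pow f t v n : deriv_at f t v -> deriv_at (fun u => f u ^ (S n)) t (INR (S n) * v * f t ^ n).
Proof.
  intros H. induction n as [|n IH].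
  - apply (deriv_at_ext f _ t v); [intros; simpl; ring|simpl; ring|easy].
  - apply (deriv_at_ext (fun u => f u * f u ^ S n) _ t
             (v * f t ^ S n + f t * (INR (S n) * v * f t ^ n))); [easy| |now apply deriv_at_mult].
    rewrite (S_INR (S n)), RtoC_plus. simpl. ring.
Qed.

Lemma Re_le_Cmod (z : C) : (Re z <= Cmod z)%R.
Proof. eapply Rle_trans; [apply Rle_abs|apply re_le_Cmod]. Qed.

(** Mean value inequality. The real mean value theorem is applied to the component
    of [f] along the direction of the total increment. *)
Lemma deriv_at_bound f f' a b M :
  (a <= b)%R -> (0 <= M)%R ->
  (forall t, (a <= t <= b)%R -> deriv_at f t (f' t)) ->
  (forall t, (a <= t <= b)%R -> (Cmod (f' t) <= M)%R) ->
  (Cmod (f b - f a) <= M * (b - a))%R.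
Proof.
  intros Hab HM Hd Hb. set (v := f b - f a).
  set (g := fun t => (Re v * Re (f t) + Im v * Im (f t))%R).
  assert (G : forall t, (a <= t <= b)%R ->
    is_derive g t (Re v * Re (f' t) + Im v * Im (f' t))%R).
  { intros t Ht. destruct (Hd t Ht) as [A B].
    apply @is_derive_plus; now apply is_derive_scal. }
  destruct (MVT_gen g a b (fun t => (Re v * Re (f' t) + Im v * Im (f' t))%R)) as [c [Hc E]].
  - intros t Ht. rewrite Rmin_left, Rmax_right in Ht by lra. apply G; lra.
  - intros t Ht. rewrite Rmin_left, Rmax_right in Ht by lra.
    apply continuity_pt_filterlim. apply (ex_derive_continuous g).
    eexists. apply G; lra.
  - rewrite Rmin_left, Rmax_right in Hc by lra.
    assert (E2 : (g b - g a = Cmod v ^ 2)%R).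
    { rewrite Cmod2_alt. unfold g.
      change (Re v) with (Re (f b - f a)). change (Im v) with (Im (f b - f a)).
      unfold Re, Im; simpl; ring. }
    assert (E3 : (Re v * Re (f' c) + Im v * Im (f' c) <= Cmod v * M)%R).
    { replace (Re v * Re (f' c) + Im v * Im (f' c))%R with (Re (Cconj v * f' c)) by (unfold Re, Im; simpl; ring).
      eapply Rle_trans; [apply Re_le_Cmod|]. rewrite Cmod_mult, Cmod_conj.
      apply Rmult_le_compat_l; [apply Cmod_ge_0|]. now apply Hb. }
    destruct (Req_dec (Cmod v) 0) as [Z|Z].
    + rewrite Z. apply Rmult_le_pos; lra.
    + assert (P := Cmod_ge_0 v). apply Rmult_le_reg_l with (Cmod v); [lra|].
      replace (Cmod v * Cmod v)%R with (Cmod v ^ 2)%R by ring. rewrite <- E2, E.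
      rewrite <- Rmult_assoc. apply Rmult_le_compat_r; lra.
Qed.

Lemma exp_le (x y : R) : (x <= y)%R -> (exp x <= exp y)%R.
Proof. intros [H| ->]; [left; now apply exp_increasing|apply Rle_refl]. Qed.

Lemma Cexp_plus z w : Cexp (z + w) = Cexp z * Cexp w.
Proof.
  unfold Cexp. apply C_eq_of_Re_Im; simpl;
  rewrite exp_plus, ?cos_plus, ?sin_plus; unfold Re, Im; simpl; ring.
Qed.

Lemma Cmod_Cexp z : Cmod (Cexp z) = exp (Re z).
Proof.
  unfold Cmod, Cexp. simpl.
  replace (_ + _)%R with (Rsqr (exp (Re z)) * (Rsqr (sin (Im z)) + Rsqr (cos (Im z))))%R
    by (unfold Rsqr; ring).
  rewrite sin2_cos2, Rmult_1_r, sqrt_Rsqr; [easy|]. left; apply exp_pos.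
Qed.

Lemma Cexp_neq0 z : Cexp z <> 0.
Proof. apply Cmod_gt_0. rewrite Cmod_Cexp. apply exp_pos. Qed.

Lemma Cexp_0 : Cexp 0 = 1.
Proof. unfold Cexp. simpl. rewrite exp_0, cos_0, sin_0. unfold RtoC; f_equal; ring. Qed.

Lemma Cexp_RtoC r : Cexp (RtoC r) = RtoC (exp r).
Proof. unfold Cexp. simpl. rewrite cos_0, sin_0. unfold RtoC; f_equal; ring. Qed.

Lemma Cexp_opp z : Cexp (- z) = / Cexp z.
Proof.
  assert (H := Cexp_plus z (- z)). replace (z + - z) with (RtoC 0) in H by ring.
  rewrite Cexp_0 in H. assert (N := Cexp_neq0 z).
  replace (/ Cexp z) with (/ Cexp z * 1) by ring. rewrite H. field. easy.
Qed.

Lemma Cexp_INR_mult (n : nat) z : Cexp (INR n * z) = Cexp z ^ n.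
Proof.
  induction n as [|n IH].
  - simpl. rewrite Cmult_0_l. apply Cexp_0.
  - rewrite S_INR, RtoC_plus. replace ((INR n + 1) * z) with (z + INR n * z) by ring.
    rewrite Cexp_plus, IH. easy.
Qed.

Lemma deriv_at_Cexp w t : deriv_at (fun u => Cexp (u * w)) t (w * Cexp (t * w)).
Proof.
  unfold deriv_at, Cexp, Re, Im. simpl. split; auto_derive; trivial; unfold Re, Im; simpl; unfold Rminus; ring.
Qed.

Definition exp_poly (n : nat) (w : C) : C := csum (fun k => w ^ k / INR (fact k)) n.

Lemma deriv_at_exp_poly w t n :
  deriv_at (fun u => exp_poly (S n) (u * w)) t (w * exp_poly n (t * w)).
Proof.
  induction n as [|n IH].
  - apply (deriv_at_ext (fun _ => 1) _ t 0); [|unfold exp_poly; simpl; ring|apply deriv_at_const].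
    intros u. unfold exp_poly. simpl. field.
  - unfold exp_poly in *.
    apply (deriv_at_ext (fun u => csum (fun k => (u * w) ^ k / INR (fact k)) (S n)
                      + (/ INR (fact (S n))) * (u * w) ^ S n) _ t
             (w * csum (fun k => (t * w) ^ k / INR (fact k)) n +
              / INR (fact (S n)) * (INR (S n) * w * (t * w) ^ n))).
    + intros u. cbn [csum]. unfold Cdiv. ring.
    + cbn [csum]. replace (INR (fact (S n))) with (INR (S n) * INR (fact n))%R
        by (rewrite <- mult_INR; easy).
      rewrite RtoC_mult. field. split; [apply fact_C_neq0|apply INR_C_neq0; lia].
    + apply deriv_at_plus; [exact IH|]. apply deriv_at_scal, deriv_at_pow.
      apply (deriv_at_ext (fun u => u * w) _ t (1 * w + t * 0)); [easy|ring|].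
      apply deriv_at_mult; [apply deriv_at_id|apply deriv_at_const].
Qed.

(** In [exp_poly (S n) (t w) * exp (- t w)] the derivatives in [t] cancel up to
    [- w (t w)^n / n! exp (- t w)]; the mean value inequality between [0] and [1] bounds the
    rest. *)
Lemma exp_poly_error (w : C) (n : nat) :
  (Cmod (exp_poly (S n) w - Cexp w) <=
     Cmod w ^ (S n) / INR (fact n) * exp (2 * Cmod w))%R.
Proof.
  set (f := fun t : R => exp_poly (S n) (t * w) * Cexp (t * (- w))).
  set (f' := fun t : R => - w * ((t * w) ^ n / INR (fact n)) * Cexp (t * (- w))).
  assert (PF : (0 < INR (fact n))%R) by apply lt_0_INR, lt_O_fact.
  assert (B : (Cmod (f 1%R - f 0%R) <=
     (Cmod w ^ (S n) / INR (fact n) * exp (Cmod w)) * (1 - 0))%R).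
  { apply (deriv_at_bound f f').
    - lra.
    - apply Rmult_le_pos; [|left; apply exp_pos].
      apply Rmult_le_pos; [apply pow_le, Cmod_ge_0|left; now apply Rinv_0_lt_compat].
    - intros t _.
      apply (deriv_at_ext f _ t ((w * exp_poly n (t * w)) * Cexp (t * (- w)) +
         exp_poly (S n) (t * w) * (- w * Cexp (t * (- w))))); [easy| |].
      + unfold f', exp_poly. cbn [csum]. ring.
      + apply deriv_at_mult; [apply deriv_at_exp_poly|apply deriv_at_Cexp].
    - intros t Ht. unfold f'. rewrite !Cmod_mult, Cmod_opp, Cmod_Cexp, Cmod_div, Cmod_pow, Cmod_INR
        by apply fact_C_neq0.
      rewrite Cmod_mult, Cmod_R.
      replace (Cmod w ^ S n / INR (fact n) * exp (Cmod w))%R with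
        (Cmod w * (Cmod w ^ n / INR (fact n)) * exp (Cmod w))%R by (simpl; field; lra).
      assert (P := Cmod_ge_0 w).
      assert (T : (Rabs t <= 1)%R) by (rewrite Rabs_right; lra).
      assert (PT := Rabs_pos t).
      assert (Q : (0 <= Rabs t * Cmod w)%R) by nra.
      apply Rmult_le_compat.
      + apply Rmult_le_pos; [easy|]. apply Rmult_le_pos; [now apply pow_le|].
        left; now apply Rinv_0_lt_compat.
      + left; apply exp_pos.
      + apply Rmult_le_compat_l; [easy|]. apply Rmult_le_compat_r.
        * left; now apply Rinv_0_lt_compat.
        * apply pow_incr. split; [easy|nra].
      + apply exp_le. rewrite re_scal_l. rewrite re_opp.
        generalize (re_le_Cmod w); intros RW. apply Rabs_le_between in RW. nra. }
  unfold f in B. rewrite !Cmult_1_l, !Cmult_0_l, Cexp_0, Cexp_opp in B.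
  replace (exp_poly (S n) 0) with (RtoC 1) in B.
  2:{ unfold exp_poly. rewrite csum_first, (csum_zero (fun k => 0 ^ S k / INR (fact (S k)))).
      - simpl. field.
      - intros k _. simpl. unfold Cdiv. ring. }
  assert (N := Cexp_neq0 w).
  replace (exp_poly (S n) w - Cexp w) with ((exp_poly (S n) w * / Cexp w - 1 * 1) * Cexp w)
    by (field; easy).
  rewrite Cmod_mult, Cmod_Cexp.
  replace (2 * Cmod w)%R with (Cmod w + Cmod w)%R by ring. rewrite exp_plus.
  rewrite Rminus_0_r, Rmult_1_r in B. rewrite <- Rmult_assoc.
  apply Rmult_le_compat; [apply Cmod_ge_0|left; apply exp_pos|exact B|].
  apply exp_le, Re_le_Cmod.
Qed.

Lemma Cexp_order2 (w : C) :
  (Cmod w <= 1)%R -> (Cmod (Cexp w - 1 - w) <= exp 2 * Cmod w ^ 2)%R.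
Proof.
  intros H. assert (E := exp_poly_error w 1).
  replace (exp_poly 2 w) with (1 + w) in E
    by (unfold exp_poly; simpl; field).
  replace (Cexp w - 1 - w) with (- (1 + w - Cexp w)) by ring. rewrite Cmod_opp.
  eapply Rle_trans; [apply E|]. simpl (INR (fact 1)). rewrite Rdiv_1_r, Rmult_comm.
  apply Rmult_le_compat_r; [apply pow_le, Cmod_ge_0|]. apply exp_le. lra.
Qed.

(** By induction on [n], the difference of the two sides is nondecreasing. *)
Lemma pow_le_fact_exp (x : R) (n : nat) : (0 <= x)%R -> (x ^ n <= INR (fact n) * exp x)%R.
Proof.
  revert x. induction n as [|n IH]; intros x Hx.
  - simpl. generalize (exp_ineq1_le x). lra.
  - set (f := fun t => (INR (fact (S n)) * exp t - t ^ S n)%R).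
    assert (D : forall t, is_derive f t (INR (fact (S n)) * exp t - INR (S n) * t ^ n)%R).
    { intros t. unfold f. auto_derive; trivial.
      change (fact n + n * fact n)%nat with (fact (S n)).
      change (match n with O => 1%R | S _ => (INR n + 1)%R end) with (INR (S n)). ring. }
    destruct (MVT_gen f 0 x (fun t => INR (fact (S n)) * exp t - INR (S n) * t ^ n)%R)
      as [c [Hc E]].
    + intros t _. apply D.
    + intros t _. apply continuity_pt_filterlim, (ex_derive_continuous f). eexists; apply D.
    + rewrite Rmin_left, Rmax_right in Hc by lra.
      assert (F0 : (0 <= f 0)%R).
      { unfold f. simpl. rewrite exp_0. assert (P := pos_INR (fact n + n * fact n)). lra. }
      assert (I := IH c (proj1 Hc)).
      assert (FS : INR (fact (S n)) = (INR (S n) * INR (fact n))%R) by (rewrite <- mult_INR; easy).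
      rewrite FS in E. assert (P := pos_INR (S n)).
      assert (0 <= f x - f 0)%R by (rewrite E; apply Rmult_le_pos; [nra|lra]).
      unfold f in *. lra.
Qed.

(** The factorial dominates every geometric sequence, with a factor [2^-n] to spare. *)
Lemma pow_le_fact (q : R) : (0 <= q)%R ->
  exists A, (0 < A)%R /\ forall n, (q ^ n <= A * INR (fact n) * (/ 2) ^ n)%R.
Proof.
  intros Hq. exists (exp (2 * q)). split; [apply exp_pos|]. intros n.
  assert (H := pow_le_fact_exp (2 * q) n ltac:(lra)). rewrite Rpow_mult_distr in H.
  rewrite pow_inv. assert (0 < 2 ^ n)%R by (apply pow_lt; lra).
  apply Rmult_le_reg_r with (2 ^ n)%R; [easy|].
  replace (exp (2 * q) * INR (fact n) * / 2 ^ n * 2 ^ n)%R with (INR (fact n) * exp (2 * q))%R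
    by (field; lra). lra.
Qed.

(** * Functions approximable by polynomials on a disc *)

(** Coefficient lists, constant term first. *)
Fixpoint peval (p : list C) (s : C) : C :=
  match p with nil => 0 | c :: q => c + s * peval q s end.

Lemma peval_add p q : exists r, forall s, peval r s = peval p s + peval q s.
Proof.
  revert q. induction p as [|c p IH]; intros q.
  - exists q. intros. simpl. ring.
  - destruct q as [|d q].
    + exists (c :: p). intros. simpl. ring.
    + destruct (IH q) as [r Hr]. exists (c + d :: r). intros. simpl. rewrite Hr. ring.
Qed.

Lemma peval_scal c p : exists r, forall s, peval r s = c * peval p s.
Proof.
  induction p as [|d p [r Hr]].
  - exists nil. intros; simpl; ring.
  - exists (c * d :: r). intros; simpl; rewrite Hr; ring.
Qed.

Lemma peval_mult p q : exists r, forall s, peval r s = peval p s * peval q s.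
Proof.
  induction p as [|c p [r Hr]].
  - exists nil. intros; simpl; ring.
  - destruct (peval_scal c q) as [r1 H1]. destruct (peval_add r1 (RtoC 0 :: r)) as [r2 H2].
    exists r2. intros s. rewrite H2, H1. simpl. rewrite Hr. ring.
Qed.

Lemma peval_divided_difference P p :
  exists Q, forall s, peval P s - peval P p = (s - p) * peval Q s.
Proof.
  induction P as [|c P [Q HQ]].
  - exists nil. intros; simpl; ring.
  - destruct (peval_scal p Q) as [r1 H1]. destruct (peval_add P r1) as [r2 H2].
    exists r2. intros s. rewrite H2, H1. simpl.
    replace (c + s * peval P s - (c + p * peval P p))
      with ((s - p) * peval P s + p * (peval P s - peval P p)) by ring.
    rewrite HQ. ring.
Qed.

(** This plays the part of holomorphy on the disc. The class is stable under products and
    uniform limits, which is how the Gamma and hypergeometric functions enter it, and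
    Cauchy's formula extends to it from polynomials; no complex derivative is ever taken. *)
Definition poly_approx (R0 : R) (f : C -> C) : Prop :=
  forall eps : R, (0 < eps)%R ->
    exists p, forall s, (Cmod s <= R0)%R -> (Cmod (f s - peval p s) <= eps)%R.

Definition disc (R0 : R) (s : C) : Prop := (Cmod s <= R0)%R.

Lemma poly_approx_ext R0 (f g : C -> C) :
  (forall s, (Cmod s <= R0)%R -> f s = g s) -> poly_approx R0 f -> poly_approx R0 g.
Proof.
  intros E H eps He. destruct (H eps He) as [p Hp]. exists p. intros s Hs.
  rewrite <- E by easy. auto.
Qed.

Lemma poly_approx_peval R0 p : poly_approx R0 (peval p).
Proof.
  intros eps He. exists p. intros s _. replace (peval p s - peval p s) with (RtoC 0) by ring.
  rewrite Cmod_0. lra.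
Qed.

Lemma poly_approx_const R0 c : poly_approx R0 (fun _ => c).
Proof.
  eapply poly_approx_ext; [|apply (poly_approx_peval R0 (c :: nil))]. intros; simpl; ring.
Qed.

Lemma poly_approx_id R0 : poly_approx R0 (fun s => s).
Proof.
  eapply poly_approx_ext; [|apply (poly_approx_peval R0 (RtoC 0 :: RtoC 1 :: nil))]. intros; simpl; ring.
Qed.

Lemma poly_approx_plus R0 (f g : C -> C) : poly_approx R0 f -> poly_approx R0 g -> poly_approx R0 (fun s => f s + g s).
Proof.
  intros Hf Hg eps He. destruct (Hf (eps / 2)%R) as [p Hp]; [lra|].
  destruct (Hg (eps / 2)%R) as [q Hq]; [lra|]. destruct (peval_add p q) as [r Hr].
  exists r. intros s Hs. rewrite Hr.
  replace (f s + g s - (peval p s + peval q s))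
    with ((f s - peval p s) + (g s - peval q s)) by ring.
  eapply Rle_trans; [apply Cmod_triangle|]. specialize (Hp s Hs). specialize (Hq s Hs). lra.
Qed.

Lemma peval_bounded R0 p : exists B, forall s, (Cmod s <= R0)%R -> (Cmod (peval p s) <= B)%R.
Proof.
  induction p as [|c p [B HB]].
  - exists 0%R. intros. simpl. rewrite Cmod_0. lra.
  - exists (Cmod c + R0 * B)%R. intros s Hs. simpl.
    eapply Rle_trans; [apply Cmod_triangle|]. rewrite Cmod_mult.
    apply Rplus_le_compat_l, Rmult_le_compat; auto using Cmod_ge_0.
Qed.

Lemma poly_approx_bounded R0 (f : C -> C) :
  poly_approx R0 f -> exists B, forall s, (Cmod s <= R0)%R -> (Cmod (f s) <= B)%R.
Proof.
  intros H. destruct (H 1%R) as [p Hp]; [lra|]. destruct (peval_bounded R0 p) as [B HB].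
  exists (1 + B)%R. intros s Hs. replace (f s) with ((f s - peval p s) + peval p s) by ring.
  eapply Rle_trans; [apply Cmod_triangle|]. specialize (Hp s Hs). specialize (HB s Hs). lra.
Qed.

Lemma poly_approx_unif_cv R0 u f : (forall n, poly_approx R0 (u n)) -> unif_cv (disc R0) u f -> poly_approx R0 f.
Proof.
  intros Hu Hc eps He. destruct (Hc (eps / 2)%R) as [N HN]; [lra|].
  destruct (Hu N (eps / 2)%R) as [p Hp]; [lra|]. exists p. intros s Hs.
  replace (f s - peval p s) with ((u N s - peval p s) - (u N s - f s)) by ring.
  eapply Rle_trans; [apply Cmod_triangle_sub|].
  specialize (Hp s Hs). specialize (HN N s (le_n _) Hs). lra.
Qed.

Lemma poly_approx_mult R0 (f g : C -> C) :
  poly_approx R0 f -> poly_approx R0 g -> poly_approx R0 (fun s => f s * g s).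
Proof.
  intros Hf Hg eps He. destruct (poly_approx_bounded _ _ Hf) as [B HB].
  destruct (poly_approx_bounded _ _ Hg) as [B' HB'].
  set (K := (Rabs B + Rabs B' + 1)%R).
  assert (P1 := Rabs_pos B). assert (P2 := Rabs_pos B').
  assert (L1 := Rle_abs B). assert (L2 := Rle_abs B').
  set (d := Rmin 1 (eps / K)).
  assert (D0 : (0 < d)%R).
  { apply Rmin_case; [lra|]. apply Rdiv_lt_0_compat; unfold K; lra. }
  assert (D1 : (d <= 1)%R) by apply Rmin_l.
  assert (D2 : (d * K <= eps)%R).
  { assert (A : (d <= eps / K)%R) by apply Rmin_r.
    apply Rmult_le_compat_r with (r := K) in A; [|unfold K; lra].
    replace (eps / K * K)%R with eps in A by (unfold K; field; lra). easy. }
  destruct (Hf d D0) as [p Hp]. destruct (Hg d D0) as [q Hq].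
  destruct (peval_mult p q) as [r Hr]. exists r. intros s Hs. rewrite Hr.
  specialize (HB s Hs). specialize (HB' s Hs). specialize (Hp s Hs). specialize (Hq s Hs).
  replace (f s * g s - peval p s * peval q s) with
    (f s * (g s - peval q s) + ((f s - peval p s) * g s -
       (f s - peval p s) * (g s - peval q s))) by ring.
  eapply Rle_trans; [apply Cmod_triangle|].
  eapply Rle_trans; [apply Rplus_le_compat_l, Cmod_triangle_sub|]. rewrite !Cmod_mult.
  assert (Q1 := Cmod_ge_0 (f s)). assert (Q2 := Cmod_ge_0 (g s)).
  assert (Q3 := Cmod_ge_0 (f s - peval p s)). assert (Q4 := Cmod_ge_0 (g s - peval q s)).
  unfold K in D2. nra.
Qed.

Lemma poly_approx_pow R0 (f : C -> C) n : poly_approx R0 f -> poly_approx R0 (fun s => f s ^ n).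
Proof.
  intros H. induction n as [|n IH]; simpl; [apply poly_approx_const|]. now apply poly_approx_mult.
Qed.

Lemma poly_approx_csum R0 (f : nat -> C -> C) n :
  (forall k, poly_approx R0 (f k)) -> poly_approx R0 (fun s => csum (fun k => f k s) n).
Proof.
  intros H. induction n as [|n IH]; simpl; [apply poly_approx_const|]. now apply poly_approx_plus.
Qed.

Lemma poly_approx_poch R0 (f : C -> C) n : poly_approx R0 f -> poly_approx R0 (fun s => poch (f s) n).
Proof.
  intros H. induction n as [|n IH]; simpl; [apply poly_approx_const|].
  apply poly_approx_mult; [easy|]. apply poly_approx_plus; [easy|apply poly_approx_const].
Qed.

Lemma INR_inv_small (A eps : R) : (0 < eps)%R -> exists N, (1 <= N)%nat /\ (A / INR N <= eps)%R.
Proof.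
  intros He. destruct (nfloor_ex (Rabs A / eps)) as [N [_ HN]].
  { apply Rmult_le_pos; [apply Rabs_pos|left; now apply Rinv_0_lt_compat]. }
  exists (S N). split; [lia|]. rewrite S_INR. assert (P := pos_INR N).
  assert (Q := Rle_abs A).
  apply Rmult_le_reg_r with (INR N + 1)%R; [lra|].
  replace (A / (INR N + 1) * (INR N + 1))%R with A by (field; lra).
  apply Rmult_lt_compat_r with (r := eps) in HN; [|easy].
  replace (Rabs A / eps * eps)%R with (Rabs A) in HN by (field; lra). lra.
Qed.

Lemma poly_approx_Cexp R0 (f : C -> C) : poly_approx R0 f -> poly_approx R0 (fun s => Cexp (f s)).
Proof.
  intros H. destruct (poly_approx_bounded _ _ H) as [B HB].
  apply poly_approx_unif_cv with (u := fun n s => exp_poly (S n) (f s)).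
  - intros n. apply poly_approx_csum. intros k. apply poly_approx_mult; [|apply poly_approx_const].
    now apply poly_approx_pow.
  - set (B' := Rabs B).
    assert (HB' : forall s, (Cmod s <= R0)%R -> (Cmod (f s) <= B')%R).
    { intros s Hs. eapply Rle_trans; [now apply HB|apply Rle_abs]. }
    assert (PB : (0 <= B')%R) by apply Rabs_pos.
    destruct (pow_le_fact B' PB) as [A [HA HAn]].
    intros eps He.
    destruct (INR_inv_small (B' * A * exp (2 * B')) eps He) as [N [HN1 HN]].
    exists N. intros n s Hn Hs. eapply Rle_trans; [apply exp_poly_error|].
    specialize (HB' s Hs). assert (P := Cmod_ge_0 (f s)).
    assert (PF : (0 < INR (fact n))%R) by apply lt_0_INR, lt_O_fact.
    assert (Pn : (0 < INR N)%R) by (apply lt_0_INR; lia).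
    assert (X : (Cmod (f s) ^ n <= A * INR (fact n) * (/ 2) ^ n)%R).
    { eapply Rle_trans; [|apply HAn]. apply pow_incr. lra. }
    assert (Y : ((/ 2) ^ n <= / INR N)%R).
    { rewrite pow_inv. apply Rinv_le_contravar; [easy|].
      apply Rle_trans with (INR n); [now apply le_INR|].
      clear. induction n as [|n IH]; [simpl; lra|]. rewrite S_INR. simpl.
      assert (1 <= 2 ^ n)%R by (apply pow_R1_Rle; lra). lra. }
    eapply Rle_trans; [|apply HN].
    replace (Cmod (f s) ^ S n / INR (fact n) * exp (2 * Cmod (f s)))%R with
      (Cmod (f s) * (Cmod (f s) ^ n / INR (fact n)) * exp (2 * Cmod (f s)))%R
      by (simpl; field; lra).
    replace (B' * A * exp (2 * B') / INR N)%R with (B' * (A * / INR N) * exp (2 * B'))%R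
      by (field; lra).
    assert (Z : (Cmod (f s) ^ n / INR (fact n) <= A * / INR N)%R).
    { apply Rmult_le_reg_r with (INR (fact n)); [easy|].
      replace (Cmod (f s) ^ n / INR (fact n) * INR (fact n))%R with (Cmod (f s) ^ n)%R
        by (field; lra).
      eapply Rle_trans; [apply X|].
      replace (A * / INR N * INR (fact n))%R with (A * INR (fact n) * / INR N)%R by ring.
      apply Rmult_le_compat_l; [nra|easy]. }
    assert (Z0 : (0 <= Cmod (f s) ^ n / INR (fact n))%R).
    { apply Rmult_le_pos; [now apply pow_le|left; now apply Rinv_0_lt_compat]. }
    apply Rmult_le_compat.
    + now apply Rmult_le_pos.
    + left; apply exp_pos.
    + apply Rmult_le_compat; easy.
    + apply exp_le. lra.
Qed.

Lemma pow_small (q eps : R) : (0 <= q < 1)%R -> (0 < eps)%R ->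
  exists N, (q ^ N <= eps)%R.
Proof.
  intros Hq He. destruct (pow_lt_1_zero q) with (y := eps) as [N HN]; [|easy|].
  - rewrite Rabs_right; lra.
  - exists N. specialize (HN N (le_n _)). apply Rabs_def2 in HN. lra.
Qed.

(** The pole [- b] lies outside the disc, and the geometric series converges there. *)
Lemma poly_approx_inv R0 b : (0 <= R0)%R -> (R0 < Cmod b)%R -> poly_approx R0 (fun s => / (b + s)).
Proof.
  intros H0 Hb.
  assert (B0 : b <> 0) by (apply Cmod_gt_0; lra).
  assert (NZ : forall s, (Cmod s <= R0)%R -> b + s <> 0).
  { intros s Hs E. assert (s = - b) by (replace s with (b + s - b) by ring; rewrite E; ring).
    subst s. rewrite Cmod_opp in Hs. lra. }
  apply poly_approx_unif_cv with (u := fun n s => csum (fun k => / b * (- / b * s) ^ k) n).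
  - intros n. apply poly_approx_csum. intros k. apply poly_approx_mult; [apply poly_approx_const|].
    apply poly_approx_pow, poly_approx_mult; [apply poly_approx_const|apply poly_approx_id].
  - set (q := (R0 / Cmod b)%R).
    assert (Hq : (0 <= q < 1)%R).
    { unfold q. split; [apply Rmult_le_pos; [easy|left; apply Rinv_0_lt_compat; lra]|].
      apply Rmult_lt_reg_r with (Cmod b); [lra|]. field_simplify; lra. }
    assert (G : forall n s, (Cmod s <= R0)%R ->
       csum (fun k => / b * (- / b * s) ^ k) n - / (b + s) = - (- / b * s) ^ n * / (b + s)).
    { intros n s Hs. specialize (NZ s Hs). induction n as [|n IH].
      - simpl. ring.
      - cbn [csum]. replace (csum (fun k => / b * (- / b * s) ^ k) n + / b * (- / b * s) ^ n - / (b + s))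
          with ((csum (fun k => / b * (- / b * s) ^ k) n - / (b + s)) + / b * (- / b * s) ^ n) by ring.
        rewrite IH, Cpow_S. field. now split. }
    intros eps He.
    destruct (pow_small q (eps * (Cmod b - R0)) Hq) as [N HN]; [apply Rmult_lt_0_compat; lra|].
    exists N. intros n s Hn Hs. unfold disc in Hs. rewrite G by easy.
    rewrite Cmod_mult, Cmod_opp, Cmod_pow, Cmod_inv_total, Cmod_mult, Cmod_opp, Cmod_inv_total.
    assert (L : (Cmod b - R0 <= Cmod (b + s))%R).
    { assert (A := Cmod_triangle_rev b (- s)). rewrite Cmod_opp in A.
      replace (b - - s) with (b + s) in A by ring. lra. }
    apply Rmult_le_reg_r with (Cmod (b + s)); [lra|].
    rewrite Rmult_assoc, Rinv_l, Rmult_1_r by lra.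
    apply Rle_trans with (q ^ n)%R.
    + apply pow_incr. unfold q. assert (P := Cmod_ge_0 s).
      assert (PI : (0 < / Cmod b)%R) by (apply Rinv_0_lt_compat; lra). split; [nra|].
      unfold Rdiv. rewrite Rmult_comm. apply Rmult_le_compat_r; lra.
    + apply Rle_trans with (q ^ N)%R.
      * replace n with (N + (n - N))%nat by lia. rewrite pow_add.
        assert (P1 := pow_le q N (proj1 Hq)).
        assert (P2 : (q ^ (n - N) <= 1)%R) by (rewrite <- (pow1 (n - N)); apply pow_incr; lra).
        nra.
      * eapply Rle_trans; [apply HN|]. apply Rmult_le_compat_l; lra.
Qed.

Definition Ccont (f : C -> C) (p : C) : Prop :=
  forall eps : R, (0 < eps)%R -> exists d : R, (0 < d)%R /\
    forall s, (Cmod (s - p) <= d)%R -> (Cmod (f s - f p) <= eps)%R.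

Lemma Ccont_const (c p : C) : Ccont (fun _ => c) p.
Proof.
  intros eps He. exists 1%R. split; [lra|]. intros. replace (c - c) with (RtoC 0) by ring.
  rewrite Cmod_0. lra.
Qed.

Lemma Ccont_id p : Ccont (fun s => s) p.
Proof. intros eps He. exists eps. auto. Qed.

Lemma Ccont_plus (f g : C -> C) p : Ccont f p -> Ccont g p -> Ccont (fun s => f s + g s) p.
Proof.
  intros Hf Hg eps He. destruct (Hf (eps / 2)%R) as [d [D Hd]]; [lra|].
  destruct (Hg (eps / 2)%R) as [d' [D' Hd']]; [lra|].
  exists (Rmin d d'). split; [now apply Rmin_case|]. intros s Hs.
  replace (f s + g s - (f p + g p)) with ((f s - f p) + (g s - g p)) by ring.
  eapply Rle_trans; [apply Cmod_triangle|].
  assert (A := Hd s (Rle_trans _ _ _ Hs (Rmin_l _ _))).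
  assert (A' := Hd' s (Rle_trans _ _ _ Hs (Rmin_r _ _))). lra.
Qed.

Lemma Ccont_mult (f g : C -> C) p : Ccont f p -> Ccont g p -> Ccont (fun s => f s * g s) p.
Proof.
  intros Hf Hg eps He. set (K := (Cmod (f p) + Cmod (g p) + 1)%R).
  assert (P1 := Cmod_ge_0 (f p)). assert (P2 := Cmod_ge_0 (g p)).
  set (e := Rmin 1 (eps / (2 * K))).
  assert (He0 : (0 < e)%R).
  { unfold e. apply Rmin_case; [lra|]. apply Rdiv_lt_0_compat; unfold K; lra. }
  assert (He1 : (e <= 1)%R) by apply Rmin_l.
  assert (He2 : (e * K <= eps)%R).
  { assert (A : (e <= eps / (2 * K))%R) by apply Rmin_r.
    apply Rmult_le_compat_r with (r := K) in A; [|unfold K; lra].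
    replace (eps / (2 * K) * K)%R with (eps / 2)%R in A by (unfold K; field; lra). lra. }
  destruct (Hf e He0) as [d [D Hd]]. destruct (Hg e He0) as [d' [D' Hd']].
  exists (Rmin d d'). split; [now apply Rmin_case|]. intros s Hs.
  replace (f s * g s - f p * g p)
    with ((f s - f p) * (g s - g p) + (f p * (g s - g p) + (f s - f p) * g p)) by ring.
  eapply Rle_trans; [apply Cmod_triangle|].
  eapply Rle_trans; [apply Rplus_le_compat_l, Cmod_triangle|]. rewrite !Cmod_mult.
  assert (A := Hd s (Rle_trans _ _ _ Hs (Rmin_l _ _))).
  assert (A' := Hd' s (Rle_trans _ _ _ Hs (Rmin_r _ _))).
  assert (P3 := Cmod_ge_0 (f s - f p)). assert (P4 := Cmod_ge_0 (g s - g p)).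
  unfold K in He2. nra.
Qed.

Lemma Ccont_inv (f : C -> C) p : f p <> 0 -> Ccont f p -> Ccont (fun s => / f s) p.
Proof.
  intros H0 Hf eps He. assert (Hm := proj1 (Cmod_gt_0 _) H0). set (m := Cmod (f p)) in *.
  destruct (Hf (Rmin (m / 2) (eps * (m / 2 * m)))) as [d [D Hd]].
  { apply Rmin_case; [lra|]. apply Rmult_lt_0_compat; nra. }
  exists d. split; [easy|]. intros s Hs. specialize (Hd s Hs).
  assert (A := Rle_trans _ _ _ Hd (Rmin_l _ _)). assert (A' := Rle_trans _ _ _ Hd (Rmin_r _ _)).
  assert (L : (m / 2 <= Cmod (f s))%R).
  { assert (T := Cmod_triangle_rev (f p) (f s)). rewrite Cmod_sub_comm in T. fold m in T. lra. }
  assert (N1 : f s <> 0) by (apply Cmod_gt_0; lra).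
  assert (N2 : f p <> 0) by (apply Cmod_gt_0; fold m; lra).
  replace (/ f s - / f p) with (- (f s - f p) * / (f s * f p)) by (field; now split).
  rewrite Cmod_mult, Cmod_opp, Cmod_inv_total, Cmod_mult. fold m.
  apply Rmult_le_reg_r with (Cmod (f s) * m)%R; [nra|].
  rewrite Rmult_assoc, Rinv_l, Rmult_1_r by nra.
  eapply Rle_trans; [apply A'|]. apply Rmult_le_compat_l; [lra|]. nra.
Qed.

Lemma Ccont_comp (f g : C -> C) p : Ccont g p -> Ccont f (g p) -> Ccont (fun s => f (g s)) p.
Proof.
  intros Hg Hf eps He. destruct (Hf eps He) as [d [D Hd]]. destruct (Hg d D) as [d' [D' Hd']].
  exists d'. auto.
Qed.

Lemma Ccont_csum (f : nat -> C -> C) n p : (forall k, (k < n)%nat -> Ccont (f k) p) -> Ccont (fun s => csum (fun k => f k s) n) p.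
Proof.
  induction n as [|n IH]; intros H; simpl; [apply Ccont_const|].
  apply Ccont_plus; [apply IH; intros; apply H; lia|apply H; lia].
Qed.

Lemma Ccont_ext (f g : C -> C) p : (forall s, f s = g s) -> Ccont f p -> Ccont g p.
Proof.
  intros E H eps He. destruct (H eps He) as [d [D Hd]]. exists d. split; [easy|].
  intros. rewrite <- !E. auto.
Qed.

Lemma Ccont_peval q p : Ccont (peval q) p.
Proof.
  induction q as [|c q IH]; simpl; [apply Ccont_const|].
  apply Ccont_plus; [apply Ccont_const|]. apply Ccont_mult; [apply Ccont_id|easy].
Qed.

Lemma poly_approx_Ccont R0 (f : C -> C) p : (Cmod p < R0)%R -> poly_approx R0 f -> Ccont f p.
Proof.
  intros Hp H eps He. destruct (H (eps / 3)%R) as [q Hq]; [lra|].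
  destruct (Ccont_peval q p (eps / 3)%R) as [d [D Hd]]; [lra|].
  exists (Rmin d (R0 - Cmod p)). split; [apply Rmin_case; lra|]. intros s Hs.
  assert (A := Hd s (Rle_trans _ _ _ Hs (Rmin_l _ _))).
  assert (A' := Rle_trans _ _ _ Hs (Rmin_r _ _)).
  assert (B := Hq p (Rlt_le _ _ Hp)).
  assert (B' : (Cmod (f s - peval q s) <= eps / 3)%R).
  { apply Hq. assert (T := Cmod_triangle_rev s p). lra. }
  replace (f s - f p) with ((f s - peval q s) + ((peval q s - peval q p) - (f p - peval q p))) by ring.
  eapply Rle_trans; [apply Cmod_triangle|].
  assert (T := Cmod_triangle_sub (peval q s - peval q p) (f p - peval q p)). lra.
Qed.

(** * The reciprocal Gamma function *)

(** The reciprocals of Gauss's approximants have no poles, so that they converge uniformly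
    on every disc. *)
Definition RGn (n : nat) (z : C) : C :=
  poch z (S n) * / INR (fact n) * Cexp (- (z * ln (INR n))).

Definition RG (z : C) : C := Clim_seq (fun n => RGn n z).

Lemma Cpower_INR (n : nat) (z : C) : (1 <= n)%nat -> Cpower (INR n) z = Cexp (z * ln (INR n)).
Proof.
  intros Hn. assert (P : (0 < INR n)%R) by (apply lt_0_INR; lia).
  unfold Cpower. do 2 f_equal. unfold Clog. rewrite Cmod_INR.
  apply C_eq_of_Re_Im; [reflexivity|]. change (Arg (INR n) = 0%R).
  unfold Arg. rewrite im_RtoC, re_RtoC, Cmod_INR.
  destruct (Rle_dec 0 0) as [_|F]; [|lra].
  replace (INR n / INR n)%R with 1%R by (field; lra). apply acos_1.
Qed.

Lemma Gamma_term (n : nat) (z : C) : (1 <= n)%nat ->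
  INR (fact n) * Cpower (INR n) z / poch z (S n) = / RGn n z.
Proof.
  intros Hn. unfold RGn. rewrite Cpower_INR by easy.
  rewrite !Cinv_mult_total, Cexp_opp, !Cinv_inv_total. unfold Cdiv. ring.
Qed.

Lemma ln_succ_bounds (n : nat) : (1 <= n)%nat ->
  (/ (INR n + 1) <= ln (INR n + 1) - ln (INR n) <= / INR n)%R.
Proof.
  intros Hn. assert (P : (0 < INR n)%R) by (apply lt_0_INR; lia).
  assert (L : forall x, (0 < x)%R -> (ln x <= x - 1)%R).
  { intros x Hx. generalize (exp_ineq1_le (ln x)). rewrite exp_ln by easy. lra. }
  split.
  - assert (A := L (INR n / (INR n + 1))%R).
    rewrite ln_div in A by lra.
    assert (E : (INR n / (INR n + 1) - 1 = - / (INR n + 1))%R) by (field; lra).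
    rewrite E in A. assert (0 < INR n / (INR n + 1))%R by (apply Rdiv_lt_0_compat; lra).
    specialize (A ltac:(easy)). lra.
  - assert (A := L ((INR n + 1) / INR n)%R).
    rewrite ln_div in A by lra.
    assert (E : ((INR n + 1) / INR n - 1 = / INR n)%R) by (field; lra).
    rewrite E in A. apply A. apply Rdiv_lt_0_compat; lra.
Qed.

Lemma RGn_succ (n : nat) (z : C) : (1 <= n)%nat ->
  RGn (S n) z =
  RGn n z * ((1 + z / (INR n + 1)%R) * Cexp (- (z * (ln (INR n + 1) - ln (INR n))%R))).
Proof.
  intros Hn. unfold RGn.
  replace (- (z * ln (INR (S n)))) with
    (- (z * ln (INR n)) + - (z * (ln (INR n + 1) - ln (INR n))%R)).
  2:{ rewrite RtoC_minus, S_INR. ring. }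
  rewrite Cexp_plus. cbn [poch]. rewrite S_INR.
  replace (INR (fact (S n))) with ((INR n + 1) * INR (fact n))%R
    by (rewrite <- S_INR, <- mult_INR; easy).
  assert (N : RtoC (INR n + 1) <> 0) by (rewrite <- S_INR; apply INR_C_neq0; lia).
  assert (N' := fact_C_neq0 n). rewrite !RtoC_mult. field. now split.
Qed.

(** The second-order cancellation between [1 + z/(n+1)] and [(1+1/n)^(-z)] makes the
    infinite product converge. *)
Lemma RGn_increment (R0 : R) : (0 <= R0)%R ->
  exists A, (0 <= A)%R /\ forall n z, (1 <= n)%nat -> (R0 <= INR n)%R -> (Cmod z <= R0)%R ->
    (Cmod (RGn (S n) z - RGn n z) <= Cmod (RGn n z) * (A * (/ INR n - / INR (S n))))%R.
Proof.
  intros HR. assert (E2 := exp_pos 2).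
  exists (R0 + R0 * R0 + 2 * (1 + R0) * (exp 2 * (R0 * R0)))%R.
  assert (Q1 : (0 <= R0 * R0)%R) by nra. assert (Q2 : (0 <= exp 2 * (R0 * R0))%R) by nra.
  split; [nra|].
  intros n z Hn HRn Hz. rewrite RGn_succ by easy.
  assert (P : (1 <= INR n)%R) by (apply (le_INR 1); lia).
  set (d := (ln (INR n + 1) - ln (INR n))%R).
  destruct (ln_succ_bounds n Hn) as [L1 L2]. fold d in L1, L2.
  set (w := - (z * d)). set (k := z / (INR n + 1)%R).
  replace (RGn n z * ((1 + k) * Cexp w) - RGn n z) with
    (RGn n z * ((k + w) + (k * w + (1 + k) * (Cexp w - 1 - w)))) by ring.
  rewrite Cmod_mult. apply Rmult_le_compat_l; [apply Cmod_ge_0|].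
  rewrite S_INR. assert (I1 : (0 < / (INR n + 1))%R) by (apply Rinv_0_lt_compat; lra).
  assert (N0 : RtoC (INR n + 1) <> 0) by (intros E; apply RtoC_inj in E; lra).
  assert (Hk : Cmod k = (Cmod z * / (INR n + 1))%R).
  { unfold k, Cdiv. rewrite Cmod_mult, Cmod_inv_total, Cmod_R, Rabs_right by lra. easy. }
  assert (Hw : Cmod w = (Cmod z * d)%R).
  { unfold w. rewrite Cmod_opp, Cmod_mult, Cmod_R, Rabs_right by lra. easy. }
  assert (Hkw : Cmod (k + w) = (Cmod z * (d - / (INR n + 1)))%R).
  { replace (k + w) with (- (z * (d - / (INR n + 1))%R)).
    - rewrite Cmod_opp, Cmod_mult, Cmod_R, Rabs_right by lra. easy.
    - unfold k, w. rewrite RtoC_minus, RtoC_inv by lra. field. easy. }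
  assert (P0 := Cmod_ge_0 z).
  assert (D : (/ INR n - / (INR n + 1) = / INR n * / (INR n + 1))%R) by (field; lra).
  set (D0 := (/ INR n * / (INR n + 1))%R) in *. rewrite D.
  assert (In : (0 < / INR n)%R) by (apply Rinv_0_lt_compat; lra).
  assert (PD0 : (0 < D0)%R) by (apply Rmult_lt_0_compat; easy).
  assert (In2 : (/ INR n * / INR n <= 2 * D0)%R).
  { unfold D0. apply Rmult_le_reg_r with (INR n * INR n * (INR n + 1))%R; [nra|].
    replace (/ INR n * / INR n * (INR n * INR n * (INR n + 1)))%R with (INR n + 1)%R by (field; lra).
    replace (2 * (/ INR n * / (INR n + 1)) * (INR n * INR n * (INR n + 1)))%R with (2 * INR n)%R
      by (field; lra). lra. }
  assert (W1 : (Cmod w <= R0 * / INR n)%R) by (rewrite Hw; apply Rmult_le_compat; lra).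
  assert (W2 : (Cmod w <= 1)%R).
  { eapply Rle_trans; [apply W1|]. apply Rmult_le_reg_r with (INR n); [lra|].
    rewrite Rmult_assoc, Rinv_l by lra. lra. }
  assert (T1 : (Cmod (k + w) <= R0 * D0)%R).
  { rewrite Hkw. apply Rmult_le_compat; lra. }
  assert (K1 : (Cmod k <= R0 * / (INR n + 1))%R) by (rewrite Hk; apply Rmult_le_compat_r; lra).
  assert (K2 : (Cmod k <= R0)%R).
  { eapply Rle_trans; [apply K1|]. rewrite <- (Rmult_1_r R0) at 2.
    apply Rmult_le_compat_l; [easy|]. rewrite <- Rinv_1. apply Rinv_le_contravar; lra. }
  assert (T2 : (Cmod (k * w) <= R0 * R0 * D0)%R).
  { rewrite Cmod_mult. unfold D0.
    replace (R0 * R0 * (/ INR n * / (INR n + 1)))%R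
      with ((R0 * / (INR n + 1)) * (R0 * / INR n))%R by ring.
    apply Rmult_le_compat; auto using Cmod_ge_0. }
  assert (T3 : (Cmod ((1 + k) * (Cexp w - 1 - w)) <= 2 * (1 + R0) * (exp 2 * (R0 * R0)) * D0)%R).
  { rewrite Cmod_mult.
    replace (2 * (1 + R0) * (exp 2 * (R0 * R0)) * D0)%R with
      ((1 + R0) * (exp 2 * (R0 * R0 * (2 * D0))))%R by ring.
    apply Rmult_le_compat; try apply Cmod_ge_0.
    - eapply Rle_trans; [apply Cmod_triangle|]. rewrite Cmod_1. lra.
    - eapply Rle_trans; [apply Cexp_order2; easy|]. apply Rmult_le_compat_l; [lra|].
      apply Rle_trans with ((R0 * / INR n) ^ 2)%R.
      + apply pow_incr. split; [apply Cmod_ge_0|easy].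
      + replace ((R0 * / INR n) ^ 2)%R with (R0 * R0 * (/ INR n * / INR n))%R by ring.
        apply Rmult_le_compat_l; [nra|easy]. }
  eapply Rle_trans; [apply Cmod_triangle|].
  assert (T := Cmod_triangle (k * w) ((1 + k) * (Cexp w - 1 - w))). lra.
Qed.

(** Since [n0] is large against [A], the relative increments add up to at most [1/2], and the
    sequence never moves further than half the size of its first term. *)
Lemma product_bounds (u : nat -> C) (n0 : nat) (A : R) :
  (1 <= n0)%nat -> (0 <= A)%R -> (4 * A <= INR n0)%R ->
  (forall n, (n0 <= n)%nat ->
     (Cmod (u (S n) - u n) <= Cmod (u n) * (A * (/ INR n - / INR (S n))))%R) ->
  forall n, (n0 <= n)%nat ->
    (Cmod (u n - u n0) <= Cmod (u n0) / 2)%R /\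
    (Cmod (u (S n) - u n) <= 2 * Cmod (u n0) * A * (/ INR n - / INR (S n)))%R.
Proof.
  intros H1 HA H4 Hu. set (M := Cmod (u n0)). assert (PM : (0 <= M)%R) by apply Cmod_ge_0.
  assert (P0 : (1 <= INR n0)%R) by (apply (le_INR 1); lia).
  assert (Dec : forall n, (n0 <= n)%nat -> (0 <= / INR n - / INR (S n))%R).
  { intros n Hn. assert (1 <= INR n)%R by (apply (le_INR 1); lia). rewrite S_INR.
    assert (/ (INR n + 1) <= / INR n)%R by (apply Rinv_le_contravar; lra). lra. }
  assert (Half : forall n, (n0 <= n)%nat ->
     (Cmod (u n - u n0) <= 2 * M * A * (/ INR n0 - / INR n))%R ->
     (Cmod (u n - u n0) <= M / 2)%R).
  { intros n Hn H. eapply Rle_trans; [apply H|].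
    assert (1 <= INR n)%R by (apply (le_INR 1); lia).
    assert (0 < / INR n)%R by (apply Rinv_0_lt_compat; lra).
    assert (A * / INR n0 <= / 4)%R.
    { apply Rmult_le_reg_r with (INR n0); [lra|]. rewrite Rmult_assoc, Rinv_l by lra. lra. }
    assert (0 <= M * A)%R by nra. nra. }
  assert (Inc : forall n, (n0 <= n)%nat -> (Cmod (u n - u n0) <= M / 2)%R ->
    (Cmod (u (S n) - u n) <= 2 * M * A * (/ INR n - / INR (S n)))%R).
  { intros n Hn H. eapply Rle_trans; [now apply Hu|]. specialize (Dec n Hn).
    rewrite <- Rmult_assoc. apply Rmult_le_compat_r; [easy|].
    apply Rmult_le_compat_r; [easy|].
    assert (T := Cmod_triangle_rev (u n) (u n0)). fold M in T. lra. }
  assert (I : forall n, (n0 <= n)%nat ->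
     (Cmod (u n - u n0) <= 2 * M * A * (/ INR n0 - / INR n))%R).
  { intros n Hn. induction Hn as [|n Hn IH].
    - replace (u n0 - u n0) with (RtoC 0) by ring. rewrite Cmod_0. lra.
    - replace (u (S n) - u n0) with ((u (S n) - u n) + (u n - u n0)) by ring.
      eapply Rle_trans; [apply Cmod_triangle|].
      assert (A1 := Inc n Hn (Half n Hn IH)). lra. }
  intros n Hn. split; [apply Half; auto|apply Inc; auto].
Qed.

Lemma poly_approx_RGn (R0 : R) (f : C -> C) (n : nat) :
  poly_approx R0 f -> poly_approx R0 (fun s => RGn n (f s)).
Proof.
  intros H. unfold RGn.
  apply poly_approx_mult.
  - apply poly_approx_mult; [now apply poly_approx_poch|apply poly_approx_const].
  - apply poly_approx_Cexp.
    apply (poly_approx_ext R0 (fun s => (- ln (INR n))%R * f s)).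
    + intros. rewrite RtoC_opp. ring.
    + apply poly_approx_mult; [apply poly_approx_const|easy].
Qed.

(** The lower bound excludes that the limit vanishes where the approximants do not, and it
    lets their inverses converge uniformly as well. *)
Lemma RGn_control (R0 : R) : (0 <= R0)%R ->
  exists n0, (1 <= n0)%nat /\
    unif_cv (disc R0) RGn RG /\
    forall n z, (n0 <= n)%nat -> (Cmod z <= R0)%R -> (Cmod (RGn n0 z) / 2 <= Cmod (RGn n z))%R.
Proof.
  intros HR. destruct (RGn_increment R0 HR) as [A [HA Hinc]].
  destruct (nfloor_ex (R0 + 4 * A)) as [N [_ HN]]; [lra|].
  set (n0 := S N). assert (Hn0 : (R0 + 4 * A <= INR n0)%R) by (unfold n0; rewrite S_INR; lra).
  assert (H1 : (1 <= n0)%nat) by (unfold n0; lia).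
  assert (PB : forall z, (Cmod z <= R0)%R -> forall n, (n0 <= n)%nat ->
    (Cmod (RGn n z - RGn n0 z) <= Cmod (RGn n0 z) / 2)%R /\
    (Cmod (RGn (S n) z - RGn n z) <= 2 * Cmod (RGn n0 z) * A * (/ INR n - / INR (S n)))%R).
  { intros z Hz. apply (product_bounds (fun n => RGn n z) n0 A); try easy; [lra|].
    intros n Hn. apply Hinc; try easy; [lia|]. apply le_INR in Hn. lra. }
  exists n0. split; [easy|]. split.
  - destruct (poly_approx_bounded R0 (RGn n0)) as [B HB].
    { apply (poly_approx_RGn R0 (fun s => s)), poly_approx_id. }
    set (B' := (2 * Rabs B * A)%R).
    assert (PB' : (0 <= B')%R).
    { unfold B'. assert (Q := Rabs_pos B). nra. }
    apply (unif_cv_telescope (disc R0) RGn (fun n => (B' / INR n)%R) n0).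
    + intros n Hn. apply Rmult_le_pos; [easy|]. left. apply Rinv_0_lt_compat, lt_0_INR. lia.
    + intros eps He. destruct (INR_inv_small B' eps He) as [M [HM1 HM]].
      exists (max M n0). split; [lia|]. eapply Rle_trans; [|apply HM].
      apply Rmult_le_compat_l; [easy|]. apply Rinv_le_contravar; [apply lt_0_INR; lia|].
      apply le_INR. lia.
    + intros n z Hn Hz. destruct (PB z Hz n Hn) as [_ I].
      eapply Rle_trans; [apply I|].
      replace (B' / INR n - B' / INR (S n))%R with (B' * (/ INR n - / INR (S n)))%R
        by (unfold Rdiv; ring).
      apply Rmult_le_compat_r.
      * assert (1 <= INR n)%R by (apply (le_INR 1); lia). rewrite S_INR.
        assert (/ (INR n + 1) <= / INR n)%R by (apply Rinv_le_contravar; lra). lra.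
      * unfold B'. apply Rmult_le_compat_r; [easy|].
        assert (Cmod (RGn n0 z) <= Rabs B)%R by (eapply Rle_trans; [now apply HB|apply Rle_abs]).
        lra.
  - intros n z Hn Hz. destruct (PB z Hz n Hn) as [I _].
    assert (T := Cmod_triangle_rev (RGn n0 z) (RGn n z)). rewrite Cmod_sub_comm in T. lra.
Qed.

Lemma RG_unif_cv (R0 : R) : (0 <= R0)%R -> unif_cv (disc R0) RGn RG.
Proof. intros H. now destruct (RGn_control R0 H) as [n0 [_ [H1 _]]]. Qed.

Lemma poly_approx_RG (R0 : R) (f : C -> C) : poly_approx R0 f -> poly_approx R0 (fun s => RG (f s)).
Proof.
  intros H. destruct (poly_approx_bounded _ _ H) as [B HB].
  apply poly_approx_unif_cv with (u := fun n s => RGn n (f s)).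
  - intros n. now apply poly_approx_RGn.
  - intros eps He. destruct (RG_unif_cv (Rabs B) (Rabs_pos B) eps He) as [N HN].
    exists N. intros n s Hn Hs. apply HN; [easy|]. red.
    eapply Rle_trans; [now apply HB|apply Rle_abs].
Qed.

Lemma Ccont_RG (p : C) : Ccont RG p.
Proof.
  apply (poly_approx_Ccont (Cmod p + 1)); [lra|].
  apply (poly_approx_RG _ (fun s => s)), poly_approx_id.
Qed.

Lemma RG_limit (z : C) : unif_cv (fun s => s = z) RGn RG.
Proof.
  apply (unif_cv_sub (disc (Cmod z))); [apply RG_unif_cv, Cmod_ge_0|]. intros s ->. apply Rle_refl.
Qed.

Lemma poch_neq0 (z : C) (n : nat) : ~ nonpos_integer z -> poch z n <> 0.
Proof.
  intros H. induction n as [|n IH]; [apply C1_nz|]. cbn [poch].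
  apply Cmult_neq_0; [easy|]. intros E. apply H. exists n.
  rewrite RtoC_opp. replace z with (z + INR n - INR n) by ring. rewrite E. ring.
Qed.

Lemma poch_nonpos (k n : nat) : (k < n)%nat -> poch (- INR k)%R n = 0.
Proof.
  induction n as [|n IH]; intros H; [lia|]. cbn [poch].
  destruct (Nat.eq_dec k n) as [->|E].
  - replace ((- INR n)%R + INR n) with (RtoC 0) by (rewrite RtoC_opp; ring). ring.
  - rewrite IH by lia. ring.
Qed.

Lemma RGn_neq0 (n : nat) (z : C) : ~ nonpos_integer z -> RGn n z <> 0.
Proof.
  intros H. apply Cmult_neq_0; [apply Cmult_neq_0|apply Cexp_neq0].
  - now apply poch_neq0.
  - intros E. apply (f_equal (fun x => INR (fact n) * x)) in E.
    rewrite Cinv_r in E by apply fact_C_neq0. apply C1_nz. rewrite E. ring.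
Qed.

Lemma RG_neq0 (z : C) : ~ nonpos_integer z -> RG z <> 0.
Proof.
  intros H. destruct (RGn_control (Cmod z) (Cmod_ge_0 z)) as [n0 [_ [C1 C2]]].
  assert (P := proj1 (Cmod_gt_0 _) (RGn_neq0 n0 z H)).
  destruct (unif_cv_inv (fun s => s = z) RGn RG (Cmod (RGn n0 z) / 2) n0) as [L _].
  - lra.
  - intros n x Hn ->. now apply C2; [|apply Rle_refl].
  - apply RG_limit.
  - apply Cmod_gt_0. specialize (L z eq_refl). lra.
Qed.

Lemma RG_nonpos (k : nat) : RG (- INR k)%R = 0.
Proof.
  apply Clim_seq_eq. intros eps He. exists k. intros n Hn. unfold RGn.
  rewrite poch_nonpos by lia.
  replace (_ - 0) with (RtoC 0) by ring. rewrite Cmod_0. lra.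
Qed.

(** At a pole both sides are [0], so that the identity has no exceptions. *)
Lemma Gamma_RG (z : C) : Gamma z = / RG z.
Proof.
  destruct (classic (nonpos_integer z)) as [[k ->]|H].
  - rewrite RG_nonpos, Cinv_0. apply Clim_seq_eq. intros eps He. exists k. intros n Hn.
    rewrite poch_nonpos by lia. unfold Cdiv. rewrite Cinv_0.
    replace (_ - 0) with (RtoC 0) by ring. rewrite Cmod_0. lra.
  - destruct (RGn_control (Cmod z) (Cmod_ge_0 z)) as [n0 [_ [C1 C2]]].
    assert (P := proj1 (Cmod_gt_0 _) (RGn_neq0 n0 z H)).
    destruct (unif_cv_inv (fun s => s = z) RGn RG (Cmod (RGn n0 z) / 2) n0) as [_ L].
    + lra.
    + intros n x Hn ->. now apply C2; [|apply Rle_refl].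
    + apply RG_limit.
    + apply (unif_cv_Clim (fun s => s = z)
        (fun n s => INR (fact n) * Cpower (INR n) s / poch s (S n)) (fun s => / RG s)); [|easy].
      apply (unif_cv_ext_loc _ _ _ _ 1%nat) with (2 := L).
      intros n x Hn _. now rewrite Gamma_term.
Qed.

Lemma poch_first (z : C) (n : nat) : poch z (S n) = z * poch (z + 1) n.
Proof.
  induction n as [|n IH]; [simpl; ring|].
  change (poch z (S (S n))) with (poch z (S n) * (z + INR (S n))).
  rewrite IH. cbn [poch]. rewrite S_INR, RtoC_plus. ring.
Qed.

Lemma poch_add (z : C) (n m : nat) : poch z (n + m) = poch z n * poch (z + INR n) m.
Proof.
  induction m as [|m IH].
  - rewrite Nat.add_0_r. simpl. ring.
  - rewrite Nat.add_succ_r. cbn [poch]. rewrite IH, plus_INR, RtoC_plus. ring.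
Qed.

Lemma unif_cv_one_plus_inv (X : Type) (D : X -> Prop) (w : X -> C) (B : R) :
  (forall x, D x -> (Cmod (w x) <= B)%R) ->
  unif_cv D (fun n x => 1 + w x / INR n) (fun _ => RtoC 1).
Proof.
  intros HB eps He. destruct (INR_inv_small B eps He) as [N [H1 HN]]. exists N.
  intros n x Hn Hx. replace (1 + w x / INR n - 1) with (w x / INR n) by ring.
  assert (P : (0 < INR N)%R) by (apply lt_0_INR; lia).
  unfold Cdiv. rewrite Cmod_mult, Cmod_inv_total, Cmod_INR.
  eapply Rle_trans; [|apply HN].
  apply Rmult_le_compat; auto using Cmod_ge_0.
  - left. apply Rinv_0_lt_compat, lt_0_INR. lia.
  - apply Rinv_le_contravar; [easy|now apply le_INR].
Qed.

(** The approximants satisfy the recurrence up to the factor [1 + (z + 1) / n]. *)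
Lemma RG_rec (z : C) : RG z = z * RG (z + 1).
Proof.
  set (D := fun s : C => s = z).
  assert (L1 : unif_cv D (fun n s => RGn n s * (1 + (s + 1) / INR n)) (fun s => RG s * 1)).
  { apply unif_cv_mult with (B := (Cmod (RG z) + 1)%R).
    - intros s ->. lra.
    - intros. rewrite Cmod_1. generalize (Cmod_ge_0 (RG z)). lra.
    - apply RG_limit.
    - apply (unif_cv_one_plus_inv C D (fun s => s + 1) (Cmod (z + 1))). intros s ->. lra. }
  assert (L2 : unif_cv D (fun n s => s * RGn n (s + 1)) (fun s => s * RG (s + 1))).
  { apply unif_cv_scal with (B := Cmod z); [intros s ->; lra|].
    intros eps He. destruct (RG_limit (z + 1) eps He) as [N HN]. exists N.
    intros n s Hn ->. now apply HN. }
  assert (E : RG z * 1 = z * RG (z + 1)).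
  { apply (unif_cv_unique D (fun n s => s * RGn n (s + 1)) (fun s => RG s * 1)
             (fun s => s * RG (s + 1))); [|exact L2|easy].
    apply (unif_cv_ext_loc _ _ _ _ 1%nat) with (2 := L1). intros n s Hn _.
    unfold RGn. rewrite poch_first. cbn [poch].
    replace (- ((s + 1) * ln (INR n))) with (- (s * ln (INR n)) + - RtoC (ln (INR n))) by ring.
    rewrite Cexp_plus, (Cexp_opp (ln (INR n))), Cexp_RtoC, exp_ln by (apply lt_0_INR; lia).
    assert (N1 := INR_C_neq0 n ltac:(lia)). assert (N2 := fact_C_neq0 n). field. now split. }
  rewrite <- E. ring.
Qed.

Lemma RG_shift (z : C) (n : nat) : RG z = poch z n * RG (z + INR n).
Proof.
  induction n as [|n IH].
  - simpl. rewrite Cplus_0_r. ring.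
  - rewrite IH, (RG_rec (z + INR n)). cbn [poch]. rewrite S_INR, RtoC_plus, Cplus_assoc. ring.
Qed.

Lemma poch_1 (n : nat) : poch 1 n = INR (fact n).
Proof.
  induction n as [|n IH]; [easy|]. cbn [poch]. rewrite IH.
  replace (fact (S n)) with (S n * fact n)%nat by easy. rewrite mult_INR, S_INR, RtoC_mult, RtoC_plus.
  ring.
Qed.

Lemma RG_1 : RG 1 = 1.
Proof.
  apply (unif_cv_unique (fun s => s = RtoC 1) RGn RG (fun _ => RtoC 1)); [apply RG_limit| |easy].
  apply (unif_cv_ext_loc _ (fun n _ => 1 + 1 / INR n) _ _ 1%nat).
  - intros n x Hn ->. unfold RGn.
    replace (- (1 * ln (INR n))) with (- RtoC (ln (INR n))) by ring.
    rewrite Cexp_opp, Cexp_RtoC, exp_ln by (apply lt_0_INR; lia).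
    cbn [poch]. rewrite poch_1.
    assert (N1 := INR_C_neq0 n ltac:(lia)). assert (N2 := fact_C_neq0 n). field. now split.
  - apply (unif_cv_one_plus_inv C _ (fun _ => 1) 1). intros. rewrite Cmod_1. lra.
Qed.

Lemma poly_approx_opp (R0 : R) (f : C -> C) : poly_approx R0 f -> poly_approx R0 (fun s => f (- s)).
Proof.
  intros H eps He. destruct (H eps He) as [p Hp].
  assert (E : exists q, forall s, peval q s = peval p (- s)).
  { clear. induction p as [|c p [q Hq]]; [exists nil; easy|].
    destruct (peval_scal (- (1)) q) as [r Hr]. exists (c :: r). intros s. simpl.
    rewrite Hr, Hq. ring. }
  destruct E as [q Hq]. exists q. intros s Hs. rewrite Hq. apply Hp. now rewrite Cmod_opp.
Qed.

(** All poles of [Gamma (b + s)] lie outside the disc, so Gauss's approximants of Gamma are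
    approximable there; they converge uniformly because those of [RG] stay away from [0]. *)
Lemma poly_approx_inv_RG (R0 : R) (b : C) : (0 <= R0)%R ->
  (forall i : nat, (R0 < Cmod (b + INR i))%R) -> poly_approx R0 (fun s => / RG (b + s)).
Proof.
  intros HR Hb.
  assert (PA : forall n, poly_approx R0 (fun s => / RGn n (b + s))).
  { intros n. unfold RGn.
    apply (poly_approx_ext R0 (fun s => / poch (b + s) (S n) * INR (fact n) *
        Cexp ((b + s) * ln (INR n)))).
    { intros s _. rewrite !Cinv_mult_total, Cexp_opp, !Cinv_inv_total. ring. }
    assert (Haff : poly_approx R0 (fun s => b + s)).
    { apply poly_approx_plus; [apply poly_approx_const|apply poly_approx_id]. }
    apply poly_approx_mult.
    - apply poly_approx_mult; [|apply poly_approx_const].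
      induction (S n) as [|m IH].
      + apply (poly_approx_ext R0 (fun _ => RtoC 1)); [|apply poly_approx_const].
        intros. simpl. field.
      + apply (poly_approx_ext R0 (fun s => / poch (b + s) m * / ((b + INR m) + s))).
        * intros s _. cbn [poch]. rewrite Cinv_mult_total. do 2 f_equal. ring.
        * apply poly_approx_mult; [easy|]. now apply poly_approx_inv.
    - apply poly_approx_Cexp, poly_approx_mult; [easy|apply poly_approx_const]. }
  destruct (RGn_control (Cmod b + R0)) as [n0 [_ [C1 C2]]].
  { generalize (Cmod_ge_0 b). lra. }
  destruct (poly_approx_bounded _ _ (PA n0)) as [B HB].
  assert (HD : forall s, (Cmod s <= R0)%R -> (Cmod (b + s) <= Cmod b + R0)%R).
  { intros s Hs. eapply Rle_trans; [apply Cmod_triangle|]. lra. }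
  set (B' := (Rabs B + 1)%R).
  assert (PB : (0 < B')%R) by (unfold B'; generalize (Rabs_pos B); lra).
  destruct (unif_cv_inv (disc R0) (fun n s => RGn n (b + s)) (fun s => RG (b + s))
              (/ B' / 2) n0) as [_ L].
  - apply Rdiv_lt_0_compat; [now apply Rinv_0_lt_compat|lra].
  - intros n s Hn Hs. eapply Rle_trans; [|apply C2; [easy|now apply HD]].
    apply Rmult_le_compat_r; [lra|]. specialize (HB s Hs). rewrite Cmod_inv_total in HB.
    assert (P : (0 < Cmod (RGn n0 (b + s)))%R).
    { apply Cmod_gt_0, RGn_neq0. intros [k E]. specialize (Hb k).
      replace (b + INR k) with (- s) in Hb.
      - rewrite Cmod_opp in Hb. unfold disc in Hs. lra.
      - replace b with (b + s - s) by ring. rewrite E, RtoC_opp. ring. }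
    rewrite <- (Rinv_inv (Cmod (RGn n0 (b + s)))). apply Rinv_le_contravar.
    + now apply Rinv_0_lt_compat.
    + unfold B'. generalize (Rle_abs B). lra.
  - intros eps He. destruct (C1 eps He) as [N HN]. exists N. intros n s Hn Hs.
    apply HN; [easy|]. now apply HD.
  - now apply poly_approx_unif_cv with (u := fun n s => / RGn n (b + s)).
Qed.

(** * Decay of the Gamma function on vertical lines *)

(** The factor by which [|poch (u + i t) n|^2] exceeds [|poch u n|^2]. *)
Fixpoint vprod (u t : R) (n : nat) : R :=
  match n with O => 1 | S k => vprod u t k * (1 + t ^ 2 / (u + INR k) ^ 2) end%R.

Lemma Cmod_sqr (x y : R) : (Cmod (x, y) ^ 2 = x ^ 2 + y ^ 2)%R.
Proof. rewrite Cmod2_alt. easy. Qed.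

Lemma vprod_poch (u t : R) (n : nat) : (0 < u)%R ->
  (Cmod (poch (u, t) n) ^ 2 = Cmod (poch u n) ^ 2 * vprod u t n)%R.
Proof.
  intros Hu. induction n as [|n IH].
  - simpl. rewrite Cmod_1. ring.
  - cbn [poch vprod]. rewrite !Cmod_mult, !Rpow_mult_distr, IH.
    rewrite <- RtoC_plus, Cmod_R, pow2_abs.
    replace ((u, t) + INR n) with ((u + INR n)%R, t)
      by (unfold Cplus, RtoC; simpl; f_equal; ring).
    rewrite Cmod_sqr. assert (P := pos_INR n). field. lra.
Qed.

Lemma RGn_vertical (n : nat) (u t : R) : (0 < u)%R ->
  (Cmod (RGn n (u, t)) ^ 2 = Cmod (RGn n u) ^ 2 * vprod u t (S n))%R.
Proof.
  intros Hu. unfold RGn. rewrite !Cmod_mult, !Rpow_mult_distr, vprod_poch by easy.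
  rewrite !Cmod_Cexp.
  replace (Re (- ((u, t) * ln (INR n)))) with (Re (- (u * ln (INR n)))) by (simpl; ring).
  ring.
Qed.

Lemma vprod_abs (u t : R) (n : nat) : vprod u (Rabs t) n = vprod u t n.
Proof. induction n as [|n IH]; cbn [vprod]; [easy|]. now rewrite IH, pow2_abs. Qed.

(** An antiderivative of [x |-> ln (1 + t^2 / x^2)], which tends to [PI t] at infinity. *)
Definition vprim (t x : R) : R := (x * ln (1 + t ^ 2 / x ^ 2) + 2 * t * atan (x / t))%R.

Lemma is_derive_vprim (t y : R) : (0 < t)%R -> (0 < y)%R ->
  is_derive (vprim t) y (ln (1 + t ^ 2 / y ^ 2)).
Proof.
  intros Ht Hy. assert (P : (0 < t ^ 2 / y ^ 2)%R) by (apply Rdiv_lt_0_compat; nra).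
  assert (E : (t * (t * 1) * / (y * (y * 1)) = t ^ 2 / y ^ 2)%R) by (field; lra).
  unfold vprim. auto_derive; rewrite E.
  - repeat split; nra.
  - field. repeat split; nra.
Qed.

Lemma vprim_step (t x : R) : (0 < t)%R -> (0 < x)%R ->
  (ln (1 + t ^ 2 / (x + 1) ^ 2) <= vprim t (x + 1) - vprim t x <= ln (1 + t ^ 2 / x ^ 2))%R.
Proof.
  intros Ht Hx.
  destruct (MVT_gen (vprim t) x (x + 1) (fun y => ln (1 + t ^ 2 / y ^ 2))) as [c [Hc E]].
  - intros y Hy. rewrite Rmin_left, Rmax_right in Hy by lra. apply is_derive_vprim; lra.
  - intros y Hy. rewrite Rmin_left, Rmax_right in Hy by lra.
    apply continuity_pt_filterlim, (ex_derive_continuous (vprim t)).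
    eexists. apply is_derive_vprim; lra.
  - rewrite Rmin_left, Rmax_right in Hc by lra. rewrite E.
    replace (x + 1 - x)%R with 1%R by ring. rewrite Rmult_1_r.
    assert (M : forall y z, (0 < y <= z)%R ->
      (ln (1 + t ^ 2 / z ^ 2) <= ln (1 + t ^ 2 / y ^ 2))%R).
    { intros y z Hyz. apply ln_le.
      - assert (0 < t ^ 2 / z ^ 2)%R by (apply Rdiv_lt_0_compat; nra). lra.
      - apply Rplus_le_compat_l, Rmult_le_compat_l; [nra|].
        apply Rinv_le_contravar; [nra|]. apply pow_incr. lra. }
    split; apply M; lra.
Qed.

(** The sum of the [ln (1 + t^2 / (u + k)^2)] is compared with the integral of
    [ln (1 + t^2 / x^2)]. *)
Lemma vprod_bounds (u t : R) (n : nat) : (0 < t)%R -> (0 < u)%R ->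
  (exp (vprim t (u + INR n) - vprim t u) <= vprod u t n)%R /\
  (vprod u t (S n) <= (1 + t ^ 2 / u ^ 2) * exp (vprim t (u + INR n) - vprim t u))%R.
Proof.
  intros Ht Hu.
  assert (PQ : forall x, (0 < x)%R -> (0 < 1 + t ^ 2 / x ^ 2)%R).
  { intros x Hx. assert (0 < t ^ 2 / x ^ 2)%R by (apply Rdiv_lt_0_compat; nra). lra. }
  induction n as [|n [IH1 IH2]].
  - simpl INR. rewrite Rplus_0_r, Rminus_diag, exp_0. cbn [vprod]. simpl INR.
    rewrite Rplus_0_r. split; lra.
  - assert (Pn := pos_INR n). rewrite S_INR.
    assert (S1 := vprim_step t (u + INR n) Ht ltac:(lra)).
    replace (u + INR n + 1)%R with (u + (INR n + 1))%R in S1 by ring.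
    set (d := (vprim t (u + (INR n + 1)) - vprim t (u + INR n))%R) in S1.
    replace (vprim t (u + (INR n + 1)) - vprim t u)%R with
      ((vprim t (u + INR n) - vprim t u) + d)%R by (unfold d; ring).
    rewrite exp_plus. split.
    + cbn [vprod]. apply Rmult_le_compat; try (left; apply exp_pos); [easy|].
      rewrite <- (exp_ln (1 + _)) by (apply PQ; lra). apply exp_le. lra.
    + change (vprod u t (S (S n))) with
        (vprod u t (S n) * (1 + t ^ 2 / (u + INR (S n)) ^ 2))%R.
      rewrite <- Rmult_assoc, S_INR. apply Rmult_le_compat; [| |easy|].
      * eapply Rle_trans; [left; apply exp_pos|].
        cbn [vprod]. eapply Rle_trans; [apply IH1|].
        assert (0 < vprod u t n)%R by (eapply Rlt_le_trans; [apply exp_pos|apply IH1]).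
        assert (0 < t ^ 2 / (u + INR n) ^ 2)%R by (apply Rdiv_lt_0_compat; nra). nra.
      * left. apply PQ. lra.
      * rewrite <- (exp_ln (1 + _)) by (apply PQ; lra). apply exp_le. lra.
Qed.

Lemma atan_le_id (x : R) : (0 <= x)%R -> (atan x <= x)%R.
Proof.
  intros Hx.
  destruct (MVT_gen (fun y => y - atan y)%R 0 x (fun y => 1 - / (1 + y ^ 2))%R) as [c [Hc E]].
  - intros y _. auto_derive; [easy|]. field. nra.
  - intros y _. apply continuity_pt_filterlim, (ex_derive_continuous (fun y => y - atan y)%R).
    auto_derive. easy.
  - rewrite atan_0 in E. rewrite Rmin_left, Rmax_right in Hc by lra.
    assert (/ (1 + c ^ 2) <= 1)%R by (rewrite <- Rinv_1; apply Rinv_le_contravar; nra). nra.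
Qed.

Lemma ln_1p_bounds (x : R) : (0 <= x)%R -> (0 <= ln (1 + x) <= x)%R.
Proof.
  intros Hx. split.
  - rewrite <- ln_1. apply ln_le; lra.
  - generalize (exp_ineq1_le (ln (1 + x))). rewrite exp_ln by lra. lra.
Qed.

Lemma vprim_bounds (t x : R) : (0 < t)%R -> (0 < x)%R ->
  (PI * t - 2 * t ^ 2 / x <= vprim t x <= PI * t + t ^ 2 / x)%R /\
  (0 <= vprim t x)%R /\ (vprim t x <= x * ln (1 + t ^ 2 / x ^ 2) + 2 * x)%R.
Proof.
  intros Ht Hx. unfold vprim.
  assert (P : (0 < t ^ 2 / x ^ 2)%R) by (apply Rdiv_lt_0_compat; nra).
  destruct (ln_1p_bounds (t ^ 2 / x ^ 2)) as [L1 L2]; [lra|].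
  assert (Pi : (0 < PI)%R) by apply PI_RGT_0.
  assert (A0 : (0 < x / t)%R) by now apply Rdiv_lt_0_compat.
  assert (A1 := atan_bound (x / t)).
  assert (A2 : (0 <= atan (x / t))%R) by (rewrite <- atan_0; left; now apply atan_increasing).
  assert (A3 : (atan (x / t) = PI / 2 - atan (t / x))%R).
  { replace (t / x)%R with (/ (x / t))%R by (field; lra). rewrite atan_inv by easy. ring. }
  assert (A4 := atan_le_id (t / x) (Rlt_le _ _ (Rdiv_lt_0_compat _ _ Ht Hx))).
  assert (A5 := atan_le_id (x / t) (Rlt_le _ _ A0)).
  assert (E1 : (x * (t ^ 2 / x ^ 2) = t ^ 2 / x)%R) by (field; lra).
  assert (M1 : (0 <= x * ln (1 + t ^ 2 / x ^ 2) <= t ^ 2 / x)%R) by (split; nra).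
  assert (E2 : (2 * t ^ 2 / x = 2 * t * (t / x))%R) by (field; lra).
  assert (E3 : (2 * t * (x / t) = 2 * x)%R) by (field; lra).
  repeat split.
  - rewrite E2, A3. nra.
  - nra.
  - nra.
  - nra.
Qed.

Lemma RG_le_limit (z w : C) (K : R) (n0 : nat) : (0 <= K)%R ->
  (forall n, (n0 <= n)%nat -> (Cmod (RGn n z) <= K * Cmod (RGn n w))%R) ->
  (Cmod (RG z) <= K * Cmod (RG w))%R.
Proof.
  intros HK H. apply le_epsilon. intros eps He.
  destruct (RG_limit z (eps / 2)%R) as [N1 H1]; [lra|].
  destruct (RG_limit w (eps / (2 * (K + 1)))%R) as [N2 H2]; [apply Rdiv_lt_0_compat; lra|].
  set (n := max n0 (max N1 N2)).
  specialize (H1 n z ltac:(unfold n; lia) eq_refl).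
  specialize (H2 n w ltac:(unfold n; lia) eq_refl).
  specialize (H n ltac:(unfold n; lia)).
  assert (T1 := Cmod_triangle_rev (RG z) (RGn n z)). rewrite Cmod_sub_comm in T1.
  assert (T2 := Cmod_triangle_rev (RGn n w) (RG w)).
  assert (K * Cmod (RGn n w) <= K * (Cmod (RG w) + eps / (2 * (K + 1))))%R
    by (apply Rmult_le_compat_l; lra).
  assert (K * (eps / (2 * (K + 1))) <= eps / 2)%R.
  { replace (K * (eps / (2 * (K + 1))))%R with (eps / 2 * (K / (K + 1)))%R by (field; lra).
    assert (K / (K + 1) <= 1)%R.
    { apply Rmult_le_reg_r with (K + 1)%R; [lra|]. field_simplify; lra. }
    nra. }
  lra.
Qed.

Lemma sqr_le_reg (x y : R) : (0 <= y)%R -> (x ^ 2 <= y ^ 2)%R -> (x <= y)%R.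
Proof. intros Hy H. apply Rnot_lt_le. intros L. nra. Qed.

Lemma RG_vertical_upper (u t : R) : (1 <= u)%R ->
  (Cmod (RG (u, t)) <= (1 + Rabs t) * exp (PI / 2 * Rabs t + 1) * Cmod (RG u))%R.
Proof.
  intros Hu. assert (Pt := Rabs_pos t). assert (Pi := PI_RGT_0).
  destruct (Req_dec t 0) as [->|Ht0].
  { rewrite Rabs_R0. change (u, 0%R) with (RtoC u). rewrite <- (Rmult_1_l (Cmod (RG u))) at 1.
    apply Rmult_le_compat_r; [apply Cmod_ge_0|].
    replace (PI / 2 * 0 + 1)%R with 1%R by ring. assert (H := exp_ineq1_le 1). nra. }
  assert (Ht : (0 < Rabs t)%R) by now apply Rabs_pos_lt.
  set (T := Rabs t) in *.
  destruct (nfloor_ex (T ^ 2)) as [n0 [_ Hn0]]; [nra|].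
  apply RG_le_limit with (S n0).
  { apply Rmult_le_pos; [lra|left; apply exp_pos]. }
  intros n Hn. apply sqr_le_reg.
  { apply Rmult_le_pos; [|apply Cmod_ge_0]. apply Rmult_le_pos; [lra|left; apply exp_pos]. }
  rewrite RGn_vertical by lra. rewrite <- (vprod_abs u t). fold T.
  rewrite Rpow_mult_distr, Rmult_comm. apply Rmult_le_compat_r; [apply pow2_ge_0|].
  destruct (vprod_bounds u T n Ht) as [_ V]; [lra|]. eapply Rle_trans; [apply V|].
  apply le_INR in Hn. rewrite S_INR in Hn. assert (Pn := pos_INR n).
  destruct (vprim_bounds T (u + INR n) Ht) as [[_ V1] _]; [lra|].
  destruct (vprim_bounds T u Ht) as [_ [V2 _]]; [lra|].
  rewrite Rpow_mult_distr.
  assert (Q : (T ^ 2 / (u + INR n) <= 1)%R).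
  { apply Rmult_le_reg_r with (u + INR n)%R; [lra|]. field_simplify; lra. }
  apply Rmult_le_compat.
  - assert (0 < T ^ 2 / u ^ 2)%R by (apply Rdiv_lt_0_compat; nra). lra.
  - left; apply exp_pos.
  - assert (T ^ 2 / u ^ 2 <= T ^ 2)%R.
    { rewrite <- (Rdiv_1_r (T ^ 2)) at 2. apply Rmult_le_compat_l; [nra|].
      apply Rinv_le_contravar; nra. }
    nra.
  - replace (exp (PI / 2 * T + 1) ^ 2)%R with (exp (PI * T + 2)).
    + apply exp_le. lra.
    + simpl. rewrite Rmult_1_r, <- exp_plus. f_equal. field.
Qed.

Lemma RG_vertical_lower (u t : R) : (1 <= u)%R ->
  (Cmod (RG u) <=
     exp (1 + u + u * ln (1 + Rabs t) - PI / 2 * Rabs t) * Cmod (RG (u, t)))%R.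
Proof.
  intros Hu. assert (Pt := Rabs_pos t). assert (Pi := PI_RGT_0).
  destruct (Req_dec t 0) as [->|Ht0].
  { rewrite Rabs_R0. change (u, 0%R) with (RtoC u). rewrite <- (Rmult_1_l (Cmod (RG u))) at 1.
    apply Rmult_le_compat_r; [apply Cmod_ge_0|].
    rewrite Rplus_0_r, ln_1. replace (1 + u + u * 0 - PI / 2 * 0)%R with (1 + u)%R by ring.
    assert (H := exp_ineq1_le (1 + u)). lra. }
  assert (Ht : (0 < Rabs t)%R) by now apply Rabs_pos_lt.
  set (T := Rabs t) in *.
  destruct (nfloor_ex (T ^ 2)) as [n0 [_ Hn0]]; [nra|].
  apply RG_le_limit with (S n0); [left; apply exp_pos|].
  intros n Hn. apply sqr_le_reg.
  { apply Rmult_le_pos; [|apply Cmod_ge_0]. left; apply exp_pos. }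
  rewrite Rpow_mult_distr, RGn_vertical by lra. rewrite <- (vprod_abs u t). fold T.
  apply le_INR in Hn. rewrite S_INR in Hn. assert (Pn := pos_INR n).
  destruct (vprod_bounds u T (S n) Ht) as [V _]; [lra|].
  destruct (vprim_bounds T (u + INR (S n)) Ht) as [[V1 _] _]; [rewrite S_INR; lra|].
  destruct (vprim_bounds T u Ht) as [_ [_ V2]]; [lra|].
  assert (Q : (2 * T ^ 2 / (u + INR (S n)) <= 2)%R).
  { rewrite S_INR. apply Rmult_le_reg_r with (u + (INR n + 1))%R; [lra|]. field_simplify; lra. }
  assert (L : (ln (1 + T ^ 2 / u ^ 2) <= 2 * ln (1 + T))%R).
  { replace (2 * ln (1 + T))%R with (ln ((1 + T) * (1 + T))) by (rewrite ln_mult; lra).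
    apply ln_le.
    - assert (0 < T ^ 2 / u ^ 2)%R by (apply Rdiv_lt_0_compat; nra). lra.
    - assert (T ^ 2 / u ^ 2 <= T ^ 2)%R.
      { rewrite <- (Rdiv_1_r (T ^ 2)) at 2. apply Rmult_le_compat_l; [nra|].
        apply Rinv_le_contravar; nra. }
      nra. }
  assert (W : (vprim T u <= 2 * (u * ln (1 + T)) + 2 * u)%R) by nra.
  set (E := (1 + u + u * ln (1 + T) - PI / 2 * T)%R).
  assert (X : (exp (- (2 * E)) <= vprod u T (S n))%R).
  { eapply Rle_trans; [|apply V]. apply exp_le. unfold E. lra. }
  rewrite <- (Rmult_1_r (Cmod (RGn n u) ^ 2)) at 1.
  replace (exp E ^ 2 * (Cmod (RGn n u) ^ 2 * vprod u T (S n)))%R with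
    (Cmod (RGn n u) ^ 2 * (exp E ^ 2 * vprod u T (S n)))%R by ring.
  apply Rmult_le_compat_l; [apply pow2_ge_0|].
  replace 1%R with (exp E ^ 2 * exp (- (2 * E)))%R.
  - apply Rmult_le_compat_l; [apply pow2_ge_0|easy].
  - simpl. rewrite Rmult_1_r, <- !exp_plus. replace (E + E + - (2 * E))%R with 0%R by ring.
    apply exp_0.
Qed.

Lemma RG_segment_bounds (U : R) : (1 <= U)%R ->
  exists m M, (0 < m)%R /\ (0 < M)%R /\ forall u, (1 <= u <= U)%R -> (m <= Cmod (RG u) <= M)%R.
Proof.
  intros HU.
  assert (Cont : forall u, continuity_pt (fun u : R => Cmod (RG u)) u).
  { intros u. apply continuity_pt_locally. intros e.
    destruct (Ccont_RG u (e / 2)%R (is_pos_div_2 e)) as [d [D Hd]].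
    exists (mkposreal d D). intros y Hy. assert (Pe := cond_pos e).
    assert (A : (Cmod (RG y - RG u) <= e / 2)%R).
    { apply Hd. rewrite <- RtoC_minus, Cmod_R. left. exact Hy. }
    assert (T1 := Cmod_triangle_rev (RG y) (RG u)).
    assert (T2 := Cmod_triangle_rev (RG u) (RG y)). rewrite Cmod_sub_comm in T2.
    apply Rabs_def1; lra. }
  destruct (continuity_ab_min (fun u : R => Cmod (RG u)) 1 U HU) as [u1 [H1 I1]].
  { intros; apply Cont. }
  destruct (continuity_ab_maj (fun u : R => Cmod (RG u)) 1 U HU) as [u2 [H2 I2]].
  { intros; apply Cont. }
  assert (NZ : forall u, (1 <= u)%R -> (0 < Cmod (RG u))%R).
  { intros u Hu. apply Cmod_gt_0, RG_neq0. intros [k E]. apply RtoC_inj in E.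
    assert (P := pos_INR k). lra. }
  exists (Cmod (RG u1)), (Cmod (RG u2)). split; [apply NZ; lra|]. split; [apply NZ; lra|].
  intros u Hu. split; auto.
Qed.

Lemma linear_le_exp (eps x : R) : (0 < eps <= 1)%R -> (0 <= x)%R ->
  (1 + x <= / eps * exp (eps * x))%R.
Proof.
  intros He Hx. apply Rmult_le_reg_l with eps; [easy|].
  rewrite <- Rmult_assoc, Rinv_r, Rmult_1_l by lra.
  assert (H := exp_ineq1_le (eps * x)). nra.
Qed.

(** A weak form of Stirling's formula. Only the exponential rate [PI / 2] matters, and powers
    of [|Im z|] are absorbed in [eps]. *)
Lemma RG_strip (U eps : R) : (1 <= U)%R -> (0 < eps)%R ->
  exists K, (0 < K)%R /\ forall z, (1 <= Re z <= U)%R ->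
    (Cmod (RG z) <= K * exp ((PI / 2 + eps) * Rabs (Im z)))%R /\
    (Cmod (/ RG z) <= K * exp (- (PI / 2 - eps) * Rabs (Im z)))%R.
Proof.
  intros HU He. destruct (RG_segment_bounds U HU) as [m [M [Hm [HM HB]]]].
  set (e := Rmin (eps / U) 1).
  assert (He0 : (0 < e <= 1)%R).
  { split; [apply Rmin_case; [apply Rdiv_lt_0_compat; lra|lra]|apply Rmin_r]. }
  assert (HeU : (U * e <= eps)%R).
  { assert (A : (e <= eps / U)%R) by apply Rmin_l.
    apply Rmult_le_compat_l with (r := U) in A; [|lra].
    replace (U * (eps / U))%R with eps in A by (field; lra). easy. }
  assert (He1 : (e <= eps)%R) by nra.
  set (K1 := (/ e * exp 1 * M)%R). set (K2 := (exp (1 + U + U * ln (/ e)) * / m)%R).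
  assert (PK1 : (0 < K1)%R).
  { assert (0 < / e)%R by now apply Rinv_0_lt_compat. assert (P := exp_pos 1).
    unfold K1. repeat apply Rmult_lt_0_compat; easy. }
  assert (PK2 : (0 < K2)%R).
  { apply Rmult_lt_0_compat; [apply exp_pos|]. now apply Rinv_0_lt_compat. }
  exists (K1 + K2)%R. split; [lra|].
  intros [u t] Hu. simpl Re in *. simpl Im.
  set (T := Rabs t). assert (PT : (0 <= T)%R) by apply Rabs_pos.
  destruct (HB u Hu) as [B1 B2]. assert (LE := linear_le_exp e T He0 PT).
  split.
  - eapply Rle_trans; [apply RG_vertical_upper; lra|]. fold T.
    assert (E : ((1 + T) * exp (PI / 2 * T + 1) * Cmod (RG u) <=
      (/ e * exp (e * T)) * exp (PI / 2 * T + 1) * M)%R).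
    { apply Rmult_le_compat; [|apply Cmod_ge_0| |easy].
      - apply Rmult_le_pos; [lra|left; apply exp_pos].
      - apply Rmult_le_compat_r; [left; apply exp_pos|easy]. }
    eapply Rle_trans; [apply E|].
    replace (/ e * exp (e * T) * exp (PI / 2 * T + 1) * M)%R with
      (K1 * (exp (e * T) * exp (PI / 2 * T)))%R.
    2:{ unfold K1. rewrite exp_plus. ring. }
    rewrite <- exp_plus. apply Rmult_le_compat; [lra|left; apply exp_pos|lra|].
    apply exp_le. nra.
  - assert (L := RG_vertical_lower u t ltac:(lra)). fold T in L.
    assert (PR : (0 < Cmod (RG (u, t)))%R).
    { apply Rnot_le_lt. intros Z. assert (P := Cmod_ge_0 (RG (u, t))).
      replace (Cmod (RG (u, t))) with 0%R in L by lra. lra. }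
    rewrite Cmod_inv_total. apply Rmult_le_reg_r with (Cmod (RG (u, t))); [easy|].
    rewrite Rinv_l by lra.
    assert (X : (exp (1 + u + u * ln (1 + T) - PI / 2 * T) <=
       exp (1 + U + U * ln (/ e)) * exp (- (PI / 2 - eps) * T))%R).
    { rewrite <- exp_plus. apply exp_le.
      assert (P1 : (0 <= ln (1 + T))%R) by (rewrite <- ln_1; apply ln_le; lra).
      assert (P2 : (ln (1 + T) <= ln (/ e) + e * T)%R).
      { rewrite <- (ln_exp (e * T)). assert (Pe : (0 < / e)%R) by now apply Rinv_0_lt_compat.
        rewrite <- ln_mult; [|easy|apply exp_pos]. apply ln_le; [lra|easy]. }
      assert (P3 : (u * ln (1 + T) <= U * (ln (/ e) + e * T))%R) by (apply Rmult_le_compat; lra).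
      assert (P4 : (U * e * T <= eps * T)%R) by (apply Rmult_le_compat_r; easy).
      lra. }
    set (Y := exp (- (PI / 2 - eps) * T)) in *. assert (PY : (0 < Y)%R) by apply exp_pos.
    assert (Z : (m <= exp (1 + U + U * ln (/ e)) * Y * Cmod (RG (u, t)))%R).
    { eapply Rle_trans; [apply B1|]. eapply Rle_trans; [apply L|].
      apply Rmult_le_compat_r; lra. }
    apply Rmult_le_reg_l with m; [easy|]. rewrite Rmult_1_r. eapply Rle_trans; [apply Z|].
    replace (m * ((K1 + K2) * Y * Cmod (RG (u, t))))%R with
      (m * K1 * (Y * Cmod (RG (u, t))) + m * K2 * (Y * Cmod (RG (u, t))))%R by ring.
    assert (m * K2 = exp (1 + U + U * ln (/ e)))%R by (unfold K2; field; lra).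
    rewrite H. assert (0 <= m * K1 * (Y * Cmod (RG (u, t))))%R.
    { apply Rmult_le_pos; nra. }
    lra.
Qed.

(** * The confluent hypergeometric function in its numerator parameter *)

(** Each [|c + i|] is comparable with [i + 1]: for large [i] by the triangle inequality, and
    the finitely many others are nonzero. *)
Lemma poch_lower (c : C) : ~ nonpos_integer c ->
  exists K, (1 <= K)%R /\ forall n, (INR (fact n) <= K ^ n * Cmod (poch c n))%R.
Proof.
  intros Hc.
  assert (NZ : forall i : nat, (0 < Cmod (c + INR i))%R).
  { intros i. apply Cmod_gt_0. intros E. apply Hc. exists i. rewrite RtoC_opp.
    replace c with (c + INR i - INR i) by ring. rewrite E. ring. }
  assert (F : forall n, exists K, (1 <= K)%R /\ forall i, (i < n)%nat ->
     (INR i + 1 <= K * Cmod (c + INR i))%R).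
  { induction n as [|n [K [K1 HK]]]; [exists 1%R; split; [lra|lia]|].
    set (L := ((INR n + 1) / Cmod (c + INR n))%R).
    exists (Rmax K L). split; [eapply Rle_trans; [apply K1|apply Rmax_l]|].
    intros i Hi. assert (P := NZ i). destruct (Nat.eq_dec i n) as [->|E].
    - apply Rle_trans with (L * Cmod (c + INR n))%R.
      + unfold L. right. field. lra.
      + apply Rmult_le_compat_r; [lra|apply Rmax_r].
    - eapply Rle_trans; [apply HK; lia|]. apply Rmult_le_compat_r; [lra|apply Rmax_l]. }
  destruct (nfloor_ex (1 + Cmod c)) as [n0 [_ Hn0]].
  { generalize (Cmod_ge_0 c). lra. }
  destruct (F (S n0)) as [K [K1 HK]].
  set (K' := Rmax K (2 + Cmod c)).
  assert (HK' : (1 <= K')%R) by (eapply Rle_trans; [apply K1|apply Rmax_l]).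
  exists K'. split; [easy|].
  assert (G : forall i, (INR i + 1 <= K' * Cmod (c + INR i))%R).
  { intros i. assert (P := NZ i). destruct (Nat.lt_ge_cases i (S n0)) as [L|L].
    - eapply Rle_trans; [now apply HK|]. apply Rmult_le_compat_r; [lra|apply Rmax_l].
    - apply le_INR in L. rewrite S_INR in L.
      assert (T : (INR i - Cmod c <= Cmod (c + INR i))%R).
      { assert (T := Cmod_triangle_rev (INR i) (- c)). rewrite Cmod_opp, Cmod_INR in T.
        replace (INR i - - c) with (c + INR i) in T by ring. lra. }
      apply Rle_trans with ((2 + Cmod c) * Cmod (c + INR i))%R.
      + generalize (Cmod_ge_0 c). nra.
      + apply Rmult_le_compat_r; [lra|apply Rmax_r]. }
  intros n. induction n as [|n IH].
  - simpl. rewrite Cmod_1. lra.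
  - cbn [poch]. rewrite Cmod_mult. replace (fact (S n)) with (S n * fact n)%nat by easy.
    rewrite mult_INR, S_INR. cbn [pow].
    replace (K' * K' ^ n * (Cmod (poch c n) * Cmod (c + INR n)))%R with
      ((K' * Cmod (c + INR n)) * (K' ^ n * Cmod (poch c n)))%R by ring.
    apply Rmult_le_compat; auto using pos_INR. generalize (pos_INR n). lra.
Qed.

(** [|poch b n| <= (|b| + n)^n], and [X^n <= n! exp X] for [X = eps (|b| + n)]. *)
Lemma poch_upper (eps : R) (b : C) (n : nat) : (0 < eps)%R ->
  (Cmod (poch b n) <= INR (fact n) * exp (eps * Cmod b) * (exp eps / eps) ^ n)%R.
Proof.
  intros He. assert (P := Cmod_ge_0 b).
  assert (A : forall m, (m <= n)%nat -> (Cmod (poch b m) <= (Cmod b + INR n) ^ m)%R).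
  { induction m as [|m IH]; intros Hm; [simpl; rewrite Cmod_1; lra|].
    cbn [poch pow]. rewrite Cmod_mult, Rmult_comm.
    apply Rmult_le_compat; auto using Cmod_ge_0; [|apply IH; lia].
    eapply Rle_trans; [apply Cmod_triangle|]. rewrite Cmod_INR.
    apply Rplus_le_compat_l, le_INR. lia. }
  eapply Rle_trans; [apply (A n), le_n|].
  assert (Q := pow_le_fact_exp (eps * (Cmod b + INR n)) n).
  rewrite Rpow_mult_distr in Q. assert (Pn := pos_INR n).
  specialize (Q ltac:(nra)).
  assert (E0 : (0 < eps ^ n)%R) by now apply pow_lt.
  apply Rmult_le_reg_l with (eps ^ n)%R; [easy|]. eapply Rle_trans; [apply Q|].
  right. unfold Rdiv. rewrite Rpow_mult_distr, pow_inv.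
  replace (eps * (Cmod b + INR n))%R with (eps * Cmod b + INR n * eps)%R by ring.
  rewrite exp_plus.
  replace (exp (INR n * eps)) with (exp eps ^ n)%R; [field; lra|].
  clear. induction n as [|n IH]; [simpl; rewrite Rmult_0_l, exp_0; easy|].
  rewrite S_INR, Rmult_plus_distr_r, Rmult_1_l, exp_plus, <- IH. simpl. ring.
Qed.

Definition hyp_term (c x b : C) (n : nat) : C := poch b n / poch c n * (x ^ n / INR (fact n)).

Lemma hyp_term_bound (c x : C) (eps : R) : ~ nonpos_integer c -> (0 < eps)%R ->
  exists A, (0 < A)%R /\ forall b n,
    (Cmod (hyp_term c x b n) <= A * exp (eps * Cmod b) * (/ 2) ^ n)%R.
Proof.
  intros Hc He. destruct (poch_lower c Hc) as [K [K1 HK]].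
  assert (Px := Cmod_ge_0 x). assert (PE : (0 < exp eps / eps)%R).
  { apply Rdiv_lt_0_compat; [apply exp_pos|easy]. }
  destruct (pow_le_fact (exp eps / eps * K * Cmod x)) as [A [HA HAn]].
  { apply Rmult_le_pos; [|easy]. apply Rmult_le_pos; lra. }
  exists A. split; [easy|]. intros b n. unfold hyp_term.
  assert (Nc := poch_neq0 c n Hc). assert (Pc := proj1 (Cmod_gt_0 _) Nc).
  assert (PF : (0 < INR (fact n))%R) by apply lt_0_INR, lt_O_fact.
  unfold Cdiv. rewrite !Cmod_mult, !Cmod_inv_total, Cmod_pow, Cmod_INR.
  assert (U := poch_upper eps b n He). specialize (HK n). specialize (HAn n).
  rewrite !Rpow_mult_distr in HAn.
  set (E := exp (eps * Cmod b)) in *. assert (PEb : (0 < E)%R) by apply exp_pos.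
  set (G := ((exp eps / eps) ^ n)%R) in *. assert (PG : (0 < G)%R) by now apply pow_lt.
  assert (V : (/ Cmod (poch c n) <= K ^ n * / INR (fact n))%R).
  { apply Rmult_le_reg_r with (Cmod (poch c n) * INR (fact n))%R; [nra|].
    replace (/ Cmod (poch c n) * (Cmod (poch c n) * INR (fact n)))%R with (INR (fact n))
      by (field; lra).
    replace (K ^ n * / INR (fact n) * (Cmod (poch c n) * INR (fact n)))%R
      with (K ^ n * Cmod (poch c n))%R by (field; lra). easy. }
  apply Rle_trans with ((INR (fact n) * E * G) * (K ^ n * / INR (fact n)) *
     (Cmod x ^ n * / INR (fact n)))%R.
  - apply Rmult_le_compat_r.
    + apply Rmult_le_pos; [now apply pow_le|]. left. now apply Rinv_0_lt_compat.
    + apply Rmult_le_compat; auto using Cmod_ge_0. left. now apply Rinv_0_lt_compat.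
  - replace (INR (fact n) * E * G * (K ^ n * / INR (fact n)) * (Cmod x ^ n * / INR (fact n)))%R
      with (E * (G * K ^ n * Cmod x ^ n * / INR (fact n)))%R by (field; lra).
    replace (A * E * (/ 2) ^ n)%R with (E * (A * INR (fact n) * (/ 2) ^ n * / INR (fact n)))%R
      by (field; lra).
    apply Rmult_le_compat_l; [lra|]. apply Rmult_le_compat_r; [|easy].
    left. now apply Rinv_0_lt_compat.
Qed.

Lemma Hyp1F1_csum (b c x : C) :
  Hyp1F1 b c x = Clim_seq (fun n => csum (hyp_term c x b) (S n)).
Proof.
  unfold Hyp1F1. f_equal. apply functional_extensionality.
  intros n. apply sum_n_csum.
Qed.

Lemma Hyp1F1_unif_cv_bound (c x : C) (A eps R0 : R) :
  (0 < A)%R -> (0 < eps)%R ->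
  (forall b n, (Cmod (hyp_term c x b n) <= A * exp (eps * Cmod b) * (/ 2) ^ n)%R) ->
  unif_cv (disc R0) (fun n b => csum (hyp_term c x b) (S n)) (fun b => Hyp1F1 b c x) /\
  (forall n b, disc R0 b ->
    (Cmod (Hyp1F1 b c x - csum (hyp_term c x b) (S n)) <= A * exp (eps * R0) * (/ 2) ^ n)%R).
Proof.
  intros HA He H. set (A' := (A * exp (eps * R0))%R).
  assert (PA : (0 < A')%R) by (apply Rmult_lt_0_compat; [easy|apply exp_pos]).
  destruct (unif_cv_telescope (disc R0) (fun n b => csum (hyp_term c x b) (S n))
     (fun n => A' * (/ 2) ^ n)%R 0) as [H1 H2].
  - intros n _. apply Rmult_le_pos; [lra|]. apply pow_le. lra.
  - intros e Hpe. destruct (pow_small (/ 2) (e / A')) as [N HN]; [lra|now apply Rdiv_lt_0_compat|].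
    exists N. split; [lia|]. apply Rmult_le_compat_l with (r := A') in HN; [|lra].
    replace (A' * (e / A'))%R with e in HN by (field; lra). easy.
  - intros n b _ Hb. change (csum (hyp_term c x b) (S (S n)))
      with (csum (hyp_term c x b) (S n) + hyp_term c x b (S n)).
    replace (csum (hyp_term c x b) (S n) + hyp_term c x b (S n) - csum (hyp_term c x b) (S n))
      with (hyp_term c x b (S n)) by ring.
    eapply Rle_trans; [apply H|].
    replace (A' * (/ 2) ^ n - A' * (/ 2) ^ S n)%R with (A' * (/ 2) ^ S n)%R
      by (simpl; field).
    apply Rmult_le_compat_r; [apply pow_le; lra|]. apply Rmult_le_compat_l; [lra|].
    apply exp_le, Rmult_le_compat_l; [lra|exact Hb].
  - assert (E : (fun b => Hyp1F1 b c x) =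
        fun b => Clim_seq (fun n => csum (hyp_term c x b) (S n))).
    { apply functional_extensionality. intros b. apply Hyp1F1_csum. }
    rewrite E. split; [exact H1|]. intros n b Hb. rewrite Hyp1F1_csum. now apply H2; [lia|].
Qed.

Lemma Hyp1F1_tail (c x : C) (eps : R) : ~ nonpos_integer c -> (0 < eps)%R ->
  exists A, (0 < A)%R /\ forall b n,
    (Cmod (hyp_term c x b n) <= A * exp (eps * Cmod b) * (/ 2) ^ n)%R /\
    (Cmod (Hyp1F1 b c x - csum (hyp_term c x b) (S n)) <= A * exp (eps * Cmod b) * (/ 2) ^ n)%R.
Proof.
  intros Hc He. destruct (hyp_term_bound c x eps Hc He) as [A [HA H]].
  exists A. split; [easy|]. intros b n. split; [easy|].
  apply (Hyp1F1_unif_cv_bound c x A eps (Cmod b)); try easy. apply Rle_refl.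
Qed.

(** The exponential rate in the numerator parameter is arbitrarily small; the decay of the
    Gamma factors will absorb it. *)
Lemma Hyp1F1_growth (c x : C) (eps : R) : ~ nonpos_integer c -> (0 < eps)%R ->
  exists A, (0 < A)%R /\ forall b, (Cmod (Hyp1F1 b c x) <= A * exp (eps * Cmod b))%R.
Proof.
  intros Hc He. destruct (Hyp1F1_tail c x eps Hc He) as [A [HA H]].
  exists (2 * A)%R. split; [lra|]. intros b. destruct (H b O) as [H1 H2].
  replace (Hyp1F1 b c x) with
    ((Hyp1F1 b c x - csum (hyp_term c x b) 1) + hyp_term c x b 0) by (simpl; ring).
  eapply Rle_trans; [apply Cmod_triangle|]. simpl pow in *. lra.
Qed.

Lemma poly_approx_Hyp1F1 (c x : C) (R0 : R) (f : C -> C) : ~ nonpos_integer c ->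
  poly_approx R0 f -> poly_approx R0 (fun s => Hyp1F1 (f s) c x).
Proof.
  intros Hc H. destruct (poly_approx_bounded _ _ H) as [B HB].
  destruct (hyp_term_bound c x 1 Hc Rlt_0_1) as [A [HA HT]].
  apply poly_approx_unif_cv with (u := fun n s => csum (hyp_term c x (f s)) (S n)).
  - intros n. apply (poly_approx_csum R0 (fun k s => hyp_term c x (f s) k)). intros k.
    apply poly_approx_mult; [|apply poly_approx_const].
    apply poly_approx_mult; [now apply poly_approx_poch|apply poly_approx_const].
  - destruct (Hyp1F1_unif_cv_bound c x A 1 B HA Rlt_0_1 HT) as [U _].
    intros eps He. destruct (U eps He) as [N HN]. exists N. intros n s Hn Hs.
    apply HN; [easy|]. now apply HB.
Qed.

(** * Growth of the Mellin-Barnes kernel *)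

Ltac pos_prod :=
  repeat match goal with
  | H : (0 < ?x)%R |- (0 < ?x)%R => exact H
  | |- (0 < _ * _)%R => apply Rmult_lt_0_compat
  | |- (0 < exp _)%R => apply exp_pos
  end; try lra.

Definition kernel (a c c' x s : C) : C :=
  Hyp1F1 (a + s) c x * (Gamma (a + s) / Gamma (c' + s)) * Gamma (- s).

Lemma kernel_RG (a c c' x s : C) :
  kernel a c c' x s = Hyp1F1 (a + s) c x * (/ RG (a + s) * RG (c' + s)) * / RG (- s).
Proof. unfold kernel, Cdiv. rewrite !Gamma_RG, Cinv_inv_total. easy. Qed.

(** [/ 2] is the distance that a line [Re s = N + 1/2] keeps from the integers. *)
Definition far_from_poles (a s : C) : Prop :=
  (forall n : nat, (/ 2 <= Cmod (s - INR n))%R) /\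
  (forall n : nat, (/ 2 <= Cmod (a + s + INR n))%R).

Lemma poch_lower_half (z : C) (m : nat) :
  (forall n : nat, (/ 2 <= Cmod (z + INR n))%R) -> ((/ 2) ^ m <= Cmod (poch z m))%R.
Proof.
  intros H. induction m as [|m IH]; [simpl; rewrite Cmod_1; lra|].
  cbn [poch pow]. rewrite Cmod_mult, Rmult_comm.
  apply Rmult_le_compat; auto; [apply pow_le; lra|lra].
Qed.

(** The factors of [poch (- w - k) k] are, up to sign, [w + 1], ..., [w + k]. *)
Lemma poch_reflected_lower (B : R) (w : C) (k : nat) : (0 < B)%R ->
  (forall i, (i < k)%nat -> (INR (S i) <= B * Cmod (w + INR (S i)))%R) ->
  (INR (fact k) <= B ^ k * Cmod (poch (- w - INR k) k))%R.
Proof.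
  intros HB. induction k as [|k IH]; intros H; [simpl; rewrite Cmod_1; lra|].
  rewrite poch_first.
  replace (- w - INR (S k) + 1) with (- w - INR k) by (rewrite S_INR, RtoC_plus; ring).
  replace (- w - INR (S k)) with (- (w + INR (S k))) by ring.
  rewrite Cmod_mult, Cmod_opp.
  replace (fact (S k)) with (S k * fact k)%nat by easy. rewrite mult_INR. cbn [pow].
  replace (B * B ^ k * (Cmod (w + INR (S k)) * Cmod (poch (- w - INR k) k)))%R with
    ((B * Cmod (w + INR (S k))) * (B ^ k * Cmod (poch (- w - INR k) k)))%R by ring.
  apply Rmult_le_compat; auto using pos_INR.
Qed.

Lemma poch_ratio (z d : C) (k : nat) : (1 <= Re z)%R ->
  (Cmod (poch (z + d) k) <= (1 + Cmod d) ^ k * Cmod (poch z k))%R.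
Proof.
  intros Hz. induction k as [|k IH]; [simpl; rewrite Cmod_1; lra|].
  cbn [poch pow]. rewrite !Cmod_mult.
  replace ((1 + Cmod d) * (1 + Cmod d) ^ k * (Cmod (poch z k) * Cmod (z + INR k)))%R with
    (((1 + Cmod d) ^ k * Cmod (poch z k)) * ((1 + Cmod d) * Cmod (z + INR k)))%R by ring.
  apply Rmult_le_compat; auto using Cmod_ge_0.
  replace (z + d + INR k) with ((z + INR k) + d) by ring.
  eapply Rle_trans; [apply Cmod_triangle|].
  assert (1 <= Cmod (z + INR k))%R.
  { eapply Rle_trans; [|apply Re_le_Cmod]. rewrite re_plus, re_RtoC.
    generalize (pos_INR k). lra. }
  generalize (Cmod_ge_0 d). nra.
Qed.

Lemma Cmod_strip (s0 : R) (w : C) : (s0 <= Re w <= s0 + 1)%R ->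
  (Cmod w <= Rabs s0 + 1 + Rabs (Im w))%R.
Proof.
  intros H. eapply Rle_trans; [apply Cmod_le_Re_Im|].
  assert (Rabs (Re w) <= Rabs s0 + 1)%R; [|lra].
  apply Rabs_le. generalize (Rle_abs s0) (Rle_abs (- s0)). rewrite Rabs_Ropp. lra.
Qed.

Lemma exp_INR_mult (x : R) (k : nat) : exp (x * INR k) = (exp x ^ k)%R.
Proof.
  induction k as [|k IH]; [simpl; rewrite Rmult_0_r; apply exp_0|].
  rewrite S_INR, Rmult_plus_distr_l, Rmult_1_r, exp_plus, IH. simpl. ring.
Qed.

(** The recurrence moves [s = w + k] back to the strip of [w], where the weak Stirling
    bound applies; what is left of [Gamma (- s)] is a product of at least the size of
    [k!] up to an exponential factor. *)
Lemma kernel_bound (a c c' x : C) (s0 eps : R) : ~ nonpos_integer c -> (0 < eps)%R ->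
  exists A K, (0 < A)%R /\ (0 < K)%R /\
    forall (k : nat) (w : C), (s0 <= Re w <= s0 + 1)%R -> far_from_poles a (w + INR k) ->
      (Cmod (kernel a c c' x (w + INR k)) <=
         A * (K ^ k / INR (fact k)) * exp (- (PI / 2 - eps) * Rabs (Im w)))%R.
Proof.
  intros Hc He.
  (* The factors lose [exp (h |Im w|)] five times in all. *)
  set (h := Rmin (eps / 5) 1).
  assert (Hh : (0 < h <= 1)%R) by (split; [apply Rmin_case; lra|apply Rmin_r]).
  assert (Hh5 : (5 * h <= eps)%R).
  { assert (A : (h <= eps / 5)%R) by apply Rmin_l. lra. }
  assert (Pa := Cmod_ge_0 a). assert (Pc' := Cmod_ge_0 c'). assert (Ps := Rabs_pos s0).
  destruct (nfloor_ex (2 + Rabs s0 + Cmod a + Cmod c')) as [m [_ Hm]]; [lra|].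
  set (M := S m). assert (HM : (2 + Rabs s0 + Cmod a + Cmod c' < INR M)%R)
    by (unfold M; rewrite S_INR; lra). clear Hm.
  set (U := (INR M + 2 + Rabs s0 + Cmod a + Cmod c')%R).
  assert (Hs0 : (- Rabs s0 <= s0 <= Rabs s0)%R).
  { generalize (Rle_abs s0) (Rle_abs (- s0)). rewrite Rabs_Ropp. lra. }
  destruct (RG_strip U h) as [K1 [PK1 HK1]]; [unfold U; lra|lra|].
  destruct (Hyp1F1_growth c x h Hc (proj1 Hh)) as [A1 [PA1 HA1]].
  set (B := (2 * (1 + Rabs s0))%R). set (D := (1 + Cmod (a - c'))%R).
  assert (PD : (1 <= D)%R) by (unfold D; generalize (Cmod_ge_0 (a - c')); lra).
  assert (PB : (2 <= B)%R) by (unfold B; lra).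
  assert (Pi := PI_RGT_0). assert (Pi2 := PI_4).
  assert (Pi3 : (1 < PI / 2)%R) by (generalize PI2_1; lra).
  set (C1 := (A1 * exp (h * (Cmod a + Rabs s0 + 1)))%R).
  set (C2 := (2 ^ M * (K1 * exp (PI / 2 * Cmod a)))%R).
  set (C3 := (INR (fact M) * exp (h * (Cmod c' + Rabs s0 + 1)) * (exp h / h) ^ M *
              (K1 * exp ((PI / 2 + h) * Cmod c')))%R).
  set (C4 := (2 ^ M * K1)%R).
  assert (P2M : (0 < 2 ^ M)%R) by (apply pow_lt; lra).
  assert (PC1 : (0 < C1)%R) by (apply Rmult_lt_0_compat; [easy|apply exp_pos]).
  assert (PC2 : (0 < C2)%R).
  { apply Rmult_lt_0_compat; [easy|]. apply Rmult_lt_0_compat; [easy|apply exp_pos]. }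
  assert (PC3 : (0 < C3)%R).
  { assert (Q1 : (0 < INR (fact M))%R) by apply lt_0_INR, lt_O_fact.
    assert (Q2 : (0 < (exp h / h) ^ M)%R) by (apply pow_lt, Rdiv_lt_0_compat; [apply exp_pos|easy]).
    assert (Q3 := exp_pos (h * (Cmod c' + Rabs s0 + 1))).
    assert (Q4 := exp_pos ((PI / 2 + h) * Cmod c')).
    apply Rmult_lt_0_compat; [apply Rmult_lt_0_compat; [apply Rmult_lt_0_compat|]|
      apply Rmult_lt_0_compat]; easy. }
  assert (PC4 : (0 < C4)%R) by (apply Rmult_lt_0_compat; easy).
  exists (C1 * C2 * C3 * C4)%R, (exp h * exp h * D * B)%R.
  split; [pos_prod|]. split; [pos_prod|].
  intros k w Hw [F1 F2]. set (T := Rabs (Im w)). assert (PT : (0 <= T)%R) by apply Rabs_pos.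
  set (s := w + INR k) in *. set (E := (exp h ^ k)%R).
  assert (PE : (0 < E)%R) by apply pow_lt, exp_pos.
  assert (Pk := pos_INR k).
  assert (Hws := Cmod_strip s0 w Hw). fold T in Hws.
  assert (Hs : (Cmod s <= Rabs s0 + 1 + T + INR k)%R).
  { unfold s. eapply Rle_trans; [apply Cmod_triangle|]. rewrite Cmod_INR. lra. }
  assert (Grow : forall b : C, (exp (h * Cmod (b + s)) <=
     exp (h * (Cmod b + Rabs s0 + 1)) * (E * exp (h * T)))%R).
  { intros b. unfold E. rewrite <- exp_INR_mult, <- !exp_plus. apply exp_le.
    assert (X := Cmod_triangle b s).
    assert (h * Cmod (b + s) <= h * (Cmod b + (Rabs s0 + 1 + T + INR k)))%R
      by (apply Rmult_le_compat_l; lra).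
    lra. }
  assert (RA := re_le_Cmod a). assert (RC := re_le_Cmod c').
  apply Rabs_le_between in RA, RC.
  assert (IA := Im_le_Cmod a). assert (IC := Im_le_Cmod c').
  assert (H1 : (Cmod (Hyp1F1 (a + s) c x) <= C1 * (E * exp (h * T)))%R).
  { eapply Rle_trans; [apply HA1|]. unfold C1. rewrite Rmult_assoc.
    apply Rmult_le_compat_l; [lra|apply Grow]. }
  assert (H2 : (Cmod (/ RG (a + s)) <=
     C2 * Cmod (poch (a + w + INR M) k) * exp (- (PI / 2 - h) * T))%R).
  { set (z := a + w + INR M).
    assert (Rz : (1 <= Re z <= U)%R).
    { unfold z, U. rewrite !re_plus, re_RtoC. lra. }
    assert (X : poch z k <> 0).
    { apply poch_neq0. intros [j Ej]. apply (f_equal Re) in Ej. rewrite re_RtoC in Ej.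
      generalize (pos_INR j). lra. }
    assert (EQ : / RG (a + s) = / poch (a + s) M * (poch z k * / RG z)).
    { rewrite (RG_shift (a + s) M), (RG_shift z k).
      replace (a + s + INR M) with (z + INR k) by (unfold z, s; ring).
      rewrite !Cinv_mult_total.
      replace (poch z k * (/ poch z k * / RG (z + INR k))) with (/ RG (z + INR k))
        by (rewrite Cmult_assoc, Cinv_r by easy; ring).
      easy. }
    rewrite EQ, !Cmod_mult, Cmod_inv_total.
    assert (L := poch_lower_half (a + s) M F2).
    assert (L' : (/ Cmod (poch (a + s) M) <= 2 ^ M)%R).
    { rewrite <- (Rinv_inv (2 ^ M)). apply Rinv_le_contravar.
      - now apply Rinv_0_lt_compat.
      - rewrite <- pow_inv. easy. }
    destruct (HK1 z Rz) as [_ G].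
    assert (G' : (Cmod (/ RG z) <= K1 * exp (PI / 2 * Cmod a) * exp (- (PI / 2 - h) * T))%R).
    { eapply Rle_trans; [apply G|]. rewrite Rmult_assoc, <- exp_plus.
      apply Rmult_le_compat_l; [lra|]. apply exp_le.
      assert (Tz : (T - Cmod a <= Rabs (Im z))%R).
      { unfold z. rewrite !im_plus, im_RtoC, Rplus_0_r.
        assert (X1 := Rabs_triang_inv (Im w) (- Im a)). rewrite Rabs_Ropp in X1.
        replace (Im w - - Im a)%R with (Im a + Im w)%R in X1 by ring. fold T in X1. lra. }
      assert ((PI / 2 - h) * (T - Cmod a) <= (PI / 2 - h) * Rabs (Im z))%R
        by (apply Rmult_le_compat_l; lra).
      nra. }
    unfold C2. replace (2 ^ M * (K1 * exp (PI / 2 * Cmod a)) * Cmod (poch z k) *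
      exp (- (PI / 2 - h) * T))%R with
      (2 ^ M * (Cmod (poch z k) * (K1 * exp (PI / 2 * Cmod a) * exp (- (PI / 2 - h) * T))))%R
      by ring.
    apply Rmult_le_compat; [|apply Rmult_le_pos; apply Cmod_ge_0|easy|].
    - left. apply Rinv_0_lt_compat. eapply Rlt_le_trans; [|apply L]. apply pow_lt. lra.
    - apply Rmult_le_compat_l; [apply Cmod_ge_0|easy]. }
  set (z' := c' + w + INR M).
  assert (Rz' : (1 <= Re z' <= U)%R) by (unfold z', U; rewrite !re_plus, re_RtoC; lra).
  assert (Xz' : poch z' k <> 0).
  { apply poch_neq0. intros [j Ej]. apply (f_equal Re) in Ej. rewrite re_RtoC in Ej.
    generalize (pos_INR j). lra. }
  assert (Pz' := proj1 (Cmod_gt_0 _) Xz').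
  assert (H3 : (Cmod (RG (c' + s)) <=
     C3 * (E * exp (h * T)) * exp ((PI / 2 + h) * T) * / Cmod (poch z' k))%R).
  { assert (EQ : RG (c' + s) = poch (c' + s) M * (RG z' * / poch z' k)).
    { rewrite (RG_shift (c' + s) M), (RG_shift z' k).
      replace (c' + s + INR M) with (z' + INR k) by (unfold z', s; ring). field. easy. }
    rewrite EQ, !Cmod_mult, Cmod_inv_total.
    assert (V := poch_upper h (c' + s) M (proj1 Hh)).
    destruct (HK1 z' Rz') as [G _].
    assert (G' : (Cmod (RG z') <= K1 * exp ((PI / 2 + h) * Cmod c') * exp ((PI / 2 + h) * T))%R).
    { eapply Rle_trans; [apply G|]. rewrite Rmult_assoc, <- exp_plus.
      apply Rmult_le_compat_l; [lra|]. apply exp_le.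
      assert (Tz : (Rabs (Im z') <= T + Cmod c')%R).
      { unfold z'. rewrite !im_plus, im_RtoC, Rplus_0_r.
        eapply Rle_trans; [apply Rabs_triang|]. fold T. lra. }
      rewrite <- Rmult_plus_distr_l. apply Rmult_le_compat_l; lra. }
    assert (V' : (Cmod (poch (c' + s) M) <= INR (fact M) *
       (exp (h * (Cmod c' + Rabs s0 + 1)) * (E * exp (h * T))) * (exp h / h) ^ M)%R).
    { eapply Rle_trans; [apply V|]. apply Rmult_le_compat_r.
      - apply pow_le. left. apply Rdiv_lt_0_compat; [apply exp_pos|easy].
      - apply Rmult_le_compat_l; [apply pos_INR|apply Grow]. }
    unfold C3. rewrite <- Rmult_assoc. apply Rmult_le_compat_r.
    - left. now apply Rinv_0_lt_compat.
    - eapply Rle_trans; [apply Rmult_le_compat; [apply Cmod_ge_0|apply Cmod_ge_0|apply V'|apply G']|].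
      right. ring. }
  assert (H4 : (Cmod (/ RG (- s)) <= C4 * (B ^ k * / INR (fact k)) * exp (- (PI / 2 - h) * T))%R).
  { set (z := - w + INR M).
    assert (Rz : (1 <= Re z <= U)%R).
    { unfold z, U. rewrite re_plus, re_opp, re_RtoC. lra. }
    assert (EQ : / RG (- s) = / poch (- w - INR k) k * (/ poch (- w) M * / RG z)).
    { rewrite (RG_shift (- s) k), (RG_shift (- s + INR k) M).
      replace (- s + INR k) with (- w) by (unfold s; ring).
      replace (- s) with (- w - INR k) by (unfold s; ring).
      rewrite !Cinv_mult_total. easy. }
    assert (L1 : ((/ 2) ^ M <= Cmod (poch (- w) M))%R).
    { apply poch_lower_half. intros n. specialize (F1 (n + k)%nat).
      rewrite <- Cmod_opp. replace (- (- w + INR n)) with (s - INR (n + k)); [easy|].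
      unfold s. rewrite plus_INR, RtoC_plus. ring. }
    assert (L2 : (INR (fact k) <= B ^ k * Cmod (poch (- w - INR k) k))%R).
    { apply poch_reflected_lower; [lra|]. intros i Hi.
      assert (X1 : (/ 2 <= Cmod (w + INR (S i)))%R).
      { specialize (F1 (k - S i)%nat). rewrite minus_INR in F1 by lia.
        replace (s - (INR k - INR (S i))%R) with (w + INR (S i)) in F1; [easy|].
        unfold s. rewrite RtoC_minus. ring. }
      assert (X2 : (INR (S i) - Rabs s0 <= Cmod (w + INR (S i)))%R).
      { eapply Rle_trans; [|apply Re_le_Cmod]. rewrite re_plus, re_RtoC. lra. }
      unfold B. set (j := INR (S i)) in *. set (q := Cmod (w + j)) in *.
      destruct (Rle_dec j (1 + Rabs s0)); nra. }
    rewrite EQ, !Cmod_mult, !Cmod_inv_total.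
    assert (PF : (0 < INR (fact k))%R) by apply lt_0_INR, lt_O_fact.
    assert (PBk : (0 < B ^ k)%R) by (apply pow_lt; lra).
    assert (PP : (0 < Cmod (poch (- w - INR k) k))%R).
    { apply Rnot_le_lt. intros Z. assert (0 <= B ^ k)%R by lra. nra. }
    assert (PP2 : (0 < Cmod (poch (- w) M))%R).
    { eapply Rlt_le_trans; [|apply L1]. apply pow_lt. lra. }
    assert (L2' : (/ Cmod (poch (- w - INR k) k) <= B ^ k * / INR (fact k))%R).
    { apply Rmult_le_reg_r with (Cmod (poch (- w - INR k) k) * INR (fact k))%R; [nra|].
      replace (/ Cmod (poch (- w - INR k) k) * (Cmod (poch (- w - INR k) k) * INR (fact k)))%R
        with (INR (fact k)) by (field; lra).
      replace (B ^ k * / INR (fact k) * (Cmod (poch (- w - INR k) k) * INR (fact k)))%R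
        with (B ^ k * Cmod (poch (- w - INR k) k))%R by (field; lra). easy. }
    assert (L1' : (/ Cmod (poch (- w) M) <= 2 ^ M)%R).
    { rewrite <- (Rinv_inv (2 ^ M)). apply Rinv_le_contravar.
      - now apply Rinv_0_lt_compat.
      - rewrite <- pow_inv. easy. }
    destruct (HK1 z Rz) as [_ G]. rewrite Cmod_inv_total in G.
    replace (Rabs (Im z)) with T in G.
    2:{ unfold z. rewrite im_plus, im_opp, im_RtoC, Rplus_0_r, Rabs_Ropp. easy. }
    unfold C4. replace (2 ^ M * K1 * (B ^ k * / INR (fact k)) * exp (- (PI / 2 - h) * T))%R with
      ((B ^ k * / INR (fact k)) * (2 ^ M * (K1 * exp (- (PI / 2 - h) * T))))%R by ring.
    assert (PG : (0 <= / Cmod (RG z))%R).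
    { rewrite <- Cmod_inv_total. apply Cmod_ge_0. }
    apply Rmult_le_compat; [|apply Rmult_le_pos| easy|]; auto.
    - left. now apply Rinv_0_lt_compat.
    - left. now apply Rinv_0_lt_compat.
    - apply Rmult_le_compat; auto. left. now apply Rinv_0_lt_compat. }
  assert (H5 : (Cmod (poch (a + w + INR M) k) <= D ^ k * Cmod (poch z' k))%R).
  { replace (a + w + INR M) with (z' + (a - c')) by (unfold z'; ring).
    apply poch_ratio. lra. }
  rewrite kernel_RG. fold s. rewrite !Cmod_mult.
  assert (PF : (0 < INR (fact k))%R) by apply lt_0_INR, lt_O_fact.
  assert (H23 : (Cmod (/ RG (a + s)) * Cmod (RG (c' + s)) <=
    C2 * C3 * D ^ k * E * (exp (- (PI / 2 - h) * T) * exp (h * T) * exp ((PI / 2 + h) * T)))%R).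
  { eapply Rle_trans; [apply Rmult_le_compat; [apply Cmod_ge_0|apply Cmod_ge_0|apply H2|apply H3]|].
    set (e1 := exp (- (PI / 2 - h) * T)). set (e2 := exp (h * T)).
    set (e3 := exp ((PI / 2 + h) * T)).
    assert (0 < e1)%R by apply exp_pos. assert (0 < e2)%R by apply exp_pos.
    assert (0 < e3)%R by apply exp_pos.
    replace (C2 * Cmod (poch (a + w + INR M) k) * e1 * (C3 * (E * e2) * e3 * / Cmod (poch z' k)))%R
      with ((C2 * C3 * E * (e1 * e2 * e3)) * (Cmod (poch (a + w + INR M) k) * / Cmod (poch z' k)))%R
      by ring.
    replace (C2 * C3 * D ^ k * E * (e1 * e2 * e3))%R with
      ((C2 * C3 * E * (e1 * e2 * e3)) * D ^ k)%R by ring.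
    apply Rmult_le_compat_l.
    - left. assert (0 < e1 * e2 * e3)%R by pos_prod. pos_prod.
    - apply Rmult_le_reg_r with (Cmod (poch z' k)); [easy|].
      rewrite Rmult_assoc, Rinv_l by lra. lra. }
  eapply Rle_trans.
  { apply Rmult_le_compat; [| |apply Rmult_le_compat; [| |apply H1|apply H23]|apply H4];
    repeat apply Rmult_le_pos; apply Cmod_ge_0. }
  rewrite !Rpow_mult_distr. fold E.
  replace (C1 * (E * exp (h * T)) *
    (C2 * C3 * D ^ k * E * (exp (- (PI / 2 - h) * T) * exp (h * T) * exp ((PI / 2 + h) * T))) *
    (C4 * (B ^ k * / INR (fact k)) * exp (- (PI / 2 - h) * T)))%R with
    ((C1 * C2 * C3 * C4 * (E * E * D ^ k * B ^ k / INR (fact k))) *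
     (exp (h * T) * exp (- (PI / 2 - h) * T) * exp (h * T) * exp ((PI / 2 + h) * T) *
      exp (- (PI / 2 - h) * T)))%R by (field; lra).
  rewrite <- !exp_plus. apply Rmult_le_compat_l.
  - assert (QD : (0 < D ^ k)%R) by (apply pow_lt; lra).
    assert (QB : (0 < B ^ k)%R) by (apply pow_lt; lra).
    left. apply Rmult_lt_0_compat; [pos_prod|]. apply Rdiv_lt_0_compat; [pos_prod|easy].
  - apply exp_le. nra.
Qed.

(** * Integration of piecewise continuous functions *)

(** Extended by its limits at the ends, [f] becomes continuous on the closed interval. *)
Lemma is_RInt_base (f F : R -> R) (a b la lb : R) : (a < b)%R ->
  (forall t, (a < t < b)%R -> continuous f t) ->
  filterlim f (at_right a) (locally la) -> filterlim f (at_left b) (locally lb) ->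
  ex_RInt f a b /\
  ((forall t, (a <= t <= b)%R -> continuous F t) ->
   (forall t, (a < t < b)%R -> is_derive F t (f t)) -> is_RInt f a b (F b - F a)%R).
Proof.
  intros Hab Hc Ha Hb.
  destruct (C0_extension_lt f la lb a b Hab Hc Ha Hb) as [g [Gc [Ge _]]].
  assert (Ig : forall c, ex_RInt g a c) by (intros c; apply (ex_RInt_continuous (V := R_CompleteNormedModule)); intros; apply Gc).
  assert (Igf : ex_RInt f a b).
  { apply ex_RInt_ext with g; [|apply Ig]. rewrite Rmin_left, Rmax_right by lra. auto. }
  split; [easy|]. intros HF HD.
  set (K := fun t => (RInt g a t - F t)%R).
  assert (DI : forall t, is_derive (RInt g a) t (g t)).
  { intros t. apply is_derive_RInt with a; [|apply Gc].
    exists (mkposreal 1 Rlt_0_1). intros y _. apply (RInt_correct g a y), Ig. }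
  destruct (MVT_gen K a b (fun _ => 0%R)) as [c [_ E]].
  - intros t Ht. rewrite Rmin_left, Rmax_right in Ht by lra.
    replace 0%R with (minus (g t) (f t)).
    + apply @is_derive_minus; [apply DI|now apply HD].
    + rewrite Ge by easy. unfold minus, plus, opp; simpl; ring.
  - intros t Ht. rewrite Rmin_left, Rmax_right in Ht by lra.
    apply continuity_pt_filterlim. apply (continuous_minus (RInt g a) F).
    + apply (ex_derive_continuous (RInt g a)). eexists; apply DI.
    + now apply HF.
  - unfold K in E. rewrite RInt_point in E. unfold zero in E; simpl in E.
    replace (F b - F a)%R with (RInt g a b) by lra.
    apply is_RInt_ext with g; [|apply (RInt_correct g a b), Ig].
    rewrite Rmin_left, Rmax_right by lra. auto.
Qed.

(** Finitely many exceptional points are removed one at a time by splitting the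
    interval. *)
Lemma is_RInt_piecewise (f F : R -> R) (l : list R) (a b : R) : (a < b)%R ->
  (forall t, (a < t < b)%R -> ~ In t l -> continuous f t) ->
  (forall t, (a <= t < b)%R -> exists v, filterlim f (at_right t) (locally v)) ->
  (forall t, (a < t <= b)%R -> exists v, filterlim f (at_left t) (locally v)) ->
  ex_RInt f a b /\
  ((forall t, (a <= t <= b)%R -> continuous F t) ->
   (forall t, (a < t < b)%R -> ~ In t l -> is_derive F t (f t)) ->
   is_RInt f a b (F b - F a)%R).
Proof.
  revert a b. induction l as [|x l IH]; intros a b Hab Hc Hr Hl.
  - destruct (Hr a) as [la La]; [lra|]. destruct (Hl b) as [lb Lb]; [lra|].
    destruct (is_RInt_base f F a b la lb Hab) as [H1 H2]; auto.
  - destruct (Rlt_dec a x) as [Hx1|Hx1]; [destruct (Rlt_dec x b) as [Hx2|Hx2]|].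
    + destruct (IH a x Hx1) as [A1 A2].
      * intros t Ht Hn. apply Hc; [lra|]. intros [E|E]; [lra|easy].
      * intros t Ht. apply Hr. lra.
      * intros t Ht. apply Hl. lra.
      * destruct (IH x b Hx2) as [B1 B2].
        -- intros t Ht Hn. apply Hc; [lra|]. intros [E|E]; [lra|easy].
        -- intros t Ht. apply Hr. lra.
        -- intros t Ht. apply Hl. lra.
        -- split; [now apply (ex_RInt_Chasles (V := R_NormedModule)) with x|].
           intros HF HD.
           replace (F b - F a)%R with (plus (F x - F a)%R (F b - F x)%R)
             by (unfold plus; simpl; ring).
           apply (is_RInt_Chasles (V := R_NormedModule)) with x.
           ++ apply A2; [intros; apply HF; lra|].
              intros t Ht Hn. apply HD; [lra|]. intros [E|E]; [lra|easy].
           ++ apply B2; [intros; apply HF; lra|].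
              intros t Ht Hn. apply HD; [lra|]. intros [E|E]; [lra|easy].
    + destruct (IH a b Hab) as [A1 A2]; auto.
      * intros t Ht Hn. apply Hc; [lra|]. intros [E|E]; [lra|easy].
      * split; [easy|]. intros HF HD. apply A2; [easy|].
        intros t Ht Hn. apply HD; [lra|]. intros [E|E]; [lra|easy].
    + destruct (IH a b Hab) as [A1 A2]; auto.
      * intros t Ht Hn. apply Hc; [lra|]. intros [E|E]; [lra|easy].
      * split; [easy|]. intros HF HD. apply A2; [easy|].
        intros t Ht Hn. apply HD; [lra|]. intros [E|E]; [lra|easy].
Qed.

Definition pw_cont (f : R -> R) : Prop :=
  (exists l : list R, forall t, ~ In t l -> continuous f t) /\
  (forall t, (exists v : R, filterlim f (at_left t) (locally v)) /\
             (exists v : R, filterlim f (at_right t) (locally v))).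

Lemma pw_cont_continuous (f : R -> R) : (forall t, continuous f t) -> pw_cont f.
Proof.
  intros H. split; [exists nil; auto|]. intros t.
  split; exists (f t); eapply filterlim_filter_le_1; try apply H;
  intros P [e He]; exists e; auto.
Qed.

Lemma pw_cont_op2 (op : R -> R -> R) (f g : R -> R) :
  (forall x y, filterlim (fun z : R * R => op (fst z) (snd z))
     (filter_prod (locally x) (locally y)) (locally (op x y))) ->
  pw_cont f -> pw_cont g -> pw_cont (fun t => op (f t) (g t)).
Proof.
  intros Hop [[l Hl] Hf] [[l' Hl'] Hg]. split.
  - exists (l ++ l'). intros t Ht.
    assert (~ In t l /\ ~ In t l') as [N N'] by (split; intros I; apply Ht, in_or_app; auto).
    exact (filterlim_comp_2 f g op (Hl t N) (Hl' t N') (Hop (f t) (g t))).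
  - intros t. destruct (Hf t) as [[v1 V1] [v2 V2]]. destruct (Hg t) as [[w1 W1] [w2 W2]].
    split.
    + exists (op v1 w1). exact (filterlim_comp_2 f g op V1 W1 (Hop v1 w1)).
    + exists (op v2 w2). exact (filterlim_comp_2 f g op V2 W2 (Hop v2 w2)).
Qed.

Lemma pw_cont_plus (f g : R -> R) : pw_cont f -> pw_cont g -> pw_cont (fun t => f t + g t)%R.
Proof.
  apply (pw_cont_op2 Rplus). intros x y.
  exact (filterlim_plus (K := R_AbsRing) (V := R_NormedModule) x y).
Qed.

Lemma pw_cont_mult (f g : R -> R) : pw_cont f -> pw_cont g -> pw_cont (fun t => f t * g t)%R.
Proof.
  apply (pw_cont_op2 Rmult). intros x y. exact (filterlim_mult (K := R_AbsRing) x y).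
Qed.

Lemma pw_cont_abs (f : R -> R) : pw_cont f -> pw_cont (fun t => Rabs (f t)).
Proof.
  intros [[l Hl] Hf].
  assert (A : forall x : R, filterlim Rabs (locally x) (locally (Rabs x)))
    by (intros x; exact (filterlim_norm (K := R_AbsRing) (V := R_NormedModule) x)).
  split.
  - exists l. intros t Ht. apply (filterlim_comp _ _ _ f Rabs _ (locally (f t))); [now apply Hl|apply A].
  - intros t. destruct (Hf t) as [[v1 V1] [v2 V2]].
    split; [exists (Rabs v1)|exists (Rabs v2)]; eapply filterlim_comp; eauto.
Qed.

Lemma pw_cont_ext (f g : R -> R) : (forall t, f t = g t) -> pw_cont f -> pw_cont g.
Proof.
  intros E H. assert (f = g) as <- by now apply functional_extensionality.
  easy.
Qed.

Lemma pw_cont_const (c : R) : pw_cont (fun _ => c).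
Proof. apply pw_cont_continuous. intros t. apply continuous_const. Qed.

Lemma pw_cont_ex_RInt (f : R -> R) (a b : R) : pw_cont f -> (a <= b)%R -> ex_RInt f a b.
Proof.
  intros [[l Hl] Hf] [Hab| ->]; [|apply ex_RInt_point].
  apply (is_RInt_piecewise f (fun _ => 0%R) l a b Hab); intros; try apply Hf; auto.
Qed.

Definition pw_cont_C (f : R -> C) : Prop :=
  pw_cont (fun t => Re (f t)) /\ pw_cont (fun t => Im (f t)).

Definition cont (f : R -> C) (t : R) : Prop :=
  continuous (fun u => Re (f u)) t /\ continuous (fun u => Im (f u)) t.

Definition CInt (f : R -> C) (a b : R) : C :=
  (RInt (fun t => Re (f t)) a b, RInt (fun t => Im (f t)) a b).

Lemma pw_cont_C_mult (f g : R -> C) : pw_cont_C f -> pw_cont_C g -> pw_cont_C (fun t => f t * g t).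
Proof.
  intros [F1 F2] [G1 G2]. split.
  - apply (pw_cont_ext (fun t => Re (f t) * Re (g t) + (-1) * (Im (f t) * Im (g t)))%R).
    + intros t. unfold Re, Im. simpl. ring.
    + apply pw_cont_plus; [now apply pw_cont_mult|].
      apply pw_cont_mult; [apply pw_cont_const|now apply pw_cont_mult].
  - apply (pw_cont_ext (fun t => Re (f t) * Im (g t) + Im (f t) * Re (g t))%R).
    + intros t. unfold Re, Im. simpl. ring.
    + apply pw_cont_plus; now apply pw_cont_mult.
Qed.

Lemma pw_cont_C_cont (f : R -> C) : (forall t, cont f t) -> pw_cont_C f.
Proof. intros H. split; apply pw_cont_continuous; intros t; apply (H t). Qed.

Lemma CInt_correct (f : R -> C) (a b : R) : pw_cont_C f -> (a <= b)%R ->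
  is_RInt (V := C_R_NormedModule) f a b (CInt f a b).
Proof.
  intros [F1 F2] Hab. apply (is_RInt_fct_extend_pair (U := R_NormedModule) (V := R_NormedModule)).
  - apply (RInt_correct (V := R_CompleteNormedModule)). now apply pw_cont_ex_RInt.
  - apply (RInt_correct (V := R_CompleteNormedModule)). now apply pw_cont_ex_RInt.
Qed.

Lemma CInt_unique (f : R -> C) (a b : R) (v : C) :
  is_RInt (V := C_R_NormedModule) f a b v -> CInt f a b = v.
Proof.
  intros H. unfold CInt. destruct v as [v1 v2]. f_equal.
  - apply (is_RInt_unique (V := R_CompleteNormedModule)).
    apply (is_RInt_fct_extend_fst (U := R_NormedModule) (V := R_NormedModule) f a b (v1, v2) H).
  - apply (is_RInt_unique (V := R_CompleteNormedModule)).
    apply (is_RInt_fct_extend_snd (U := R_NormedModule) (V := R_NormedModule) f a b (v1, v2) H).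
Qed.

Lemma CInt_ext (f g : R -> C) (a b : R) : (a <= b)%R ->
  (forall t, (a < t < b)%R -> f t = g t) -> CInt f a b = CInt g a b.
Proof.
  intros Hab H. unfold CInt.
  f_equal; apply RInt_ext; rewrite Rmin_left, Rmax_right by lra; intros t Ht; simpl; now rewrite H.
Qed.

Lemma CInt_plus (f g : R -> C) (a b : R) : pw_cont_C f -> pw_cont_C g -> (a <= b)%R ->
  CInt (fun t => f t + g t) a b = CInt f a b + CInt g a b.
Proof.
  intros F G Hab. apply CInt_unique.
  apply (is_RInt_plus (V := C_R_NormedModule)); now apply CInt_correct.
Qed.

Lemma CInt_scal (c : C) (f : R -> C) (a b : R) : pw_cont_C f -> (a <= b)%R ->
  CInt (fun t => c * f t) a b = c * CInt f a b.
Proof.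
  intros [F1 F2] Hab.
  assert (I1 := RInt_correct (V := R_CompleteNormedModule) _ a b (pw_cont_ex_RInt _ a b F1 Hab)).
  assert (I2 := RInt_correct (V := R_CompleteNormedModule) _ a b (pw_cont_ex_RInt _ a b F2 Hab)).
  unfold CInt. apply C_eq_of_Re_Im; simpl; apply (is_RInt_unique (V := R_CompleteNormedModule)).
  - apply (is_RInt_ext (fun t => minus (scal (fst c) (Re (f t))) (scal (snd c) (Im (f t))))).
    + intros t _. reflexivity.
    + apply (is_RInt_minus (V := R_NormedModule)); now apply (is_RInt_scal (V := R_NormedModule)).
  - apply (is_RInt_ext (fun t => plus (scal (fst c) (Im (f t))) (scal (snd c) (Re (f t))))).
    + intros t _. reflexivity.
    + apply (is_RInt_plus (V := R_NormedModule)); now apply (is_RInt_scal (V := R_NormedModule)).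
Qed.

Lemma norm_C_R (z : C) : norm (V := C_R_NormedModule) z = Cmod z.
Proof.
  unfold norm. simpl. unfold prod_norm, Cmod. f_equal.
  change (Rabs (fst z) ^ 2 + Rabs (snd z) ^ 2 = fst z ^ 2 + snd z ^ 2)%R.
  now rewrite !pow2_abs.
Qed.

Lemma CInt_bound (f : R -> C) (m : R -> R) (a b I : R) : (a <= b)%R -> pw_cont_C f ->
  (forall t, (a <= t <= b)%R -> (Cmod (f t) <= m t)%R) ->
  is_RInt m a b I -> (Cmod (CInt f a b) <= I)%R.
Proof.
  intros Hab Hf Hm HI. rewrite <- norm_C_R.
  apply (norm_RInt_le (V := C_R_NormedModule) f m a b _ I Hab); [|now apply CInt_correct|easy].
  intros t Ht. rewrite norm_C_R. auto.
Qed.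

Lemma CInt_FTC (f F : R -> C) (l : list R) (a b : R) : (a <= b)%R -> pw_cont_C f ->
  (forall t, (a <= t <= b)%R -> cont F t) ->
  (forall t, (a <= t <= b)%R -> ~ In t l -> deriv_at F t (f t)) ->
  CInt f a b = F b - F a.
Proof.
  intros Hab [[[l1 L1] F1] [[l2 L2] F2]] Hc Hd.
  destruct Hab as [Hab| ->].
  2:{ unfold CInt. rewrite !RInt_point. apply C_eq_of_Re_Im; simpl; unfold zero; simpl; ring. }
  apply CInt_unique.
  apply (is_RInt_fct_extend_pair (U := R_NormedModule) (V := R_NormedModule) f a b).
  - apply (is_RInt_piecewise (fun t => Re (f t)) (fun t => Re (F t)) (l ++ l1) a b Hab).
    + intros t _ Ht. apply L1. intros I; apply Ht, in_or_app; auto.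
    + intros t _. apply F1.
    + intros t _. apply F1.
    + intros t Ht. now apply Hc.
    + intros t Ht Hn. apply Hd; [lra|]. intros I; apply Hn, in_or_app; auto.
  - apply (is_RInt_piecewise (fun t => Im (f t)) (fun t => Im (F t)) (l ++ l2) a b Hab).
    + intros t _ Ht. apply L2. intros I; apply Ht, in_or_app; auto.
    + intros t _. apply F2.
    + intros t _. apply F2.
    + intros t Ht. now apply Hc.
    + intros t Ht Hn. apply Hd; [lra|]. intros I; apply Hn, in_or_app; auto.
Qed.

Lemma cont_eps (f : R -> C) (t : R) : cont f t <->
  forall eps : R, (0 < eps)%R -> exists d : R, (0 < d)%R /\
    forall u, (Rabs (u - t) < d)%R -> (Cmod (f u - f t) <= eps)%R.
Proof.
  split.
  - intros [H1 H2] eps He.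
    assert (E2 : (0 < eps / 2)%R) by lra.
    assert (B1 := proj1 (filterlim_locally _ _) H1 (mkposreal _ E2)).
    assert (B2 := proj1 (filterlim_locally _ _) H2 (mkposreal _ E2)).
    destruct (filter_and _ _ B1 B2) as [d Hd]. exists d. split; [apply cond_pos|].
    intros u Hu. destruct (Hd u Hu) as [A1 A2].
    eapply Rle_trans; [apply Cmod_le_Re_Im|].
    change (Rabs (Re (f u) - Re (f t)) < eps / 2)%R in A1.
    change (Rabs (Im (f u) - Im (f t)) < eps / 2)%R in A2.
    change (Re (f u - f t)) with (Re (f u) - Re (f t))%R.
    change (Im (f u - f t)) with (Im (f u) - Im (f t))%R. lra.
  - intros H. split; apply filterlim_locally; intros e;
    destruct (H (e / 2)%R (is_pos_div_2 e)) as [d [D Hd]]; exists (mkposreal d D); intros u Hu;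
    specialize (Hd u Hu); assert (Pe := cond_pos e).
    + change (Rabs (Re (f u) - Re (f t)) < e)%R.
      change (Re (f u) - Re (f t))%R with (Re (f u - f t)).
      generalize (re_le_Cmod (f u - f t)). lra.
    + change (Rabs (Im (f u) - Im (f t)) < e)%R.
      change (Im (f u) - Im (f t))%R with (Im (f u - f t)).
      generalize (Im_le_Cmod (f u - f t)). lra.
Qed.

Lemma continuity_pt_Cmod (f : R -> C) (p : C) (t : R) : cont f t ->
  continuity_pt (fun u => Cmod (f u - p)) t.
Proof.
  intros H. apply continuity_pt_locally. intros e.
  destruct (proj1 (cont_eps _ _) H (e / 2)%R (is_pos_div_2 e)) as [d [D Hd]].
  exists (mkposreal d D). intros u Hu. specialize (Hd u Hu). assert (Pe := cond_pos e).
  assert (T1 := Cmod_triangle_rev (f u - p) (f t - p)).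
  assert (T2 := Cmod_triangle_rev (f t - p) (f u - p)).
  rewrite (Cmod_sub_comm (f t - p) (f u - p)) in T2.
  replace (f u - p - (f t - p)) with (f u - f t) in T1, T2 by ring.
  apply Rabs_def1; lra.
Qed.

Lemma Cmod_bounded_on (f : R -> C) (a b : R) : (a <= b)%R -> (forall t, cont f t) ->
  exists B, (0 < B)%R /\ forall t, (a <= t <= b)%R -> (Cmod (f t) < B)%R.
Proof.
  intros Hab Hf.
  destruct (continuity_ab_maj (fun t => Cmod (f t - 0)) a b Hab) as [m [Hm _]].
  - intros t _. now apply continuity_pt_Cmod.
  - exists (Cmod (f m) + 1)%R. split; [generalize (Cmod_ge_0 (f m)); lra|].
    intros t Ht. specialize (Hm t Ht). unfold Cminus in Hm.
    rewrite Copp_0, !Cplus_0_r in Hm. lra.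
Qed.

Lemma cont_comp (h : C -> C) (g : R -> C) (t : R) : cont g t -> Ccont h (g t) ->
  cont (fun u => h (g u)) t.
Proof.
  intros Hg Hh. apply cont_eps. intros eps He. destruct (Hh eps He) as [d [D Hd]].
  destruct (proj1 (cont_eps _ _) Hg d D) as [d' [D' Hd']]. exists d'. auto.
Qed.

Lemma continuous_C_cont (g : R -> C) (t : R) : continuous g t -> cont g t.
Proof.
  intros H. split; (eapply filterlim_comp; [exact H|]).
  - destruct (g t) as [x y]. apply (continuous_fst (U := R_UniformSpace) (V := R_UniformSpace)).
  - destruct (g t) as [x y]. apply (continuous_snd (U := R_UniformSpace) (V := R_UniformSpace)).
Qed.

(** * Path integrals *)

Lemma piecewise_C1_cont (g : R -> C) (t : R) : piecewise_C1 g -> cont g t.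
Proof. intros [H _]. apply continuous_C_cont, H. Qed.

Lemma piecewise_C1_pw_cont_C (g : R -> C) : piecewise_C1 g -> pw_cont_C (path_derive g).
Proof.
  intros [_ [[l Hl] Hlim]].
  assert (L : forall (F : (R -> Prop) -> Prop) (f : R -> C) (v : C),
     filterlim f F (locally v) ->
     filterlim (fun t => Re (f t)) F (locally (Re v)) /\
     filterlim (fun t => Im (f t)) F (locally (Im v))).
  { intros F f [x y] H. split; (eapply filterlim_comp; [exact H|]).
    - apply (continuous_fst (U := R_UniformSpace) (V := R_UniformSpace)).
    - apply (continuous_snd (U := R_UniformSpace) (V := R_UniformSpace)). }
  split; (split; [exists l; intros t Ht; apply (L _ _ _ (proj2 (Hl t Ht)))|]);
  intros t; destruct (Hlim t) as [[v V] [w W]];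
  (split; eexists; [apply (L _ _ _ V)|apply (L _ _ _ W)]).
Qed.

Lemma ex_derive_components (g : R -> C) (t : R) :
  ex_derive (K := R_AbsRing) (V := C_R_NormedModule) g t -> deriv_at g t (path_derive g t).
Proof.
  intros [l Hl].
  assert (H : is_derive (fun u => Re (g u)) t (Re l) /\ is_derive (fun u => Im (g u)) t (Im l)).
  { split; unfold is_derive in *.
    - apply (filterdiff_ext_lin (fun u => fst (g u)) (fun y => fst (scal y l))); [|reflexivity].
      apply (filterdiff_comp' (U := R_NormedModule) (V := C_R_NormedModule) (W := R_NormedModule) g fst); [exact Hl|].
      apply filterdiff_linear, is_linear_fst.
    - apply (filterdiff_ext_lin (fun u => snd (g u)) (fun y => snd (scal y l))); [|reflexivity].
      apply (filterdiff_comp' (U := R_NormedModule) (V := C_R_NormedModule) (W := R_NormedModule) g snd); [exact Hl|].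
      apply filterdiff_linear, is_linear_snd. }
  destruct H as [H1 H2]. unfold path_derive. split; simpl; apply Derive_correct; eexists; eassumption.
Qed.

Lemma piecewise_C1_deriv_at (g : R -> C) : piecewise_C1 g ->
  exists l : list R, forall t, ~ In t l -> deriv_at g t (path_derive g t).
Proof.
  intros [_ [[l Hl] _]]. exists l. intros t Ht. apply ex_derive_components, Hl, Ht.
Qed.

Definition path_int (g : R -> C) (a b : R) (h : C -> C) : C :=
  CInt (fun t => h (g t) * path_derive g t) a b.

(** Continuity is required on the whole path, although only arcs of it are integrated: the
    integrability of piecewise continuous functions is stated for functions on [R]. *)
Definition along (g : R -> C) (h : C -> C) : Prop := forall t, cont (fun u => h (g u)) t.

Lemma along_pw_cont_C (g : R -> C) (h : C -> C) : piecewise_C1 g -> along g h ->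
  pw_cont_C (fun t => h (g t) * path_derive g t).
Proof. intros Hg Hh. apply pw_cont_C_mult; [now apply pw_cont_C_cont|now apply piecewise_C1_pw_cont_C]. Qed.

Lemma along_Ccont (g : R -> C) (h : C -> C) : piecewise_C1 g ->
  (forall t, Ccont h (g t)) -> along g h.
Proof. intros Hg Hh t. apply cont_comp; [now apply piecewise_C1_cont|apply Hh]. Qed.

Lemma along_plus (g : R -> C) (h k : C -> C) : along g h -> along g k ->
  along g (fun s => h s + k s).
Proof.
  intros H K t. destruct (H t) as [H1 H2]. destruct (K t) as [K1 K2]. split.
  - apply (continuous_plus (fun u => Re (h (g u))) (fun u => Re (k (g u)))); easy.
  - apply (continuous_plus (fun u => Im (h (g u))) (fun u => Im (k (g u)))); easy.
Qed.

Lemma along_mult (g : R -> C) (h k : C -> C) : along g h -> along g k ->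
  along g (fun s => h s * k s).
Proof.
  intros H K t. destruct (H t) as [H1 H2]. destruct (K t) as [K1 K2]. split.
  - apply (continuous_minus (fun u => Re (h (g u)) * Re (k (g u)))%R
             (fun u => Im (h (g u)) * Im (k (g u)))%R).
    + now apply (continuous_mult (fun u => Re (h (g u))) (fun u => Re (k (g u)))).
    + now apply (continuous_mult (fun u => Im (h (g u))) (fun u => Im (k (g u)))).
  - apply (continuous_plus (fun u => Re (h (g u)) * Im (k (g u)))%R
             (fun u => Im (h (g u)) * Re (k (g u)))%R).
    + now apply (continuous_mult (fun u => Re (h (g u))) (fun u => Im (k (g u)))).
    + now apply (continuous_mult (fun u => Im (h (g u))) (fun u => Re (k (g u)))).
Qed.

Lemma along_const (g : R -> C) (c : C) : along g (fun _ => c).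
Proof. intros t. split; simpl; apply continuous_const. Qed.

Lemma path_int_ext (g : R -> C) (a b : R) (h k : C -> C) : (a <= b)%R ->
  (forall t, h (g t) = k (g t)) -> path_int g a b h = path_int g a b k.
Proof. intros Hab E. apply CInt_ext; [easy|]. intros t _. now rewrite E. Qed.

Lemma path_int_plus (g : R -> C) (a b : R) (h k : C -> C) : (a <= b)%R -> piecewise_C1 g ->
  along g h -> along g k -> path_int g a b (fun s => h s + k s) = path_int g a b h + path_int g a b k.
Proof.
  intros Hab Hg Hh Hk. unfold path_int. rewrite <- CInt_plus; auto using along_pw_cont_C.
  apply CInt_ext; [easy|]. intros. ring.
Qed.

Lemma path_int_scal (g : R -> C) (a b : R) (c : C) (h : C -> C) : (a <= b)%R -> piecewise_C1 g ->
  along g h -> path_int g a b (fun s => c * h s) = c * path_int g a b h.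
Proof.
  intros Hab Hg Hh. unfold path_int. rewrite <- CInt_scal; auto using along_pw_cont_C.
  apply CInt_ext; [easy|]. intros. ring.
Qed.

Lemma path_int_bound (g : R -> C) (a b : R) : (a <= b)%R -> piecewise_C1 g ->
  exists L, (0 <= L)%R /\ forall h M, along g h ->
    (forall t, (a <= t <= b)%R -> (Cmod (h (g t)) <= M)%R) ->
    (Cmod (path_int g a b h) <= M * L)%R.
Proof.
  intros Hab Hg.
  set (m := fun t => (Rabs (Re (path_derive g t)) + Rabs (Im (path_derive g t)))%R).
  assert (Pm : pw_cont m).
  { destruct (piecewise_C1_pw_cont_C g Hg). apply pw_cont_plus; now apply pw_cont_abs. }
  assert (Im0 := RInt_correct (V := R_CompleteNormedModule) _ a b (pw_cont_ex_RInt m a b Pm Hab)).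
  exists (RInt m a b). split.
  - apply (RInt_ge_0 m a b Hab); [now apply pw_cont_ex_RInt|].
    intros t _. unfold m. generalize (Rabs_pos (Re (path_derive g t))) (Rabs_pos (Im (path_derive g t))).
    lra.
  - intros h M Hh HM.
    apply (CInt_bound _ (fun t => M * m t)%R a b); [easy|now apply along_pw_cont_C| |].
    + intros t Ht. rewrite Cmod_mult. specialize (HM t Ht).
      apply Rmult_le_compat; try apply Cmod_ge_0; [easy|apply Cmod_le_Re_Im].
    + now apply (is_RInt_scal (V := R_NormedModule) m a b M).
Qed.

Lemma path_int_FTC (g : R -> C) (a b : R) (h : C -> C) (F : C -> C) : (a <= b)%R -> piecewise_C1 g ->
  along g h ->
  (forall t, (a <= t <= b)%R -> cont (fun u => F (g u)) t) ->
  (forall t, (a <= t <= b)%R -> deriv_at g t (path_derive g t) ->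
     deriv_at (fun u => F (g u)) t (h (g t) * path_derive g t)) ->
  path_int g a b h = F (g b) - F (g a).
Proof.
  intros Hab Hg Hh Hc Hd. destruct (piecewise_C1_deriv_at g Hg) as [l Hl].
  apply (CInt_FTC _ (fun t => F (g t)) l); auto using along_pw_cont_C.
Qed.

(** * Cauchy's theorem on closed chains *)

Record piece := Piece { pfun : R -> C; plo : R; phi : R; psgn : C }.

Definition good_piece (P : piece) : Prop :=
  piecewise_C1 (pfun P) /\ (plo P <= phi P)%R /\ Cmod (psgn P) = 1%R.

Definition good_chain (ch : list piece) : Prop := forall P, In P ch -> good_piece P.

Definition along_chain (ch : list piece) (h : C -> C) : Prop :=
  forall P, In P ch -> along (pfun P) h.

(** The whole paths, and not only the integrated arcs, have to avoid [p], so that the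
    integrands stay continuous on all of [R]. *)
Definition avoids (ch : list piece) (p : C) : Prop :=
  forall P, In P ch -> forall t, pfun P t <> p.

Definition on_chain (ch : list piece) (D : C -> Prop) : Prop :=
  forall P, In P ch -> forall t, (plo P <= t <= phi P)%R -> D (pfun P t).

Definition chain_int (ch : list piece) (h : C -> C) : C :=
  fold_right (fun P acc => psgn P * path_int (pfun P) (plo P) (phi P) h + acc) 0 ch.

Definition boundary (ch : list piece) (F : C -> C) : C :=
  fold_right (fun P acc => psgn P * (F (pfun P (phi P)) - F (pfun P (plo P))) + acc) 0 ch.

(** The endpoints cancel in pairs; letting [F] be arbitrary says so without naming them. *)
Definition closed_chain (ch : list piece) : Prop := forall F : C -> C, boundary ch F = 0.

Lemma good_chain_cons P ch : good_chain (P :: ch) -> good_piece P /\ good_chain ch.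
Proof. intros H. split; [apply H; now left|]. intros Q HQ. apply H. now right. Qed.

Lemma chain_int_ext ch (h k : C -> C) : good_chain ch ->
  (forall P t, In P ch -> h (pfun P t) = k (pfun P t)) -> chain_int ch h = chain_int ch k.
Proof.
  induction ch as [|P ch IH]; intros G E; [easy|]. simpl.
  destruct (good_chain_cons _ _ G) as [[_ [G1 _]] G2].
  rewrite (path_int_ext _ _ _ h k G1); [|intros t; apply E; now left].
  rewrite IH; [easy|easy|]. intros Q t HQ. apply E. now right.
Qed.

Lemma chain_int_plus ch (h k : C -> C) : good_chain ch -> along_chain ch h -> along_chain ch k ->
  chain_int ch (fun s => h s + k s) = chain_int ch h + chain_int ch k.
Proof.
  induction ch as [|P ch IH]; intros G H K; simpl; [ring|].
  destruct (good_chain_cons _ _ G) as [[G0 [G1 _]] G2].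
  rewrite IH, path_int_plus; [ring|easy|easy| | |easy| |];
  try (apply H; now left); try (apply K; now left);
  intros Q HQ; (apply H || apply K); now right.
Qed.

Lemma chain_int_scal ch c (h : C -> C) : good_chain ch -> along_chain ch h ->
  chain_int ch (fun s => c * h s) = c * chain_int ch h.
Proof.
  induction ch as [|P ch IH]; intros G H; simpl; [ring|].
  destruct (good_chain_cons _ _ G) as [[G0 [G1 _]] G2].
  rewrite IH, path_int_scal; [ring|easy|easy| |easy|]; [apply H; now left|].
  intros Q HQ; apply H; now right.
Qed.

Lemma along_chain_const ch (c : C) : along_chain ch (fun _ => c).
Proof. intros P _. apply along_const. Qed.

Lemma along_chain_plus ch (h k : C -> C) : along_chain ch h -> along_chain ch k ->
  along_chain ch (fun s => h s + k s).
Proof. intros H K P HP. apply along_plus; auto. Qed.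

Lemma along_chain_mult ch (h k : C -> C) : along_chain ch h -> along_chain ch k ->
  along_chain ch (fun s => h s * k s).
Proof. intros H K P HP. apply along_mult; auto. Qed.

Lemma along_chain_Ccont ch (h : C -> C) : good_chain ch ->
  (forall P t, In P ch -> Ccont h (pfun P t)) -> along_chain ch h.
Proof. intros G H P HP. apply along_Ccont; [apply (G P HP)|auto]. Qed.

Lemma along_chain_inv ch (p : C) : good_chain ch -> avoids ch p ->
  along_chain ch (fun s => / (s - p)).
Proof.
  intros G A. apply along_chain_Ccont; [easy|]. intros P t HP. apply Ccont_inv.
  - apply Cminus_eq_contra. now apply A.
  - apply Ccont_plus; [apply Ccont_id|apply Ccont_const].
Qed.

Lemma along_chain_csum ch (h : nat -> C -> C) n :
  (forall i, (i < n)%nat -> along_chain ch (h i)) ->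
  along_chain ch (fun s => csum (fun i => h i s) n).
Proof.
  induction n as [|n IH]; intros H; simpl; [apply along_chain_const|].
  apply along_chain_plus; [apply IH; intros; apply H; lia|apply H; lia].
Qed.

Lemma chain_int_zero ch : good_chain ch -> chain_int ch (fun _ => 0) = 0.
Proof.
  intros G. transitivity (chain_int ch (fun _ => 0 * 0)).
  - apply chain_int_ext; [easy|]. intros; ring.
  - rewrite (chain_int_scal ch 0 (fun _ => 0)); [ring|easy|apply along_chain_const].
Qed.

Lemma chain_int_csum ch (h : nat -> C -> C) n : good_chain ch ->
  (forall i, (i < n)%nat -> along_chain ch (h i)) ->
  chain_int ch (fun s => csum (fun i => h i s) n) = csum (fun i => chain_int ch (h i)) n.
Proof.
  intros G. induction n as [|n IH]; intros H; simpl.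
  - now apply chain_int_zero.
  - rewrite chain_int_plus, IH; auto.
    apply along_chain_csum. auto.
Qed.

Lemma chain_int_bound ch : good_chain ch ->
  exists L, (0 <= L)%R /\ forall h M, along_chain ch h -> on_chain ch (fun s => Cmod (h s) <= M)%R ->
    (Cmod (chain_int ch h) <= M * L)%R.
Proof.
  induction ch as [|P ch IH]; intros G.
  - exists 0%R. split; [lra|]. intros. simpl. rewrite Cmod_0. lra.
  - destruct (good_chain_cons _ _ G) as [[G0 [G1 G3]] G2].
    destruct (IH G2) as [L [HL1 HL2]].
    destruct (path_int_bound _ _ _ G1 G0) as [L' [HL1' HL2']].
    exists (L' + L)%R. split; [lra|]. intros h M Hh HM. simpl.
    eapply Rle_trans; [apply Cmod_triangle|]. rewrite Cmod_mult, G3, Rmult_1_l, Rmult_plus_distr_l.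
    apply Rplus_le_compat.
    + apply HL2'; [apply Hh; now left|]. apply HM. now left.
    + apply HL2; [intros Q HQ; apply Hh; now right|intros Q HQ; apply HM; now right].
Qed.

Lemma chain_int_primitive ch (h F : C -> C) : closed_chain ch ->
  (forall P, In P ch ->
     path_int (pfun P) (plo P) (phi P) h = F (pfun P (phi P)) - F (pfun P (plo P))) ->
  chain_int ch h = 0.
Proof.
  intros HC H. rewrite <- (HC F). clear HC. induction ch as [|P ch IH]; [easy|].
  simpl. rewrite IH; [|intros Q HQ; apply H; now right]. rewrite H; [easy|now left].
Qed.

Lemma chain_int_monomial ch n : good_chain ch -> closed_chain ch ->
  chain_int ch (fun s => s ^ n) = 0.
Proof.
  intros G HC. apply chain_int_primitive with (F := fun s => s ^ S n / INR (S n)); [easy|].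
  intros P HP. destruct (G P HP) as [G0 [G1 _]].
  assert (CP : forall k t, Ccont (fun s => s ^ k) (pfun P t)).
  { intros k t. induction k as [|k IH]; simpl; [apply Ccont_const|].
    apply Ccont_mult; [apply Ccont_id|easy]. }
  apply path_int_FTC with (F := fun s => s ^ S n / INR (S n)); auto.
  - apply along_Ccont; auto.
  - intros t _. apply (cont_comp (fun s => s ^ S n / INR (S n))); [now apply piecewise_C1_cont|].
    apply Ccont_mult; [apply CP|apply Ccont_const].
  - intros t _ D. assert (N := INR_C_neq0 (S n) ltac:(lia)).
    apply (deriv_at_ext (fun u => / INR (S n) * pfun P u ^ S n) _ t
      (/ INR (S n) * (INR (S n) * path_derive (pfun P) t * pfun P t ^ n))).
    + intros u. unfold Cdiv. ring.
    + field. easy.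
    + now apply deriv_at_scal, deriv_at_pow.
Qed.

Lemma along_chain_peval ch p : good_chain ch -> along_chain ch (peval p).
Proof. intros G. apply along_chain_Ccont; [easy|]. intros. apply Ccont_peval. Qed.

Lemma chain_int_peval ch p : good_chain ch -> closed_chain ch -> chain_int ch (peval p) = 0.
Proof.
  intros G HC.
  assert (A : forall k, along_chain ch (fun s => s ^ k)).
  { induction k as [|k IH]; simpl; [apply along_chain_const|].
    apply along_chain_mult; [|easy]. apply along_chain_Ccont; [easy|]. intros; apply Ccont_id. }
  assert (H : forall k, chain_int ch (fun s => s ^ k * peval p s) = 0).
  { induction p as [|c p IH]; intros k.
    - transitivity (chain_int ch (fun _ => 0)); [|now apply chain_int_zero].
      apply chain_int_ext; [easy|]. intros; simpl; ring.
    - rewrite (chain_int_ext ch _ (fun s => c * s ^ k + s ^ S k * peval p s) G).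
      + rewrite chain_int_plus, chain_int_scal, chain_int_monomial, IH by
          (try easy; try (apply along_chain_mult; auto using along_chain_const, along_chain_peval)).
        ring.
      + intros. simpl. ring. }
  rewrite <- (H O). apply chain_int_ext; [easy|]. intros. simpl. ring.
Qed.

Lemma chain_int_poly_approx ch R0 (h : C -> C) : good_chain ch -> closed_chain ch ->
  on_chain ch (disc R0) -> along_chain ch h -> poly_approx R0 h -> chain_int ch h = 0.
Proof.
  intros G HC HD Hh Ha. destruct (chain_int_bound ch G) as [L [HL1 HL2]].
  apply C_eq_of_close. intros eps He.
  destruct (Ha (eps / (L + 1))%R) as [p Hp]; [apply Rdiv_lt_0_compat; lra|].
  assert (Ap := along_chain_peval ch p G).
  assert (An : along_chain ch (fun s => - (1) * peval p s))
    by (apply along_chain_mult; [apply along_chain_const|easy]).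
  assert (E : chain_int ch h = chain_int ch (fun s => h s + - (1) * peval p s)).
  { rewrite chain_int_plus, chain_int_scal, chain_int_peval by easy. ring. }
  rewrite E. unfold Cminus. rewrite Copp_0, Cplus_0_r.
  eapply Rle_trans; [apply HL2 with (M := (eps / (L + 1))%R)|].
  - now apply along_chain_plus.
  - intros P HP t Ht. replace (h (pfun P t) + - (1) * peval p (pfun P t))
      with (h (pfun P t) - peval p (pfun P t)) by ring.
    apply Hp. now apply HD.
  - apply Rmult_le_reg_r with (L + 1)%R; [lra|].
    replace (eps / (L + 1) * L * (L + 1))%R with (eps * L)%R by (field; lra). nra.
Qed.

Lemma path_dist (g : R -> C) (a b : R) (p : C) : piecewise_C1 g -> (a <= b)%R ->
  (forall t, g t <> p) -> exists d : R, (0 < d)%R /\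
  forall t, (a <= t <= b)%R -> (d <= Cmod (g t - p))%R.
Proof.
  intros Hg Hab Hp.
  destruct (continuity_ab_min (fun t => Cmod (g t - p)) a b Hab) as [m [Hm _]].
  - intros t _. now apply continuity_pt_Cmod, piecewise_C1_cont.
  - exists (Cmod (g m - p)). split; [|auto].
    apply Cmod_gt_0, Cminus_eq_contra, Hp.
Qed.

Lemma chain_dist ch p : good_chain ch -> avoids ch p ->
  exists d : R, (0 < d)%R /\ on_chain ch (fun s => d <= Cmod (s - p))%R.
Proof.
  induction ch as [|P ch IH]; intros G A.
  - exists 1%R. split; [lra|]. intros Q [].
  - destruct (good_chain_cons _ _ G) as [[G0 [G1 _]] G2].
    destruct IH as [d [D Hd]]; [easy|intros Q HQ; apply A; now right|].
    destruct (path_dist _ _ _ p G0 G1) as [d' [D' Hd']]; [apply A; now left|].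
    exists (Rmin d d'). split; [now apply Rmin_case|]. intros Q [<-|HQ] t Ht.
    + eapply Rle_trans; [apply Rmin_r|auto].
    + eapply Rle_trans; [apply Rmin_l|now apply Hd].
Qed.

(** [2 i PI] times the winding number of the chain around [p]. *)
Definition wind (ch : list piece) (p : C) : C := chain_int ch (fun s => / (s - p)).

(** For a polynomial, the difference quotient is again a polynomial, so Cauchy's formula
    reduces to the vanishing of integrals of monomials; uniform limits follow. When [p] is
    outside the disc, both sides vanish because [/ (s - p)] is itself approximable. *)
Lemma cauchy_formula ch R0 (h : C -> C) p : (0 <= R0)%R -> good_chain ch -> closed_chain ch ->
  on_chain ch (disc R0) -> along_chain ch h -> poly_approx R0 h -> avoids ch p ->
  chain_int ch (fun s => h s * / (s - p)) = h p * wind ch p.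
Proof.
  intros HR G HC HD Hh Ha Hp.
  assert (Ai := along_chain_inv ch p G Hp).
  assert (Am := along_chain_mult ch _ _ Hh Ai).
  destruct (Rlt_le_dec R0 (Cmod p)) as [Out|In].
  - assert (Pi : poly_approx R0 (fun s => / (s - p))).
    { apply (poly_approx_ext R0 (fun s => / (- p + s))).
      - intros s _. f_equal. ring.
      - apply poly_approx_inv; [easy|]. now rewrite Cmod_opp. }
    unfold wind. rewrite (chain_int_poly_approx ch R0 _ G HC HD Am) by now apply poly_approx_mult.
    rewrite (chain_int_poly_approx ch R0 _ G HC HD Ai) by easy. ring.
  - destruct (chain_int_bound ch G) as [L [HL1 HL2]].
    destruct (chain_dist ch p G Hp) as [d [D Hd]].
    apply C_eq_of_close. intros eps He.
    set (K := (L * / d + Cmod (wind ch p))%R).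
    assert (Id : (0 < / d)%R) by now apply Rinv_0_lt_compat.
    assert (PW := Cmod_ge_0 (wind ch p)).
    assert (PK : (0 <= K)%R) by (unfold K; nra).
    set (e := (eps / (K + 1))%R). assert (Pe : (0 < e)%R) by (apply Rdiv_lt_0_compat; lra).
    destruct (Ha e Pe) as [q Hq].
    destruct (peval_divided_difference q p) as [Q HQ].
    assert (Aq := along_chain_peval ch q G).
    assert (An : along_chain ch (fun s => (h s + - (1) * peval q s) * / (s - p))).
    { apply along_chain_mult; [|easy]. apply along_chain_plus; [easy|].
      apply along_chain_mult; [apply along_chain_const|easy]. }
    assert (E : chain_int ch (fun s => h s * / (s - p)) =
       chain_int ch (fun s => (h s + - (1) * peval q s) * / (s - p)) + peval q p * wind ch p).
    { rewrite (chain_int_ext ch (fun s => h s * / (s - p))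
         (fun s => (h s + - (1) * peval q s) * / (s - p) +
            (peval Q s + peval q p * / (s - p))) G).
      - assert (A1 := along_chain_peval ch Q G).
        assert (A2 : along_chain ch (fun s => peval q p * / (s - p)))
          by now apply along_chain_mult; [apply along_chain_const|].
        rewrite (chain_int_plus ch _ (fun s => peval Q s + peval q p * / (s - p)) G An)
          by now apply along_chain_plus.
        rewrite (chain_int_plus ch (peval Q) (fun s => peval q p * / (s - p)) G A1 A2).
        rewrite (chain_int_scal ch (peval q p) (fun s => / (s - p)) G Ai).
        rewrite chain_int_peval by easy. unfold wind. ring.
      - intros P t HP. set (s := pfun P t).
        assert (N : s - p <> 0) by now apply Cminus_eq_contra, Hp.
        replace (peval Q s) with ((peval q s - peval q p) * / (s - p))
          by (rewrite HQ; field; easy). ring. }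
    rewrite E.
    replace (chain_int ch (fun s => (h s + - (1) * peval q s) * / (s - p)) +
      peval q p * wind ch p - h p * wind ch p) with
      (chain_int ch (fun s => (h s + - (1) * peval q s) * / (s - p)) -
       (h p - peval q p) * wind ch p) by ring.
    eapply Rle_trans; [apply Cmod_triangle_sub|].
    assert (B1 : (Cmod (chain_int ch (fun s => (h s + - (1) * peval q s) * / (s - p))%C)
       <= (e * / d) * L)%R).
    { apply HL2; [easy|]. intros P HP t Ht. rewrite Cmod_mult, Cmod_inv_total.
      apply Rmult_le_compat; [apply Cmod_ge_0| | |].
      - left. apply Rinv_0_lt_compat. eapply Rlt_le_trans; [apply D|]. now apply Hd.
      - replace (h (pfun P t) + - (1) * peval q (pfun P t))
          with (h (pfun P t) - peval q (pfun P t)) by ring.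
        apply Hq, HD; easy.
      - apply Rinv_le_contravar; [easy|]. now apply Hd. }
    assert (B2 : (Cmod ((h p - peval q p) * wind ch p) <= e * Cmod (wind ch p))%R).
    { rewrite Cmod_mult. apply Rmult_le_compat_r; [easy|]. now apply Hq. }
    assert (B3 : (e * K <= eps)%R).
    { unfold e. apply Rmult_le_reg_r with (K + 1)%R; [lra|].
      replace (eps / (K + 1) * K * (K + 1))%R with (eps * K)%R by (field; lra). nra. }
    unfold K in B3. lra.
Qed.

(** * Winding numbers *)

(** The logarithm of the open right half-plane. *)
Definition rlog (w : C) : C := (ln (Re w ^ 2 + Im w ^ 2) / 2, atan (Im w / Re w))%R.

Lemma is_derive_log_arg (x y : R -> R) (t dx dy : R) : (0 < x t)%R ->
  is_derive x t dx -> is_derive y t dy ->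
  is_derive (fun u => ln (x u ^ 2 + y u ^ 2) / 2)%R t
    ((dx * x t + dy * y t) / (x t ^ 2 + y t ^ 2))%R /\
  is_derive (fun u => atan (y u / x u))%R t
    ((dy * x t - dx * y t) / (x t ^ 2 + y t ^ 2))%R.
Proof.
  intros Hp H1 H2. assert (N : (0 < x t ^ 2 + y t ^ 2)%R) by nra. simpl in N.
  assert (D1 := is_derive_unique x t _ H1). assert (D2 := is_derive_unique y t _ H2).
  assert (Ex1 : ex_derive x t) by (eexists; exact H1).
  assert (Ex2 : ex_derive y t) by (eexists; exact H2).
  split.
  - apply (is_derive_ext (fun u => ln (x u * (x u * 1) + y u * (y u * 1)) / 2)%R); [reflexivity|].
    auto_derive; [repeat split; auto|].
    change (fun x0 => x x0) with x. change (fun x0 => y x0) with y.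
    rewrite D1, D2. field. lra.
  - auto_derive; [repeat split; auto; lra|].
    change (fun x0 => x x0) with x. change (fun x0 => y x0) with y.
    rewrite D1, D2. field. split; nra.
Qed.

Lemma deriv_at_rlog (f : R -> C) (t : R) (v : C) : (0 < Re (f t))%R -> deriv_at f t v ->
  deriv_at (fun u => rlog (f u)) t (v / f t).
Proof.
  intros Hp [H1 H2].
  assert (N : (0 < Re (f t) ^ 2 + Im (f t) ^ 2)%R) by nra.
  assert (E : v / f t =
     ((Re v * Re (f t) + Im v * Im (f t)) / (Re (f t) ^ 2 + Im (f t) ^ 2),
      (Im v * Re (f t) - Re v * Im (f t)) / (Re (f t) ^ 2 + Im (f t) ^ 2))%R).
  { unfold Cdiv, Cinv. apply C_eq_of_Re_Im; unfold Re, Im in *; simpl; simpl in N; field; lra. }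
  rewrite E.
  exact (is_derive_log_arg (fun u => Re (f u)) (fun u => Im (f u)) t _ _ Hp H1 H2).
Qed.

Lemma is_derive_inv_components (x y : R -> R) (t dx dy : R) : (0 < x t ^ 2 + y t ^ 2)%R ->
  is_derive x t dx -> is_derive y t dy ->
  is_derive (fun u => x u / (x u ^ 2 + y u ^ 2))%R t
    ((dx * (y t ^ 2 - x t ^ 2) - 2 * x t * y t * dy) / (x t ^ 2 + y t ^ 2) ^ 2)%R /\
  is_derive (fun u => - y u / (x u ^ 2 + y u ^ 2))%R t
    ((dy * (y t ^ 2 - x t ^ 2) + 2 * x t * y t * dx) / (x t ^ 2 + y t ^ 2) ^ 2)%R.
Proof.
  intros N H1 H2. simpl in N.
  assert (D1 := is_derive_unique x t _ H1). assert (D2 := is_derive_unique y t _ H2).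
  assert (Ex1 : ex_derive x t) by (eexists; exact H1).
  assert (Ex2 : ex_derive y t) by (eexists; exact H2).
  split; auto_derive; try (repeat split; auto; lra);
    change (fun x0 => x x0) with x; change (fun x0 => y x0) with y;
    rewrite D1, D2; field; lra.
Qed.

Lemma deriv_at_inv (f : R -> C) (t : R) (v : C) : f t <> 0 -> deriv_at f t v ->
  deriv_at (fun u => / f u) t (- v * / (f t * f t)).
Proof.
  intros Hf [H1 H2].
  assert (N : (0 < Re (f t) ^ 2 + Im (f t) ^ 2)%R).
  { rewrite <- Cmod2_alt. apply pow_lt. now apply Cmod_gt_0. }
  destruct (is_derive_inv_components (fun u => Re (f u)) (fun u => Im (f u)) t _ _ N H1 H2)
    as [D1 D2].
  assert (E : - v * / (f t * f t) =
    ((Re v * (Im (f t) ^ 2 - Re (f t) ^ 2) - 2 * Re (f t) * Im (f t) * Im v) /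
       (Re (f t) ^ 2 + Im (f t) ^ 2) ^ 2,
     (Im v * (Im (f t) ^ 2 - Re (f t) ^ 2) + 2 * Re (f t) * Im (f t) * Re v) /
       (Re (f t) ^ 2 + Im (f t) ^ 2) ^ 2)%R).
  { rewrite Cinv_mult_total. unfold Cinv.
    apply C_eq_of_Re_Im; unfold Re, Im in *; simpl; simpl in N; field; lra. }
  rewrite E. split; [exact D1|exact D2].
Qed.

Lemma deriv_at_shift (g : R -> C) t v (p : C) : deriv_at g t v -> deriv_at (fun u => g u - p) t v.
Proof.
  intros H. apply (deriv_at_ext (fun u => g u + - p) _ t (v + 0)); [easy|ring|].
  apply deriv_at_plus; [easy|apply deriv_at_const].
Qed.

Lemma Ccont_rlog (w : C) : (0 < Re w)%R -> Ccont rlog w.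
Proof.
  intros Hw eps Heps.
  assert (K1 : continuity_2d_pt (fun x y => ln (x ^ 2 + y ^ 2) / 2)%R (Re w) (Im w)).
  { apply continuity_2d_pt_mult; [|apply continuity_2d_pt_const].
    apply continuity_1d_2d_pt_comp.
    - apply derivable_continuous_pt. exists (/ (Re w ^ 2 + Im w ^ 2))%R.
      apply derivable_pt_lim_ln. nra.
    - apply continuity_2d_pt_plus; simpl; repeat apply continuity_2d_pt_mult;
      auto using continuity_2d_pt_id1, continuity_2d_pt_id2, continuity_2d_pt_const. }
  assert (K2 : continuity_2d_pt (fun x y => atan (y / x))%R (Re w) (Im w)).
  { apply continuity_1d_2d_pt_comp.
    - apply derivable_continuous_pt, derivable_pt_atan.
    - apply continuity_2d_pt_mult; [apply continuity_2d_pt_id2|].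
      apply continuity_2d_pt_inv; [apply continuity_2d_pt_id1|lra]. }
  assert (E2 : (0 < eps / 2)%R) by lra.
  destruct (K1 (mkposreal _ E2)) as [d1 H1]. destruct (K2 (mkposreal _ E2)) as [d2 H2].
  exists (Rmin d1 d2 / 2)%R.
  assert (PD : (0 < Rmin d1 d2)%R) by (apply Rmin_case; apply cond_pos). split; [lra|].
  intros s Hs.
  assert (S1 : (Rabs (Re s - Re w) < Rmin d1 d2)%R).
  { change (Re s - Re w)%R with (Re (s - w)). generalize (re_le_Cmod (s - w)). lra. }
  assert (S2 : (Rabs (Im s - Im w) < Rmin d1 d2)%R).
  { change (Im s - Im w)%R with (Im (s - w)). generalize (Im_le_Cmod (s - w)). lra. }
  assert (M1 := Rmin_l d1 d2). assert (M2 := Rmin_r d1 d2).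
  specialize (H1 (Re s) (Im s) ltac:(lra) ltac:(lra)).
  specialize (H2 (Re s) (Im s) ltac:(lra) ltac:(lra)).
  eapply Rle_trans; [apply Cmod_le_Re_Im|]. simpl in H1, H2.
  unfold rlog. simpl. unfold Rminus in H1, H2. lra.
Qed.

(** In a half-plane seen from [p], where [Re (e * (s - p))] is positive, a branch of the logarithm
    is a primitive of [/ (s - p)]. *)
Lemma path_int_half_plane (g : R -> C) (a b : R) (e p : C) : piecewise_C1 g -> (a <= b)%R ->
  (forall t, g t <> p) -> e <> 0 ->
  (forall t, (a <= t <= b)%R -> (0 < Re (e * (g t - p)))%R) ->
  path_int g a b (fun s => / (s - p)) = rlog (e * (g b - p)) - rlog (e * (g a - p)).
Proof.
  intros Hg Hab Hp He Hpos.
  assert (Cg : forall t, Ccont (fun s => e * (s - p)) (g t)).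
  { intros t. apply Ccont_mult; [apply Ccont_const|].
    apply Ccont_plus; [apply Ccont_id|apply Ccont_const]. }
  apply (path_int_FTC g a b (fun s => / (s - p)) (fun s => rlog (e * (s - p)))); auto.
  - apply along_Ccont; [easy|]. intros t. apply Ccont_inv.
    + apply Cminus_eq_contra, Hp.
    + apply Ccont_plus; [apply Ccont_id|apply Ccont_const].
  - intros t Ht. apply (cont_comp (fun s => rlog (e * (s - p)))); [now apply piecewise_C1_cont|].
    apply Ccont_comp; [auto|]. now apply Ccont_rlog, Hpos.
  - intros t Ht D.
    apply (deriv_at_ext (fun u => rlog (e * (g u - p))) _ t
      (e * path_derive g t / (e * (g t - p)))); [easy| |].
    + assert (N : g t - p <> 0) by apply Cminus_eq_contra, Hp. field. now split.
    + apply (deriv_at_rlog (fun u => e * (g u - p))); [now apply Hpos|].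
      now apply deriv_at_scal, deriv_at_shift.
Qed.

Lemma wind_half_plane ch (e p : C) : good_chain ch -> closed_chain ch -> avoids ch p -> e <> 0 ->
  on_chain ch (fun s => 0 < Re (e * (s - p)))%R -> wind ch p = 0.
Proof.
  intros G HC A He H. apply chain_int_primitive with (F := fun s => rlog (e * (s - p))); [easy|].
  intros P HP. destruct (G P HP) as [G0 [G1 _]].
  apply (path_int_half_plane _ _ _ e p G0 G1 (A P HP) He). intros t Ht. now apply (H P HP t).
Qed.

(** The quotient [(s - p') / (s - p)] stays in the right half-plane when [p'] is close
    to [p], so its logarithm is single-valued along the chain. *)
Lemma wind_locally_constant ch p : good_chain ch -> closed_chain ch -> avoids ch p ->
  exists d : R, (0 < d)%R /\ forall p', avoids ch p' -> (Cmod (p' - p) < d)%R ->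
    wind ch p' = wind ch p.
Proof.
  intros G HC A. destruct (chain_dist ch p G A) as [d [D Hd]].
  exists d. split; [easy|]. intros p' A' Hp'.
  assert (I1 := along_chain_inv ch p G A). assert (I2 := along_chain_inv ch p' G A').
  assert (E : chain_int ch (fun s => / (s - p') + - (1) * / (s - p)) = 0).
  { apply chain_int_primitive with (F := fun s => rlog ((s - p') * / (s - p))); [easy|].
    intros P HP. destruct (G P HP) as [G0 [G1 _]]. specialize (A P HP). specialize (A' P HP).
    assert (N : forall t, pfun P t - p <> 0) by (intros; apply Cminus_eq_contra, A).
    assert (N' : forall t, pfun P t - p' <> 0) by (intros; apply Cminus_eq_contra, A').
    assert (Pos : forall t, (plo P <= t <= phi P)%R ->
      (0 < Re ((pfun P t - p') * / (pfun P t - p)))%R).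
    { intros t Ht. specialize (N t). specialize (Hd P HP t Ht). set (s := pfun P t) in *.
      replace ((s - p') * / (s - p)) with (1 - (p' - p) * / (s - p)) by (field; easy).
      assert (B : (Cmod ((p' - p) * / (s - p)) < 1)%R).
      { rewrite Cmod_mult, Cmod_inv_total.
        apply Rmult_lt_reg_r with (Cmod (s - p)); [lra|].
        rewrite Rmult_assoc, Rinv_l by lra. lra. }
      assert (R1 := Re_le_Cmod ((p' - p) * / (s - p))).
      change (0 < 1 - Re ((p' - p) * / (s - p)))%R. lra. }
    assert (Sh : forall q t, Ccont (fun s => s - q) (pfun P t))
      by (intros; apply Ccont_plus; [apply Ccont_id|apply Ccont_const]).
    apply (path_int_FTC _ _ _ _ (fun s => rlog ((s - p') * / (s - p)))); auto.
    - apply along_plus; [now apply I2|]. apply along_mult; [apply along_const|now apply I1].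
    - intros t Ht. apply (cont_comp (fun s => rlog ((s - p') * / (s - p))));
        [now apply piecewise_C1_cont|].
      apply Ccont_comp; [|now apply Ccont_rlog, Pos].
      apply Ccont_mult; [apply Sh|]. apply Ccont_inv; [apply N|apply Sh].
    - intros t Ht HD. specialize (N t). specialize (N' t). set (g' := path_derive (pfun P) t) in *.
      apply (deriv_at_ext (fun u => rlog ((pfun P u - p') * / (pfun P u - p))) _ t
        ((g' * / (pfun P t - p) +
          (pfun P t - p') * (- g' * / ((pfun P t - p) * (pfun P t - p)))) /
          ((pfun P t - p') * / (pfun P t - p)))); [easy|field; now split|].
      apply (deriv_at_rlog (fun u => (pfun P u - p') * / (pfun P u - p))); [now apply Pos|].
      apply deriv_at_mult; [now apply deriv_at_shift|].
      apply (deriv_at_inv (fun u => pfun P u - p)); [easy|now apply deriv_at_shift]. }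
  rewrite chain_int_plus, chain_int_scal in E; auto.
  - unfold wind. replace (chain_int ch (fun s => / (s - p'))) with
      (chain_int ch (fun s => / (s - p)) + (chain_int ch (fun s => / (s - p')) +
         - (1) * chain_int ch (fun s => / (s - p)))) by ring. rewrite E. ring.
  - now apply along_chain_mult; [apply along_chain_const|].
Qed.

Lemma locally_constant_R (f : R -> C) :
  (forall t, exists d : R, (0 < d)%R /\ forall u, (Rabs (u - t) < d)%R -> f u = f t) ->
  forall a b, f a = f b.
Proof.
  intros H a b.
  assert (W : forall a b, (a <= b)%R -> f a = f b).
  { clear a b. intros a b Hab. apply C_eq_of_close. intros eps He.
    rewrite Cmod_sub_comm. eapply Rle_trans; [|left; exact He].
    rewrite <- (Rmult_0_l (b - a)).
    apply (deriv_at_bound f (fun _ => 0) a b 0); [easy|lra| |].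
    - intros t _. destruct (H t) as [d [D Hd]].
      split; simpl; (eapply is_derive_ext_loc; [|apply @is_derive_const]);
      exists (mkposreal d D); intros u Hu; symmetry; [apply (f_equal Re)|apply (f_equal Im)];
      now apply Hd.
    - intros. rewrite Cmod_0. lra. }
  destruct (Rle_lt_dec a b); [auto|symmetry; apply W; lra].
Qed.

(** Makes an arc parametrised by [0 <= t <= 1] admissible for all parameters. *)
Definition clamp (t : R) : R := Rmax 0 (Rmin 1 t).

Lemma clamp_range (t : R) : (0 <= clamp t <= 1)%R.
Proof.
  unfold clamp. split; [apply Rmax_l|]. apply Rmax_lub; [lra|apply Rmin_l].
Qed.

Lemma clamp_lipschitz (t u : R) : (Rabs (clamp t - clamp u) <= Rabs (t - u))%R.
Proof.
  unfold clamp, Rmax, Rmin, Rabs.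
  repeat (destruct (Rle_dec _ _) || destruct (Rcase_abs _)); lra.
Qed.

Lemma wind_constant_along ch (h : R -> C) : good_chain ch -> closed_chain ch ->
  (forall t, continuous h t) -> (forall t, (0 <= t <= 1)%R -> avoids ch (h t)) ->
  wind ch (h 0%R) = wind ch (h 1%R).
Proof.
  intros G HC Hh HA.
  assert (E := locally_constant_R (fun t => wind ch (h (clamp t)))).
  assert (C0 : clamp 0 = 0%R) by (unfold clamp, Rmax, Rmin; repeat destruct (Rle_dec _ _); lra).
  assert (C1 : clamp 1 = 1%R) by (unfold clamp, Rmax, Rmin; repeat destruct (Rle_dec _ _); lra).
  rewrite <- C0, <- C1. apply E. intros t.
  destruct (wind_locally_constant ch (h (clamp t)) G HC (HA _ (clamp_range t))) as [d [D Hd]].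
  assert (E2 : (0 < d / 2)%R) by lra.
  destruct (proj1 (cont_eps _ _) (continuous_C_cont h (clamp t) (Hh _)) (d / 2)%R E2)
    as [e [Pe He]].
  exists e. split; [easy|]. intros u Hu. apply Hd; [apply HA, clamp_range|].
  eapply Rle_lt_trans; [apply He|lra]. eapply Rle_lt_trans; [apply clamp_lipschitz|easy].
Qed.

(** * The residue theorem *)

(** There has to be at least one pole: without any, the left-hand side is the constant [1]. *)
Lemma partial_fractions (p : nat -> C) (n : nat) :
  (forall i j, (i < S n)%nat -> (j < i)%nat -> p i <> p j) ->
  exists rho : nat -> C, forall s : C, (forall i, (i < S n)%nat -> s <> p i) ->
    / cprod (fun i => s - p i) (S n) = csum (fun i => rho i * / (s - p i)) (S n).
Proof.
  induction n as [|n IH]; intros Hp.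
  - exists (fun _ => 1). intros s Hs. simpl.
    assert (N := Cminus_eq_contra _ _ (Hs O ltac:(lia))). field. easy.
  - destruct IH as [rho Hr]; [intros i j Hi Hj; apply Hp; lia|].
    exists (fun i => if Nat.eq_dec i (S n) then - csum (fun i => rho i * / (p i - p (S n))) (S n)
                     else rho i * / (p i - p (S n))).
    intros s Hs.
    change (cprod (fun i => s - p i) (S (S n))) with
      (cprod (fun i => s - p i) (S n) * (s - p (S n))).
    rewrite Cinv_mult_total, Hr by (intros; apply Hs; lia).
    change (csum ?u (S (S n))) with (csum u (S n) + u (S n)). cbv beta.
    destruct (Nat.eq_dec (S n) (S n)) as [_|F]; [|easy].
    assert (N0 := Cminus_eq_contra _ _ (Hs (S n) ltac:(lia))).
    rewrite Cmult_comm, <- csum_scal.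
    replace (- csum (fun i => rho i * / (p i - p (S n))) (S n) * / (s - p (S n))) with
      (csum (fun i => - / (s - p (S n)) * (rho i * / (p i - p (S n)))) (S n))
      by (rewrite csum_scal; ring).
    rewrite <- csum_plus. apply csum_ext. intros k Hk.
    destruct (Nat.eq_dec k (S n)) as [E|_]; [lia|].
    assert (N1 := Cminus_eq_contra _ _ (Hs k ltac:(lia))).
    assert (N2 : p k - p (S n) <> 0).
    { intros E. apply (Hp (S n) k); [lia|easy|]. symmetry. now apply Ceq_minus. }
    field. now repeat split.
Qed.

Lemma Ccont_eq_punctured (f g : C -> C) (p : C) (d : R) : (0 < d)%R ->
  Ccont f p -> Ccont g p ->
  (forall s, s <> p -> (Cmod (s - p) < d)%R -> f s = g s) -> f p = g p.
Proof.
  intros Hd Hf Hg E. apply C_eq_of_close. intros eps He.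
  destruct (Hf (eps / 2)%R) as [d1 [D1 H1]]; [lra|].
  destruct (Hg (eps / 2)%R) as [d2 [D2 H2]]; [lra|].
  set (m := (Rmin d (Rmin d1 d2) / 2)%R).
  assert (Pm : (0 < Rmin d (Rmin d1 d2))%R) by (repeat apply Rmin_case; easy).
  assert (L1 := Rmin_l d (Rmin d1 d2)). assert (L2 := Rmin_r d (Rmin d1 d2)).
  assert (L3 := Rmin_l d1 d2). assert (L4 := Rmin_r d1 d2).
  set (s := p + m). assert (Hs : Cmod (s - p) = m).
  { unfold s. replace (p + m - p) with (RtoC m) by ring. rewrite Cmod_R, Rabs_right; unfold m; lra. }
  assert (Ns : s <> p).
  { intros Es. rewrite Es in Hs. replace (p - p) with (RtoC 0) in Hs by ring.
    rewrite Cmod_0 in Hs. unfold m in Hs. lra. }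
  specialize (H1 s ltac:(unfold m in Hs; lra)). specialize (H2 s ltac:(unfold m in Hs; lra)).
  rewrite (E s Ns ltac:(unfold m in Hs; lra)) in H1.
  replace (f p - g p) with ((g s - g p) - (g s - f p)) by ring.
  eapply Rle_trans; [apply Cmod_triangle_sub|]. lra.
Qed.

Lemma isolated (p : nat -> C) (n : nat) (q : C) :
  exists d : R, (0 < d)%R /\ forall j, (j < n)%nat -> p j <> q -> (d <= Cmod (p j - q))%R.
Proof.
  induction n as [|n [d [D Hd]]]; [exists 1%R; split; [lra|lia]|].
  destruct (Ceq_dec (p n) q) as [E|N].
  - exists d. split; [easy|]. intros j Hj Hn. apply Hd; [|easy].
    assert (j <> n) by congruence. lia.
  - exists (Rmin d (Cmod (p n - q))). split.
    + apply Rmin_case; [easy|]. now apply Cmod_gt_0, Cminus_eq_contra.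
    + intros j Hj Hn. destruct (Nat.eq_dec j n) as [->|Nj]; [apply Rmin_r|].
      eapply Rle_trans; [apply Rmin_l|]. apply Hd; [lia|easy].
Qed.

(** The residue is the value at [p] of a continuous extension of [f s * (s - p)]. *)
Definition simple_residue (f : C -> C) (p r : C) : Prop :=
  exists g : C -> C, Ccont g p /\ g p = r /\ exists d : R, (0 < d)%R /\
    forall s, s <> p -> (Cmod (s - p) < d)%R -> f s * (s - p) = g s.

(** A function with simple poles is an approximable function divided by a product of
    linear factors; partial fractions reduce it to Cauchy's formula. *)
Lemma residue_theorem ch R0 (f h : C -> C) (p r : nat -> C) (n : nat) :
  (0 <= R0)%R -> good_chain ch -> closed_chain ch -> on_chain ch (disc R0) ->
  poly_approx R0 h -> along_chain ch h ->
  (forall i j, (i < S n)%nat -> (j < i)%nat -> p i <> p j) ->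
  (forall i, (i < S n)%nat -> avoids ch (p i)) ->
  (forall s, (forall i, (i < S n)%nat -> s <> p i) -> f s = h s * / cprod (fun i => s - p i) (S n)) ->
  (forall i, (i < S n)%nat -> wind ch (p i) <> 0 ->
     Ccont h (p i) /\ simple_residue f (p i) (r i)) ->
  chain_int ch f = csum (fun i => r i * wind ch (p i)) (S n).
Proof.
  intros HR G HC HD Ha Hh Hp Av Hf Hr.
  destruct (partial_fractions p n Hp) as [rho Hrho].
  assert (Ai : forall i, (i < S n)%nat -> along_chain ch (fun s => h s * / (s - p i))).
  { intros i Hi. apply along_chain_mult; [easy|]. now apply along_chain_inv; [|apply Av]. }
  rewrite (chain_int_ext ch f (fun s => csum (fun i => rho i * (h s * / (s - p i))) (S n)) G).
  2:{ intros P t HP. assert (N : forall i, (i < S n)%nat -> pfun P t <> p i)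
        by (intros i Hi; now apply (Av i Hi P HP)).
      rewrite Hf, Hrho by easy. rewrite <- csum_scal. apply csum_ext. intros. ring. }
  rewrite (chain_int_csum ch (fun i s => rho i * (h s * / (s - p i))) (S n) G).
  2:{ intros i Hi. apply along_chain_mult; [apply along_chain_const|auto]. }
  apply csum_ext. intros i Hi.
  rewrite (chain_int_scal ch (rho i) (fun s => h s * / (s - p i))) by auto.
  rewrite (cauchy_formula ch R0) by auto.
  destruct (Ceq_dec (wind ch (p i)) 0) as [->|Hw]; [ring|].
  destruct (Hr i Hi Hw) as [Ch [g [Cg [Eg [d [D Hg]]]]]].
  rewrite Cmult_assoc. f_equal.
  destruct (isolated p (S n) (p i)) as [d' [D' Hd']].
  set (chi := fun s => h s * csum (fun j => if Nat.eq_dec j i then rho i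
                                            else rho j * ((s - p i) * / (s - p j))) (S n)).
  assert (Echi : chi (p i) = rho i * h (p i)).
  { unfold chi. rewrite Cmult_comm. f_equal.
    clear -Hi. induction (S n) as [|m IH]; [lia|]. simpl.
    destruct (Nat.eq_dec m i) as [->|Nm].
    - rewrite csum_zero; [ring|]. intros k Hk. destruct (Nat.eq_dec k i); [lia|ring].
    - rewrite IH by lia. ring. }
  rewrite <- Echi, <- Eg. apply (Ccont_eq_punctured chi g (p i) (Rmin d d')).
  - now apply Rmin_case.
  - apply Ccont_mult; [easy|].
    apply (Ccont_csum (fun j s => if Nat.eq_dec j i then rho i
                                  else rho j * ((s - p i) * / (s - p j)))).
    intros j Hj. destruct (Nat.eq_dec j i) as [E|N]; [apply Ccont_const|].
    assert (Npp : p i <> p j).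
    { destruct (Nat.lt_ge_cases j i); [now apply Hp|].
      intros E. apply (Hp j i); [easy|lia|easy]. }
    apply Ccont_mult; [apply Ccont_const|].
    apply Ccont_mult; [apply Ccont_plus; [apply Ccont_id|apply Ccont_const]|].
    apply Ccont_inv; [now apply Cminus_eq_contra|].
    apply Ccont_plus; [apply Ccont_id|apply Ccont_const].
  - easy.
  - intros s Ns Hs. rewrite <- Hg by (easy || (eapply Rlt_le_trans; [exact Hs|apply Rmin_l])).
    assert (Nall : forall j, (j < S n)%nat -> s <> p j).
    { intros j Hj Ej. destruct (Ceq_dec (p j) (p i)) as [E|N]; [congruence|].
      specialize (Hd' j Hj N). rewrite <- Ej in Hd'.
      generalize (Rmin_r d d'). lra. }
    rewrite Hf, Hrho by easy. unfold chi. rewrite <- Cmult_assoc. f_equal.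
    rewrite Cmult_comm, <- csum_scal. apply csum_ext. intros j Hj.
    destruct (Nat.eq_dec j i) as [->|Nj]; [|ring].
    assert (N := Cminus_eq_contra _ _ (Nall i Hi)). field. easy.
Qed.

(** * Closing the path by a rectangle *)

Definition hline (y : R) : R -> C := fun t => (t, y).
Definition vline (x : R) : R -> C := fun t => (x, t).

Lemma path_derive_hline y t : path_derive (hline y) t = 1.
Proof.
  unfold path_derive, hline. simpl. rewrite Derive_id, Derive_const. easy.
Qed.

Lemma path_derive_vline x t : path_derive (vline x) t = Ci.
Proof.
  unfold path_derive, vline. simpl. rewrite Derive_id, Derive_const. easy.
Qed.

Lemma piecewise_C1_smooth (g : R -> C) (v : C) :
  (forall t, is_derive (K := R_AbsRing) (V := C_R_NormedModule) g t v) ->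
  (forall t, path_derive g t = v) -> piecewise_C1 g.
Proof.
  intros Hd Hp.
  assert (E : path_derive g = fun _ => v)
    by now apply functional_extensionality.
  split; [|split].
  - intros t. apply (ex_derive_continuous (K := R_AbsRing) (V := C_R_NormedModule) g). now exists v.
  - exists nil. intros t _. split; [now exists v|]. rewrite E. apply continuous_const.
  - intros t. rewrite E. split; exists v; apply filterlim_const.
Qed.

Lemma piecewise_C1_hline y : piecewise_C1 (hline y).
Proof.
  apply (piecewise_C1_smooth _ 1); [|apply path_derive_hline]. intros t.
  apply (is_derive_ext (K := R_AbsRing) (V := C_R_NormedModule)
    (fun u => plus (scal u (RtoC 1)) ((0%R, y) : C))).
  - intros u. unfold hline, RtoC, plus, scal; simpl. unfold prod_plus, prod_scal, plus, scal; simpl.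
    unfold mult; simpl. f_equal; ring.
  - assert (E : plus (scal (one : R_AbsRing) ((RtoC 1) : C_R_NormedModule)) zero = (RtoC 1)).
    { etransitivity; [apply (plus_zero_r (G := C_R_NormedModule))|].
      apply (scal_one (V := C_R_NormedModule)). }
    refine (eq_ind _ (fun v => is_derive (K := R_AbsRing) (V := C_R_NormedModule) _ t v) _ _ E).
    apply (is_derive_plus (V := C_R_NormedModule)); [|apply (is_derive_const (V := C_R_NormedModule))].
    apply (is_derive_scal_l (V := C_R_NormedModule)), (is_derive_id (K := R_AbsRing)).
Qed.

Lemma piecewise_C1_vline x : piecewise_C1 (vline x).
Proof.
  apply (piecewise_C1_smooth _ Ci); [|apply path_derive_vline]. intros t.
  apply (is_derive_ext (K := R_AbsRing) (V := C_R_NormedModule)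
    (fun u => plus (scal u Ci) (RtoC x))).
  - intros u. unfold vline, RtoC, Ci, plus, scal; simpl. unfold prod_plus, prod_scal, plus, scal; simpl.
    unfold mult; simpl. f_equal; ring.
  - assert (E : plus (scal (one : R_AbsRing) (Ci : C_R_NormedModule)) zero = Ci).
    { etransitivity; [apply (plus_zero_r (G := C_R_NormedModule))|].
      apply (scal_one (V := C_R_NormedModule)). }
    refine (eq_ind _ (fun v => is_derive (K := R_AbsRing) (V := C_R_NormedModule) _ t v) _ _ E).
    apply (is_derive_plus (V := C_R_NormedModule)); [|apply (is_derive_const (V := C_R_NormedModule))].
    apply (is_derive_scal_l (V := C_R_NormedModule)), (is_derive_id (K := R_AbsRing)).
Qed.

(** An arc of [L] closed by three sides of a rectangle, with clockwise orientation. *)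
Definition contour (L : R -> C) (sigma T1 T2 X : R) : list piece :=
  Piece L (- T1) T2 1 :: Piece (hline T2) sigma X 1 ::
  Piece (vline X) (- T1) T2 (- (1)) :: Piece (hline (- T1)) sigma X (- (1)) :: nil.

Lemma contour_int L sigma T1 T2 X h :
  chain_int (contour L sigma T1 T2 X) h =
  path_int L (- T1) T2 h + path_int (hline T2) sigma X h - path_int (vline X) (- T1) T2 h
  - path_int (hline (- T1)) sigma X h.
Proof. unfold contour. simpl. ring. Qed.

Lemma contour_pieces L sigma T1 T2 X (Q : piece -> Prop) :
  Q (Piece L (- T1) T2 1) -> Q (Piece (hline T2) sigma X 1) ->
  Q (Piece (vline X) (- T1) T2 (- (1))) -> Q (Piece (hline (- T1)) sigma X (- (1))) ->
  forall P, In P (contour L sigma T1 T2 X) -> Q P.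
Proof. intros H1 H2 H3 H4 P [<-|[<-|[<-|[<-|[]]]]]; easy. Qed.

Lemma contour_good L sigma T1 T2 X : piecewise_C1 L -> (- T1 <= T2)%R -> (sigma <= X)%R ->
  good_chain (contour L sigma T1 T2 X).
Proof.
  intros HL HT HX. unfold good_chain. apply contour_pieces;
  (split; [|split]; simpl;
   [auto using piecewise_C1_hline, piecewise_C1_vline|easy|]); try apply Cmod_1; apply Cmod_m1.
Qed.

Lemma contour_closed L sigma T1 T2 X : L (- T1)%R = (sigma, (- T1)%R) -> L T2 = (sigma, T2) ->
  closed_chain (contour L sigma T1 T2 X).
Proof.
  intros E1 E2 F. unfold contour, boundary. simpl. rewrite E1, E2. unfold hline, vline. ring.
Qed.

Lemma contour_avoids L sigma T1 T2 X p : (forall t, L t <> p) ->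
  (Im p <> T2)%R -> (Im p <> - T1)%R -> (Re p <> X)%R -> avoids (contour L sigma T1 T2 X) p.
Proof.
  intros H1 H2 H3 H4. refine (contour_pieces L sigma T1 T2 X (fun P => forall t, pfun P t <> p) _ _ _ _); simpl; intros t; [easy|..];
  intros <-; unfold hline, vline in *; simpl in *; congruence.
Qed.

Lemma contour_on L sigma T1 T2 X (D : C -> Prop) :
  (forall t, D (L t)) ->
  (forall t, (sigma <= t <= X)%R -> D (t, T2) /\ D (t, (- T1)%R)) ->
  (forall t, (- T1 <= t <= T2)%R -> D (X, t)) -> on_chain (contour L sigma T1 T2 X) D.
Proof.
  intros H1 H2 H3. 
  refine (contour_pieces L sigma T1 T2 X
    (fun P => forall t, (plo P <= t <= phi P)%R -> D (pfun P t)) _ _ _ _); simpl; intros t Ht; auto;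
  apply (H2 t Ht).
Qed.

Lemma indented_bounded sigma L : indented_vertical_line sigma L ->
  exists B, forall t, (Rabs (Re (L t)) <= B)%R.
Proof.
  intros [HL [_ [T HT]]]. set (T' := (Rabs T + 1)%R). assert (PT := Rabs_pos T).
  destruct (continuity_ab_maj (fun t => Rabs (Re (L t))) (- T') T') as [m [Hm _]].
  - unfold T'. lra.
  - intros t _. apply continuity_pt_filterlim.
    apply (filterlim_comp _ _ _ (fun u => Re (L u)) Rabs _ (locally (Re (L t)))).
    + apply (piecewise_C1_cont L t HL).
    + exact (filterlim_norm (K := R_AbsRing) (V := R_NormedModule) (Re (L t))).
  - exists (Rmax (Rabs (Re (L m))) (Rabs sigma)). intros t.
    destruct (Rle_lt_dec T' (Rabs t)) as [H|H].
    + rewrite HT; [apply Rmax_r|]. unfold T' in H. generalize (Rle_abs T). lra.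
    + eapply Rle_trans; [|apply Rmax_l]. apply Hm. apply Rabs_def2 in H. lra.
Qed.

Lemma indented_beyond sigma L : indented_vertical_line sigma L ->
  exists T, (0 < T)%R /\ forall t, (T <= Rabs t)%R -> L t = (sigma, t).
Proof.
  intros [_ [_ [T HT]]]. exists (Rabs T + 1)%R. generalize (Rabs_pos T) (Rle_abs T).
  intros. split; [lra|]. intros. apply HT. lra.
Qed.

Lemma wind_far_left L sigma T1 T2 X p : indented_vertical_line sigma L ->
  L (- T1)%R = (sigma, (- T1)%R) -> L T2 = (sigma, T2) ->
  (sigma <= X)%R -> (forall u, (Re p < Re (L u))%R) -> (- T1 < Im p < T2)%R ->
  wind (contour L sigma T1 T2 X) p = 0.
Proof.
  intros HL E1 E2 HX Hp HI.
  assert (Hs : (Re p < sigma)%R) by (specialize (Hp T2); rewrite E2 in Hp; easy).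
  apply wind_half_plane with (e := RtoC 1).
  - apply contour_good; [apply HL|lra|easy].
  - now apply contour_closed.
  - apply contour_avoids; try lra. intros t E. specialize (Hp t). rewrite E in Hp. lra.
  - apply C1_nz.
  - apply contour_on.
    + intros t. rewrite Cmult_1_l. change (0 < Re (L t) - Re p)%R. specialize (Hp t). lra.
    + intros t Ht. rewrite !Cmult_1_l. simpl. unfold Re in Hs. lra.
    + intros t Ht. rewrite Cmult_1_l. simpl. unfold Re in Hs. lra.
Qed.

Lemma wind_beyond L sigma T1 T2 X p : indented_vertical_line sigma L ->
  L (- T1)%R = (sigma, (- T1)%R) -> L T2 = (sigma, T2) ->
  (sigma <= X)%R -> (forall u, (Re (L u) < Re p)%R) -> (X < Re p)%R -> (- T1 < Im p < T2)%R ->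
  wind (contour L sigma T1 T2 X) p = 0.
Proof.
  intros HL E1 E2 HX Hp HX2 HI.
  apply wind_half_plane with (e := - RtoC 1).
  - apply contour_good; [apply HL|lra|easy].
  - now apply contour_closed.
  - apply contour_avoids; try lra. intros t E. specialize (Hp t). rewrite E in Hp. lra.
  - intros E. apply C1_nz. replace (RtoC 1) with (- - RtoC 1) by ring. rewrite E. ring.
  - apply contour_on.
    + intros t. replace (- (1) * (L t - p)) with (p - L t) by ring.
      change (0 < Re p - Re (L t))%R. specialize (Hp t). lra.
    + intros t Ht. replace (- (1) * ((t, T2) - p)) with (p - (t, T2)) by ring.
      replace (- (1) * ((t, (- T1)%R) - p)) with (p - (t, (- T1)%R)) by ring.
      simpl. unfold Re in HX2. lra.
    + intros t Ht. replace (- (1) * ((X, t) - p)) with (p - (X, t)) by ring.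
      simpl. unfold Re in HX2. lra.
Qed.

Lemma atan_complement (x y : R) : (0 < x)%R -> (0 < y)%R -> (atan (x / y) + atan (y / x) = PI / 2)%R.
Proof.
  intros Hx Hy. replace (y / x)%R with (/ (x / y))%R by (field; lra).
  rewrite atan_inv by now apply Rdiv_lt_0_compat. ring.
Qed.

(** Each of the four sides is seen from [p] inside a half-plane; the eight angles at the
    corners pair up to right angles. *)
Lemma wind_inside L sigma T1 T2 X p : indented_vertical_line sigma L ->
  L (- T1)%R = (sigma, (- T1)%R) -> L T2 = (sigma, T2) ->
  (forall u, (Re (L u) < Re p)%R) -> (Re p < X)%R -> (- T1 < Im p < T2)%R ->
  wind (contour L sigma T1 T2 X) p = - (2 * PI * Ci).
Proof.
  intros HL E1 E2 Hp HX HI.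
  assert (Hs : (sigma < Re p)%R) by (specialize (Hp T2); rewrite E2 in Hp; easy).
  unfold wind. rewrite contour_int.
  assert (NL : forall t, L t <> p) by (intros t E; specialize (Hp t); rewrite E in Hp; lra).
  assert (N1 : - RtoC 1 <> 0).
  { intros E. apply C1_nz. replace (RtoC 1) with (- - RtoC 1) by ring. rewrite E. ring. }
  assert (N2 : - Ci <> 0).
  { intros E. apply Ci_nz. replace Ci with (- - Ci) by ring. rewrite E. ring. }
  rewrite (path_int_half_plane L (- T1) T2 (- RtoC 1) p); [|apply HL|lra|easy|easy|].
  2:{ intros t _. replace (- (1) * (L t - p)) with (p - L t) by ring.
      change (0 < Re p - Re (L t))%R. specialize (Hp t). lra. }
  rewrite (path_int_half_plane (hline T2) sigma X (- Ci) p); [|apply piecewise_C1_hline|lra| |easy|].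
  2:{ intros t <-. simpl in HI. lra. }
  2:{ intros t _. unfold hline, Re, Im in *. simpl. lra. }
  rewrite (path_int_half_plane (vline X) (- T1) T2 (RtoC 1) p); [|apply piecewise_C1_vline|lra| |apply C1_nz|].
  2:{ intros t <-. simpl in HX. lra. }
  2:{ intros t _. unfold vline, Re, Im in *. simpl. lra. }
  rewrite (path_int_half_plane (hline (- T1)) sigma X Ci p); [|apply piecewise_C1_hline|lra| |apply Ci_nz|].
  2:{ intros t <-. simpl in HI. lra. }
  2:{ intros t _. unfold hline, Re, Im in *. simpl. lra. }
  rewrite E1, E2. unfold hline, vline.
  destruct p as [a b]. unfold Re, Im in Hs, HX, HI. simpl in Hs, HX, HI.
  (* The distances from [p] to the four sides, the left one being [Re s = sigma]. *)
  set (d := (a - sigma)%R). set (e := (X - a)%R). set (u := (T2 - b)%R). set (v := (b + T1)%R).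
  replace (- (1) * ((sigma, T2) - (a, b))) with ((d, (- u)%R) : C)
    by (apply C_eq_of_Re_Im; unfold d, u; simpl; ring).
  replace (- (1) * ((sigma, (- T1)%R) - (a, b))) with ((d, v) : C)
    by (apply C_eq_of_Re_Im; unfold d, v; simpl; ring).
  replace (- Ci * ((X, T2) - (a, b))) with ((u, (- e)%R) : C)
    by (apply C_eq_of_Re_Im; unfold e, u; simpl; ring).
  replace (- Ci * ((sigma, T2) - (a, b))) with ((u, d) : C)
    by (apply C_eq_of_Re_Im; unfold d, u; simpl; ring).
  replace (1 * ((X, T2) - (a, b))) with ((e, u) : C)
    by (apply C_eq_of_Re_Im; unfold e, u; simpl; ring).
  replace (1 * ((X, (- T1)%R) - (a, b))) with ((e, (- v)%R) : C)
    by (apply C_eq_of_Re_Im; unfold e, v; simpl; ring).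
  replace (Ci * ((X, (- T1)%R) - (a, b))) with ((v, e) : C)
    by (apply C_eq_of_Re_Im; unfold e, v; simpl; ring).
  replace (Ci * ((sigma, (- T1)%R) - (a, b))) with ((v, (- d)%R) : C)
    by (apply C_eq_of_Re_Im; unfold d, v; simpl; ring).
  assert (Pd : (0 < d)%R) by (unfold d; lra). assert (Pe : (0 < e)%R) by (unfold e; lra).
  assert (Pu : (0 < u)%R) by (unfold u; lra). assert (Pv : (0 < v)%R) by (unfold v; lra).
  clearbody d e u v.
  assert (A1 := atan_complement d u Pd Pu). assert (A2 := atan_complement d v Pd Pv).
  assert (A3 := atan_complement e u Pe Pu). assert (A4 := atan_complement e v Pe Pv).
  assert (On : forall x y : R, atan (- x / y) = (- atan (x / y))%R).
  { intros x y. rewrite <- atan_opp. f_equal. unfold Rdiv. ring. }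
  assert (Sq : forall x : R, ((- x) ^ 2 = x ^ 2)%R) by (intros; ring).
  unfold rlog. simpl Re. simpl Im. rewrite !On, !Sq.
  replace (u ^ 2 + e ^ 2)%R with (e ^ 2 + u ^ 2)%R by ring.
  replace (u ^ 2 + d ^ 2)%R with (d ^ 2 + u ^ 2)%R by ring.
  replace (v ^ 2 + e ^ 2)%R with (e ^ 2 + v ^ 2)%R by ring.
  replace (v ^ 2 + d ^ 2)%R with (d ^ 2 + v ^ 2)%R by ring.
  apply C_eq_of_Re_Im; simpl; lra.
Qed.

(** When the rectangle is large enough to contain the arc joining [p] to [q], both points
    have the same winding number. *)
Lemma wind_joined sigma L p q : indented_vertical_line sigma L -> joined_off_path L p q ->
  exists B, forall T1 T2 X, (B <= T1)%R -> (B <= T2)%R -> (B <= X)%R ->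
    L (- T1)%R = (sigma, (- T1)%R) /\ L T2 = (sigma, T2) /\ (sigma <= X)%R /\
    (Rabs (Re q) < X)%R /\ (- T1 < Im q < T2)%R /\
    avoids (contour L sigma T1 T2 X) p /\
    wind (contour L sigma T1 T2 X) p = wind (contour L sigma T1 T2 X) q.
Proof.
  intros HL [h [Hc [H0 [H1 Hn]]]].
  destruct (Cmod_bounded_on h 0 1 Rle_0_1 (fun t => continuous_C_cont h t (Hc t))) as [B [PB HB]]. destruct (indented_beyond _ _ HL) as [T [PT HT]].
  exists (B + T + Rabs sigma)%R. intros T1 T2 X HT1 HT2 HX.
  assert (Ps := Rabs_pos sigma). assert (Ls := Rle_abs sigma).
  assert (E1 : L (- T1)%R = (sigma, (- T1)%R)).
  { apply HT. rewrite Rabs_Ropp, Rabs_right; lra. }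
  assert (E2 : L T2 = (sigma, T2)) by (apply HT; rewrite Rabs_right; lra).
  assert (Hq : (Cmod q < B)%R) by (rewrite <- H1; apply HB; lra).
  assert (Q1 := re_le_Cmod q). assert (Q2 := Im_le_Cmod q).
  assert (A : forall t, (0 <= t <= 1)%R -> avoids (contour L sigma T1 T2 X) (h t)).
  { intros t Ht. specialize (HB t Ht).
    assert (I1 := re_le_Cmod (h t)). assert (I2 := Im_le_Cmod (h t)).
    apply Rabs_le_between in I1, I2.
    apply contour_avoids; try lra. intros u E. now apply (Hn t u Ht). }
  repeat split; try easy; try lra.
  - apply Rabs_le_between in Q2. lra.
  - apply Rabs_le_between in Q2. lra.
  - rewrite <- H0. apply A. lra.
  - rewrite <- H0, <- H1. apply wind_constant_along; try easy.
    + apply contour_good; [apply HL|lra|lra].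
    + now apply contour_closed.
Qed.

Lemma wind_left sigma L p : indented_vertical_line sigma L -> left_of_path L p ->
  exists B, forall T1 T2 X, (B <= T1)%R -> (B <= T2)%R -> (B <= X)%R ->
    avoids (contour L sigma T1 T2 X) p /\ wind (contour L sigma T1 T2 X) p = 0.
Proof.
  intros HL [q [Hq HJ]]. destruct (wind_joined sigma L p q HL HJ) as [B HB].
  exists B. intros T1 T2 X H1 H2 H3. destruct (HB T1 T2 X H1 H2 H3) as (E1 & E2 & HX & _ & HI & HA & ->).
  split; [easy|]. now apply wind_far_left.
Qed.

Lemma wind_right sigma L p : indented_vertical_line sigma L -> right_of_path L p ->
  exists B, forall T1 T2 X, (B <= T1)%R -> (B <= T2)%R -> (B <= X)%R ->
    avoids (contour L sigma T1 T2 X) p /\ wind (contour L sigma T1 T2 X) p = - (2 * PI * Ci).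
Proof.
  intros HL [q [Hq HJ]]. destruct (wind_joined sigma L p q HL HJ) as [B HB].
  exists B. intros T1 T2 X H1 H2 H3.
  destruct (HB T1 T2 X H1 H2 H3) as (E1 & E2 & HX & HR & HI & HA & ->).
  split; [easy|]. apply wind_inside; try easy. generalize (Rle_abs (Re q)). lra.
Qed.

Lemma two_PI_Ci_neq0 : 2 * PI * Ci <> 0.
Proof.
  apply Cmult_neq_0; [|apply Ci_nz]. rewrite <- RtoC_mult. intros E. apply RtoC_inj in E.
  generalize PI_RGT_0. lra.
Qed.

(** The two winding numbers differ. In particular no path can separate the poles when [a] is
    a nonpositive integer, because [Gamma (a + s)] and [Gamma (- s)] then share a pole. *)
Lemma not_left_and_right sigma L p : indented_vertical_line sigma L ->
  left_of_path L p -> right_of_path L p -> False.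
Proof.
  intros HL H1 H2. destruct (wind_left _ _ _ HL H1) as [B1 HB1].
  destruct (wind_right _ _ _ HL H2) as [B2 HB2].
  set (M := Rmax B1 B2). assert (M1 := Rmax_l B1 B2). assert (M2 := Rmax_r B1 B2).
  destruct (HB1 M M M M1 M1 M1) as [_ E1]. destruct (HB2 M M M M2 M2 M2) as [_ E2].
  apply two_PI_Ci_neq0. rewrite E1 in E2.
  replace (2 * PI * Ci) with (- - (2 * PI * Ci)) by ring. rewrite <- E2. ring.
Qed.

(** * The double series as a single series of confluent functions *)

Definition psi2_coef (a c c' x y : C) (n : nat) : C :=
  poch a n / poch c' n * (y ^ n / INR (fact n)) * Hyp1F1 (a + INR n) c x.

Lemma Psi2_term_factor a c c' x y m n :
  Psi2_term a c c' x y m n = hyp_term c' y a n * hyp_term c x (a + INR n) m.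
Proof.
  unfold Psi2_term, hyp_term. rewrite (Nat.add_comm m n), poch_add.
  unfold Cdiv. rewrite !Cinv_mult_total. ring.
Qed.

Lemma csum_geometric_bound (u : nat -> C) (A : R) (n : nat) : (0 <= A)%R ->
  (forall k, (Cmod (u k) <= A * (/ 2) ^ k)%R) -> (Cmod (csum u n) <= 2 * A)%R.
Proof.
  intros HA H.
  assert (G : (Cmod (csum u n) <= 2 * A * (1 - (/ 2) ^ n))%R).
  { induction n as [|n IH]; simpl; [rewrite Cmod_0; lra|].
    eapply Rle_trans; [apply Cmod_triangle|]. specialize (H n). lra. }
  assert (0 < (/ 2) ^ n)%R by (apply pow_lt; lra). nra.
Qed.

(** The terms are dominated by a product [C 2^-m 2^-n], so that summing first in [m] is
    legitimate. *)
Lemma Psi2_series a c c' x y : ~ nonpos_integer c -> ~ nonpos_integer c' ->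
  forall eps : R, (0 < eps)%R -> exists N, forall n, (N <= n)%nat ->
    (Cmod (csum (psi2_coef a c c' x y) (S n) - Psi2 a c c' x y) <= eps)%R.
Proof.
  intros Hc Hc'.
  destruct (Hyp1F1_tail c x 1 Hc Rlt_0_1) as [A [HA HT]].
  destruct (hyp_term_bound c' (exp 1 * y) 1 Hc' Rlt_0_1) as [A' [HA' HT']].
  set (C0 := (A * A' * exp (Cmod a) * exp (Cmod a))%R).
  assert (PC : (0 < C0)%R) by (unfold C0; pos_prod).
  assert (Hb : forall n, (Cmod (hyp_term c' y a n) * exp (Cmod (a + INR n)) <=
     A' * exp (Cmod a) * exp (Cmod a) * (/ 2) ^ n)%R).
  { intros n. specialize (HT' a n). rewrite Rmult_1_l in HT'.
    assert (E : hyp_term c' (exp 1 * y) a n = (exp 1) ^ n * hyp_term c' y a n).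
    { unfold hyp_term, Cdiv. rewrite Cpow_mult_l. ring. }
    rewrite E, Cmod_mult, Cmod_pow, Cmod_R, Rabs_right in HT' by (left; apply exp_pos).
    rewrite <- exp_INR_mult, Rmult_1_l in HT'.
    apply Rle_trans with (Cmod (hyp_term c' y a n) * (exp (Cmod a) * exp (INR n)))%R.
    - apply Rmult_le_compat_l; [apply Cmod_ge_0|]. rewrite <- exp_plus. apply exp_le.
      eapply Rle_trans; [apply Cmod_triangle|]. rewrite Cmod_INR. lra.
    - assert (P := exp_pos (Cmod a)).
      replace (A' * exp (Cmod a) * exp (Cmod a) * (/ 2) ^ n)%R with
        (exp (Cmod a) * (A' * exp (Cmod a) * (/ 2) ^ n))%R by ring.
      replace (Cmod (hyp_term c' y a n) * (exp (Cmod a) * exp (INR n)))%R with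
        (exp (Cmod a) * (exp (INR n) * Cmod (hyp_term c' y a n)))%R by ring.
      apply Rmult_le_compat_l; lra. }
  assert (Pair : forall n z M, (Cmod z <= A * exp (Cmod (a + INR n)) * (/ 2) ^ M)%R ->
     (Cmod (hyp_term c' y a n * z) <= C0 * (/ 2) ^ M * (/ 2) ^ n)%R).
  { intros n z M Hz. rewrite Cmod_mult.
    assert (P2 : (0 < (/ 2) ^ M)%R) by (apply pow_lt; lra).
    apply Rle_trans with (A * (/ 2) ^ M * (Cmod (hyp_term c' y a n) * exp (Cmod (a + INR n))))%R.
    - replace (A * (/ 2) ^ M * (Cmod (hyp_term c' y a n) * exp (Cmod (a + INR n))))%R with
        (Cmod (hyp_term c' y a n) * (A * exp (Cmod (a + INR n)) * (/ 2) ^ M))%R by ring.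
      apply Rmult_le_compat_l; [apply Cmod_ge_0|easy].
    - replace (C0 * (/ 2) ^ M * (/ 2) ^ n)%R with
        (A * (/ 2) ^ M * (A' * exp (Cmod a) * exp (Cmod a) * (/ 2) ^ n))%R by (unfold C0; ring).
      apply Rmult_le_compat_l; [nra|apply Hb]. }
  assert (Ecoef : forall n, psi2_coef a c c' x y n = hyp_term c' y a n * Hyp1F1 (a + INR n) c x)
    by reflexivity.
  assert (Bcoef : forall n, (Cmod (psi2_coef a c c' x y n) <= 2 * C0 * (/ 2) ^ n)%R).
  { intros n. destruct (HT (a + INR n) O) as [H1 H2]. rewrite Rmult_1_l in H1, H2.
    assert (B1 := Pair n _ O H1). assert (B2 := Pair n _ O H2). rewrite Ecoef.
    replace (hyp_term c' y a n * Hyp1F1 (a + INR n) c x) with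
      (hyp_term c' y a n * (Hyp1F1 (a + INR n) c x - csum (hyp_term c x (a + INR n)) 1) +
       hyp_term c' y a n * hyp_term c x (a + INR n) 0) by (simpl; ring).
    eapply Rle_trans; [apply Cmod_triangle|]. simpl pow in *. lra. }
  destruct (unif_cv_telescope (fun _ : unit => True)
     (fun n _ => csum (psi2_coef a c c' x y) (S n)) (fun n => 2 * C0 * (/ 2) ^ n)%R 0)
    as [U1 U2].
  { intros n _. apply Rmult_le_pos; [lra|apply pow_le; lra]. }
  { intros e He. destruct (pow_small (/ 2) (e / (2 * C0))) as [N HN]; [lra|apply Rdiv_lt_0_compat; lra|].
    exists N. split; [lia|]. apply Rmult_le_compat_l with (r := (2 * C0)%R) in HN; [|lra].
    replace (2 * C0 * (e / (2 * C0)))%R with e in HN by (field; lra). easy. }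
  { intros n _ _ _. change (csum (psi2_coef a c c' x y) (S (S n))) with
      (csum (psi2_coef a c c' x y) (S n) + psi2_coef a c c' x y (S n)).
    replace (csum (psi2_coef a c c' x y) (S n) + psi2_coef a c c' x y (S n) -
      csum (psi2_coef a c c' x y) (S n)) with (psi2_coef a c c' x y (S n)) by ring.
    eapply Rle_trans; [apply Bcoef|]. simpl. right. field. }
  set (l := Clim_seq (fun n => csum (psi2_coef a c c' x y) (S n))) in *.
  assert (El : Psi2 a c c' x y = l).
  { apply lim_eq.
    { apply filtermap_proper_filter, filter_prod_proper. }
    intros e He.
    destruct (pow_small (/ 2) (e / (4 * C0))) as [N HN]; [lra|apply Rdiv_lt_0_compat; lra|].
    apply Rmult_le_compat_l with (r := (4 * C0)%R) in HN; [|lra].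
    replace (4 * C0 * (e / (4 * C0)))%R with e in HN by (field; lra).
    assert (Small : forall n, (N <= n)%nat -> ((/ 2) ^ n <= (/ 2) ^ N)%R).
    { intros n Hn. induction Hn as [|n Hn IH]; [lra|]. simpl.
      assert (0 < (/ 2) ^ n)%R by (apply pow_lt; lra). lra. }
    exists (fun M => (N <= M)%nat) (fun M => (N <= M)%nat);
      [exists N; auto|exists N; auto|].
    intros M n HM Hn. simpl fst. simpl snd.
    rewrite sum_n_csum.
    rewrite (csum_ext _ (fun m => csum (fun n => Psi2_term a c c' x y m n) (S n)))
      by (intros; apply sum_n_csum).
    rewrite csum_switch.
    rewrite (csum_ext _ (fun n => hyp_term c' y a n * csum (hyp_term c x (a + INR n)) (S M))).
    2:{ intros k _. rewrite <- csum_scal. apply csum_ext. intros i _. apply Psi2_term_factor. }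
    replace (csum (fun n => hyp_term c' y a n * csum (hyp_term c x (a + INR n)) (S M)) (S n) - l)
      with (- csum (fun n => hyp_term c' y a n *
              (Hyp1F1 (a + INR n) c x - csum (hyp_term c x (a + INR n)) (S M))) (S n)
            - (l - csum (psi2_coef a c c' x y) (S n))).
    2:{ rewrite (csum_ext (fun n => hyp_term c' y a n *
              (Hyp1F1 (a + INR n) c x - csum (hyp_term c x (a + INR n)) (S M)))
          (fun n => psi2_coef a c c' x y n +
             (- (1)) * (hyp_term c' y a n * csum (hyp_term c x (a + INR n)) (S M))))
          by (intros; rewrite Ecoef; ring).
        rewrite csum_plus, (csum_scal (- (1))). ring. }
    eapply Rle_trans; [apply Cmod_triangle_sub|]. rewrite Cmod_opp.
    assert (B1 := U2 n tt ltac:(lia) I).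
    assert (B2 : (Cmod (csum (fun n => hyp_term c' y a n *
        (Hyp1F1 (a + INR n) c x - csum (hyp_term c x (a + INR n)) (S M)))%C (S n)) <=
        2 * (C0 * (/ 2) ^ M))%R).
    { apply csum_geometric_bound.
      - apply Rmult_le_pos; [lra|apply pow_le; lra].
      - intros k. apply Pair. destruct (HT (a + INR k) M) as [_ H2].
        rewrite Rmult_1_l in H2. easy. }
    assert (S1 := Small M HM). assert (S2 := Small n Hn). nra. }
  intros eps He. destruct (U1 eps He) as [N HN]. exists N. intros n Hn.
  rewrite El. now apply (HN n tt).
Qed.

(** * Powers with the principal logarithm *)

Lemma Cexp_Clog (w : C) : w <> 0 -> Cexp (Clog w) = w.
Proof.
  intros H. assert (P := proj1 (Cmod_gt_0 _) H).
  assert (B : (-1 <= Re w / Cmod w <= 1)%R).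
  { assert (I := re_le_Cmod w). apply Rabs_le_between in I.
    split; apply Rmult_le_reg_r with (Cmod w); try easy;
    replace (Re w / Cmod w * Cmod w)%R with (Re w) by (field; lra); lra. }
  assert (S : (sin (acos (Re w / Cmod w)) = Rabs (Im w) / Cmod w)%R).
  { rewrite sin_acos by easy.
    replace (1 - (Re w / Cmod w)²)%R with ((Rabs (Im w) / Cmod w)²)%R.
    - apply sqrt_Rsqr. apply Rmult_le_pos; [apply Rabs_pos|left; now apply Rinv_0_lt_compat].
    - assert (E := Cmod2_alt w). rewrite <- (pow2_abs (Im w)) in E.
      unfold Rsqr. apply Rmult_eq_reg_r with (Cmod w ^ 2)%R; [|nra].
      rewrite Rmult_minus_distr_r. replace (1 * Cmod w ^ 2)%R with (Cmod w ^ 2)%R by ring.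
      rewrite E at 2. field. lra. }
  unfold Cexp, Clog. simpl. rewrite exp_ln by easy.
  unfold Arg. destruct (Rle_dec 0 (Im w)) as [I|I].
  - rewrite cos_acos, S, Rabs_right by lra. apply C_eq_of_Re_Im; simpl; field; lra.
  - rewrite cos_neg, sin_neg, cos_acos, S, Rabs_left by lra.
    apply C_eq_of_Re_Im; simpl; field; lra.
Qed.

Lemma Cpower_INR_exponent (w : C) (n : nat) : w <> 0 -> Cpower w (INR n) = w ^ n.
Proof. intros H. unfold Cpower. now rewrite Cexp_INR_mult, Cexp_Clog. Qed.

Lemma Cmod_Cpower_le (w s : C) (th : R) : (Rabs (Arg w) <= th)%R ->
  (Cmod (Cpower w s) <= exp (Re s * ln (Cmod w)) * exp (th * Rabs (Im s)))%R.
Proof.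
  intros H. unfold Cpower. rewrite Cmod_Cexp, <- exp_plus. apply exp_le.
  rewrite re_mult. change (Re (Clog w)) with (ln (Cmod w)). change (Im (Clog w)) with (Arg w).
  assert (- (Im s * Arg w) <= th * Rabs (Im s))%R; [|lra].
  eapply Rle_trans; [apply Rle_abs|]. rewrite Rabs_Ropp, Rabs_mult, Rmult_comm.
  apply Rmult_le_compat_r; [apply Rabs_pos|easy].
Qed.

(** * The integrand and its residues *)

Definition integrand (a c c' x y s : C) : C := kernel a c c' x s * Cpower (- y) s.

(** The entire factor of the integrand. *)
Definition integrand_num (a c c' x y s : C) : C :=
  Hyp1F1 (a + s) c x * RG (c' + s) * Cpower (- y) s.

Lemma integrand_eq a c c' x y s :
  integrand a c c' x y s = integrand_num a c c' x y s * (/ RG (a + s) * / RG (- s)).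
Proof. unfold integrand, integrand_num. rewrite kernel_RG. ring. Qed.

Lemma poly_approx_integrand_num a c c' x y R0 : ~ nonpos_integer c ->
  poly_approx R0 (integrand_num a c c' x y).
Proof.
  intros Hc.
  assert (Sh : forall b, poly_approx R0 (fun s => b + s))
    by (intros; apply poly_approx_plus; [apply poly_approx_const|apply poly_approx_id]).
  apply poly_approx_mult; [apply poly_approx_mult|].
  - now apply poly_approx_Hyp1F1.
  - now apply poly_approx_RG.
  - apply poly_approx_Cexp, poly_approx_mult; [apply poly_approx_id|apply poly_approx_const].
Qed.

Lemma Ccont_integrand_num a c c' x y p : ~ nonpos_integer c -> Ccont (integrand_num a c c' x y) p.
Proof.
  intros Hc. apply (poly_approx_Ccont (Cmod p + 1)); [lra|]. now apply poly_approx_integrand_num.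
Qed.

Lemma Ccont_shift b p : Ccont (fun s => b + s) p.
Proof. apply Ccont_plus; [apply Ccont_const|apply Ccont_id]. Qed.

Lemma Ccont_opp p : Ccont (fun s => - s) p.
Proof.
  apply (Ccont_ext (fun s => - (1) * s)); [intros; ring|].
  apply Ccont_mult; [apply Ccont_const|apply Ccont_id].
Qed.

Lemma Ccont_poch (f : C -> C) n p : Ccont f p -> Ccont (fun s => poch (f s) n) p.
Proof.
  intros H. induction n as [|n IH]; simpl; [apply Ccont_const|].
  apply Ccont_mult; [easy|]. apply Ccont_plus; [easy|apply Ccont_const].
Qed.

Lemma Ccont_integrand a c c' x y p : ~ nonpos_integer c ->
  ~ nonpos_integer (a + p) -> ~ nonpos_integer (- p) -> Ccont (integrand a c c' x y) p.
Proof.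
  intros Hc H1 H2.
  apply (Ccont_ext (fun s => integrand_num a c c' x y s * (/ RG (a + s) * / RG (- s)))).
  { intros; symmetry; apply integrand_eq. }
  apply Ccont_mult; [now apply Ccont_integrand_num|]. apply Ccont_mult.
  - apply (Ccont_inv (fun s => RG (a + s))); [now apply RG_neq0|].
    apply Ccont_comp; [apply Ccont_shift|apply Ccont_RG].
  - apply (Ccont_inv (fun s => RG (- s))); [now apply RG_neq0|].
    apply (Ccont_comp RG (fun s => - s)); [apply Ccont_opp|apply Ccont_RG].
Qed.

Lemma poch_neg_INR (k : nat) : poch (- INR k)%R k = (- (1)) ^ k * INR (fact k).
Proof.
  rewrite RtoC_opp. induction k as [|k IH]; [simpl; ring|].
  rewrite poch_first. replace (- INR (S k) + 1) with (- INR k)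
    by (rewrite S_INR, RtoC_plus; ring).
  rewrite IH. replace (fact (S k)) with (S k * fact k)%nat by easy.
  rewrite mult_INR, RtoC_mult. simpl. ring.
Qed.

Lemma sign_neq0 (k : nat) : (- RtoC 1) ^ k <> 0.
Proof.
  apply Cpow_nz. intros E. apply C1_nz. replace (RtoC 1) with (- - RtoC 1) by ring.
  rewrite E. ring.
Qed.

Lemma poch_neg_INR_neq0 (k : nat) : poch (- INR k)%R k <> 0.
Proof. rewrite poch_neg_INR. apply Cmult_neq_0; [apply sign_neq0|apply fact_C_neq0]. Qed.

Lemma not_nonpos_shift (a : C) (k : nat) : ~ nonpos_integer a -> ~ nonpos_integer (a + INR k).
Proof.
  intros H [j E]. apply H. exists (j + k)%nat.
  replace a with (a + INR k - INR k) by ring. rewrite E, plus_INR, !RtoC_opp, RtoC_plus. ring.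
Qed.

(** The first [n + 1] steps of the recurrence isolate the vanishing factor of [RG]. *)
Lemma inv_RG_pole (z : C) (n : nat) : z + INR n <> 0 ->
  / RG z * (z + INR n) = / (poch z n * RG (z + INR (S n))).
Proof.
  intros H. rewrite (RG_shift z (S n)). cbn [poch]. rewrite !Cinv_mult_total.
  replace (/ poch z n * / (z + INR n) * / RG (z + INR (S n)) * (z + INR n)) with
    (/ poch z n * / RG (z + INR (S n)) * (/ (z + INR n) * (z + INR n))) by ring.
  rewrite Cinv_l by easy. ring.
Qed.

Definition right_residue (a c c' x y : C) (k : nat) : C :=
  - (integrand_num a c c' x y (INR k) * / RG (a + INR k) * / (poch (- INR k)%R k)).

Lemma residue_right a c c' x y k : ~ nonpos_integer a -> ~ nonpos_integer c ->
  simple_residue (integrand a c c' x y) (INR k) (right_residue a c c' x y k).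
Proof.
  intros Ha Hc.
  exists (fun s => - (1) * (integrand_num a c c' x y s * / RG (a + s) *
     / (poch (- s) k * RG (- s + INR (S k))))).
  assert (E1 : - INR k + INR (S k) = 1) by (rewrite S_INR, RtoC_plus; ring).
  split; [|split].
  - apply Ccont_mult; [apply Ccont_const|]. apply Ccont_mult; [apply Ccont_mult|].
    + now apply Ccont_integrand_num.
    + apply (Ccont_inv (fun s => RG (a + s))); [now apply RG_neq0, not_nonpos_shift|].
      apply Ccont_comp; [apply Ccont_shift|apply Ccont_RG].
    + apply (Ccont_inv (fun s => poch (- s) k * RG (- s + INR (S k)))).
      * rewrite E1, RG_1, <- RtoC_opp. apply Cmult_neq_0; [apply poch_neg_INR_neq0|apply C1_nz].
      * apply Ccont_mult; [apply Ccont_poch, Ccont_opp|].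
        apply (Ccont_comp RG (fun s => - s + INR (S k))); [|apply Ccont_RG].
        apply Ccont_plus; [apply Ccont_opp|apply Ccont_const].
  - unfold right_residue. rewrite E1, RG_1, RtoC_opp, Cmult_1_r. ring.
  - exists 1%R. split; [lra|]. intros s Hs _.
    assert (N : - s + INR k <> 0).
    { intros E. apply Hs. replace s with (- (- s + INR k) + INR k) by ring. rewrite E. ring. }
    rewrite <- inv_RG_pole by easy. rewrite integrand_eq. ring.
Qed.

Definition left_residue (a c c' x y : C) (j : nat) : C :=
  integrand_num a c c' x y (- a - INR j) * / RG (a + INR j) * / (poch (- INR j)%R j).

Lemma residue_left a c c' x y j : ~ nonpos_integer a -> ~ nonpos_integer c ->
  simple_residue (integrand a c c' x y) (- a - INR j) (left_residue a c c' x y j).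
Proof.
  intros Ha Hc.
  exists (fun s => integrand_num a c c' x y s * / RG (- s) *
     / (poch (a + s) j * RG (a + s + INR (S j)))).
  assert (E0 : a + (- a - INR j) = - INR j) by ring.
  assert (E1 : - INR j + INR (S j) = 1) by (rewrite S_INR, RtoC_plus; ring).
  assert (E2 : - (- a - INR j) = a + INR j) by ring.
  split; [|split].
  - apply Ccont_mult; [apply Ccont_mult|].
    + now apply Ccont_integrand_num.
    + apply (Ccont_inv (fun s => RG (- s))); [rewrite E2; now apply RG_neq0, not_nonpos_shift|].
      apply (Ccont_comp RG (fun s => - s)); [apply Ccont_opp|apply Ccont_RG].
    + apply (Ccont_inv (fun s => poch (a + s) j * RG (a + s + INR (S j)))).
      * rewrite E0, E1, RG_1, <- RtoC_opp.
        apply Cmult_neq_0; [apply poch_neg_INR_neq0|apply C1_nz].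
      * apply Ccont_mult; [apply Ccont_poch, Ccont_shift|].
        apply (Ccont_comp RG (fun s => a + s + INR (S j))); [|apply Ccont_RG].
        apply Ccont_plus; [apply Ccont_shift|apply Ccont_const].
  - unfold left_residue. rewrite E2, E0, E1, RG_1, RtoC_opp, Cmult_1_r. ring.
  - exists 1%R. split; [lra|]. intros s Hs _.
    assert (N : a + s + INR j <> 0).
    { intros E. apply Hs. replace s with (a + s + INR j - a - INR j) by ring. rewrite E. ring. }
    rewrite <- inv_RG_pole by easy. rewrite integrand_eq. ring.
Qed.

Lemma right_residue_eq (a c c' x y : C) (k : nat) : y <> 0 -> ~ nonpos_integer a -> ~ nonpos_integer c' ->
  right_residue a c c' x y k = - (RG c' * / RG a) * psi2_coef a c c' x y k.
Proof.
  intros Hy Ha Hc'. unfold right_residue, integrand_num, psi2_coef.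
  rewrite Cpower_INR_exponent.
  2:{ intros E. apply Hy. replace y with (- - y) by ring. rewrite E. ring. }
  rewrite poch_neg_INR. replace (- y) with (- (1) * y) by ring. rewrite Cpow_mult_l.
  assert (N1 := sign_neq0 k). assert (N2 := fact_C_neq0 k). assert (N3 := poch_neq0 c' k Hc').
  assert (N4 := poch_neq0 a k Ha). assert (N5 := RG_neq0 _ (not_nonpos_shift a k Ha)).
  rewrite (RG_shift c' k), (RG_shift a k). field. repeat split; easy.
Qed.

(** * The integral over the contour *)

(** The first [m] poles of [Gamma (- s)], followed by the first [m] poles of
    [Gamma (a + s)]. *)
Definition poles (a : C) (m i : nat) : C :=
  if lt_dec i m then INR i else - a - INR (i - m).

Definition pole_residue (a c c' x y : C) (m i : nat) : C :=
  if lt_dec i m then right_residue a c c' x y i else left_residue a c c' x y (i - m).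

Lemma cprod_split (u : nat -> C) n m :
  cprod u (n + m) = cprod u n * cprod (fun k => u (n + k)%nat) m.
Proof.
  induction m as [|m IH]; simpl; [rewrite Nat.add_0_r; ring|].
  rewrite Nat.add_succ_r. simpl. rewrite IH. ring.
Qed.

Lemma cprod_ext (u v : nat -> C) n :
  (forall k, (k < n)%nat -> u k = v k) -> cprod u n = cprod v n.
Proof.
  induction n as [|n IH]; intros H; simpl; [easy|].
  rewrite IH; [|intros; apply H; lia]. rewrite (H n); [easy|lia].
Qed.

Lemma cprod_poles a m s :
  cprod (fun i => s - poles a m i) (m + m) = (- (1)) ^ m * poch (- s) m * poch (a + s) m.
Proof.
  rewrite cprod_split.
  rewrite (cprod_ext _ (fun i => s - INR i)).
  2:{ intros i Hi. unfold poles. destruct (lt_dec i m); [easy|lia]. }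
  rewrite (cprod_ext (fun i => s - poles a m (m + i)) (fun i => a + s + INR i)).
  2:{ intros i Hi. unfold poles. destruct (lt_dec (m + i) m); [lia|].
      replace (m + i - m)%nat with i by lia. ring. }
  f_equal.
  - induction m as [|m IH]; simpl; [ring|]. rewrite IH. ring.
  - induction m as [|m IH]; simpl; [easy|]. now rewrite IH.
Qed.

Lemma poles_distinct a m i j : ~ nonpos_integer a -> (i < m + m)%nat -> (j < i)%nat ->
  poles a m i <> poles a m j.
Proof.
  intros Ha Hi Hj. unfold poles. destruct (lt_dec i m), (lt_dec j m); intros E; try lia.
  - apply RtoC_inj, INR_eq in E. lia.
  - apply Ha. exists (i - m + j)%nat. rewrite plus_INR, RtoC_opp, RtoC_plus.
    rewrite <- E. ring.
  - assert (E' : RtoC (INR (i - m)) = INR (j - m)).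
    { replace (RtoC (INR (i - m))) with (- a - (- a - INR (i - m))) by ring. rewrite E. ring. }
    apply RtoC_inj, INR_eq in E'. lia.
Qed.

Lemma large_index (B : R) : exists m : nat, (1 <= m)%nat /\ (B < INR m)%R.
Proof.
  destruct (nfloor_ex (Rabs B) (Rabs_pos B)) as [m [_ Hm]]. exists (S m). split; [lia|].
  rewrite S_INR. generalize (Rle_abs B). lra.
Qed.

Lemma chain_in_disc ch : good_chain ch -> exists R0, (0 <= R0)%R /\ on_chain ch (disc R0).
Proof.
  induction ch as [|P ch IH]; intros G; [exists 0%R; split; [lra|intros Q []]|].
  destruct (good_chain_cons _ _ G) as [[G0 [G1 _]] G2]. destruct (IH G2) as [R0 [HR H0]].
  destruct (Cmod_bounded_on (pfun P) (plo P) (phi P) G1) as [B [_ HB]].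
  { intros t. now apply piecewise_C1_cont. }
  exists (Rmax R0 B). split; [eapply Rle_trans; [exact HR|apply Rmax_l]|].
  intros Q [<-|HQ] t Ht; unfold disc.
  - eapply Rle_trans; [left; now apply HB|apply Rmax_r].
  - eapply Rle_trans; [now apply H0|apply Rmax_l].
Qed.

(** Inside a fixed disc the recurrence pushes the poles of both Gamma factors outside,
    at the price of the explicit product over [poles]. *)
Lemma integrand_residues a c c' x y ch : ~ nonpos_integer a -> ~ nonpos_integer c ->
  good_chain ch -> closed_chain ch ->
  (forall P t, In P ch -> ~ nonpos_integer (a + pfun P t) /\ ~ nonpos_integer (- pfun P t)) ->
  (forall k : nat, avoids ch (INR k)) -> (forall j : nat, avoids ch (- a - INR j)) ->
  exists m0, forall m, (m0 <= m)%nat ->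
    chain_int ch (integrand a c c' x y) =
    csum (fun k => right_residue a c c' x y k * wind ch (INR k)) m +
    csum (fun j => left_residue a c c' x y j * wind ch (- a - INR j)) m.
Proof.
  intros Ha Hc G HC HL Av1 Av2. destruct (chain_in_disc ch G) as [R0 [HR HD]].
  destruct (large_index (R0 + Cmod a)) as [m0 [H1 Hm0]].
  exists m0. intros m Hm. apply le_INR in Hm as Hm'.
  assert (Pa := Cmod_ge_0 a).
  assert (L0 : forall i : nat, (R0 < Cmod (INR m + INR i))%R).
  { intros i. rewrite <- RtoC_plus, <- plus_INR, Cmod_INR, plus_INR. generalize (pos_INR i). lra. }
  assert (L1 : forall i : nat, (R0 < Cmod (a + INR m + INR i))%R).
  { intros i. assert (T := Cmod_triangle_rev (INR m + INR i) (- a)).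
    rewrite Cmod_opp in T. replace (INR m + INR i - - a) with (a + INR m + INR i) in T by ring.
    rewrite <- RtoC_plus, <- plus_INR, Cmod_INR, plus_INR in T. generalize (pos_INR i). lra. }
  set (h := fun s => integrand_num a c c' x y s * (- (1)) ^ m *
     (/ RG (a + INR m + s) * / RG (INR m + - s))).
  assert (Ph : poly_approx R0 h).
  { apply poly_approx_mult; [apply poly_approx_mult; [now apply poly_approx_integrand_num|apply poly_approx_const]|].
    apply poly_approx_mult; [now apply poly_approx_inv_RG|].
    apply (poly_approx_opp R0 (fun s => / RG (INR m + s))). now apply poly_approx_inv_RG. }
  assert (Fh : forall s, integrand a c c' x y s =
     h s * / cprod (fun i => s - poles a m i) (m + m)).
  { intros s. rewrite cprod_poles, integrand_eq. unfold h.
    rewrite (RG_shift (a + s) m), (RG_shift (- s) m), !Cinv_mult_total.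
    replace (a + s + INR m) with (a + INR m + s) by ring.
    replace (- s + INR m) with (INR m + - s) by ring.
    assert (I := Cinv_r _ (sign_neq0 m)).
    match goal with |- ?l = _ =>
      transitivity (l * ((- (1)) ^ m * / (- (1)) ^ m)); [rewrite I; ring|ring] end. }
  assert (Ch : forall s, ~ nonpos_integer (a + INR m + s) -> ~ nonpos_integer (INR m + - s) ->
     Ccont h s).
  { intros s N1 N2. apply Ccont_mult; [apply Ccont_mult; [now apply Ccont_integrand_num|
      apply Ccont_const]|]. apply Ccont_mult.
    - apply (Ccont_inv (fun s => RG (a + INR m + s))); [now apply RG_neq0|].
      apply Ccont_comp; [apply Ccont_shift|apply Ccont_RG].
    - apply (Ccont_inv (fun s => RG (INR m + - s))); [now apply RG_neq0|].
      apply (Ccont_comp RG (fun s => INR m + - s)); [|apply Ccont_RG].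
      apply Ccont_plus; [apply Ccont_const|apply Ccont_opp]. }
  assert (Ah : along_chain ch h).
  { apply along_chain_Ccont; [easy|]. intros P t HP. destruct (HL P t HP) as [N1 N2].
    apply Ch.
    - replace (a + INR m + pfun P t) with (a + pfun P t + INR m) by ring.
      now apply not_nonpos_shift.
    - rewrite Cplus_comm. now apply not_nonpos_shift. }
  destruct m as [|m']; [lia|].
  change (S m' + S m')%nat with (S (m' + S m')) in Fh.
  rewrite (residue_theorem ch R0 (integrand a c c' x y) h (poles a (S m'))
     (pole_residue a c c' x y (S m')) (m' + S m'));
    [|exact HR|exact G|exact HC|exact HD|exact Ph|exact Ah| | | |].
  - change (S (m' + S m')) with (S m' + S m')%nat. rewrite csum_split. f_equal; apply csum_ext.
    + intros k Hk. unfold pole_residue, poles. destruct (lt_dec k (S m')); [easy|lia].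
    + intros k Hk. unfold pole_residue, poles. destruct (lt_dec (S m' + k) (S m')); [lia|].
      replace (S m' + k - S m')%nat with k by lia. easy.
  - intros i j Hi Hj. apply poles_distinct; [easy|lia|easy].
  - intros i Hi. unfold poles. destruct (lt_dec i (S m')); [apply Av1|apply Av2].
  - intros s _. apply Fh.
  - intros i Hi _. unfold poles, pole_residue. destruct (lt_dec i (S m')) as [Li|Li].
    + split; [|now apply residue_right]. apply Ch.
      * replace (a + INR (S m') + INR i) with (a + INR (S m' + i))
          by (rewrite plus_INR, RtoC_plus; ring). now apply not_nonpos_shift.
      * replace (INR (S m') + - INR i) with (RtoC (INR (S m' - i)))
          by (rewrite minus_INR, RtoC_minus by lia; ring).
        intros [j E]. apply RtoC_inj in E. assert (P := pos_INR j).
        assert (0 < INR (S m' - i))%R by (apply lt_0_INR; lia). lra.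
    + split; [|now apply residue_left]. apply Ch.
      * replace (a + INR (S m') + (- a - INR (i - S m'))) with (RtoC (INR (S m' - (i - S m'))))
          by (rewrite minus_INR, RtoC_minus by lia; ring).
        intros [j E]. apply RtoC_inj in E. assert (P := pos_INR j).
        assert (0 < INR (S m' - (i - S m')))%R by (apply lt_0_INR; lia). lra.
      * replace (INR (S m') + - (- a - INR (i - S m'))) with (a + INR (S m' + (i - S m')))
          by (rewrite plus_INR, RtoC_plus; ring). now apply not_nonpos_shift.
Qed.

(** Finitely many thresholds have a common one. *)
Lemma uniform_threshold (Q : nat -> R -> R -> R -> Prop) (n : nat) :
  (forall i, (i < n)%nat -> exists B, forall T1 T2 X,
     (B <= T1)%R -> (B <= T2)%R -> (B <= X)%R -> Q i T1 T2 X) ->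
  exists B, forall i T1 T2 X, (i < n)%nat ->
     (B <= T1)%R -> (B <= T2)%R -> (B <= X)%R -> Q i T1 T2 X.
Proof.
  induction n as [|n IH]; intros H; [exists 0%R; lia|].
  destruct IH as [B HB]; [intros; apply H; lia|]. destruct (H n) as [B' HB']; [lia|].
  exists (Rmax B B'). intros i T1 T2 X Hi H1 H2 H3.
  assert (M1 := Rmax_l B B'). assert (M2 := Rmax_r B B').
  destruct (Nat.eq_dec i n) as [->|N]; [apply HB'; lra|apply HB; lia || lra].
Qed.

Lemma half_not_INR (N k : nat) : (INR N + / 2)%R <> INR k.
Proof.
  intros E. assert (E' : (INR (2 * N + 1) = INR (2 * k))%R).
  { rewrite plus_INR, !mult_INR. simpl. lra. }
  apply INR_eq in E'. lia.
Qed.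

Lemma csum_indicator (u w : nat -> C) (v : C) (n m : nat) : (n <= m)%nat ->
  (forall k, (k < n)%nat -> w k = v) -> (forall k, (n <= k < m)%nat -> w k = 0) ->
  csum (fun k => u k * w k) m = v * csum u n.
Proof.
  intros Hnm H1 H2. replace m with (n + (m - n))%nat by lia. rewrite csum_split.
  rewrite (csum_zero (fun k => u (n + k)%nat * w (n + k)%nat)).
  2:{ intros k Hk. rewrite H2 by lia. ring. }
  rewrite <- csum_scal, Cplus_0_r. apply csum_ext. intros k Hk. rewrite H1 by easy. ring.
Qed.

Lemma right_of_path_off L p : right_of_path L p -> forall t, L t <> p.
Proof.
  intros [q [_ [h [_ [h0 [_ Hn]]]]]] t E. apply (Hn 0%R t); [lra|]. now rewrite h0.
Qed.

Lemma left_of_path_off L p : left_of_path L p -> forall t, L t <> p.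
Proof.
  intros [q [_ [h [_ [h0 [_ Hn]]]]]] t E. apply (Hn 0%R t); [lra|]. now rewrite h0.
Qed.

(** The poles with index at most [N] on the right, and the first [J] poles of
    [Gamma (a + s)], are the ones that the clockwise contour encloses. *)
Lemma contour_value a c c' x y sigma L (J : nat) :
  ~ nonpos_integer a -> ~ nonpos_integer c -> indented_vertical_line sigma L ->
  (forall k : nat, right_of_path L (INR k)) ->
  (forall j, (j < J)%nat -> right_of_path L (- a - INR j)) ->
  (forall j, (J <= j)%nat -> left_of_path L (- a - INR j)) ->
  exists B, forall T1 T2 N, (B <= T1)%R -> (B <= T2)%R -> (B <= INR N + / 2)%R ->
    chain_int (contour L sigma T1 T2 (INR N + / 2)) (integrand a c c' x y) =
    - (2 * PI * Ci) * (csum (right_residue a c c' x y) (S N) + csum (left_residue a c c' x y) J).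
Proof.
  intros Ha Hc HL Hk HjR HjL.
  destruct (indented_bounded _ _ HL) as [BL HBL].
  destruct (indented_beyond _ _ HL) as [TL [PTL HTL]].
  (* From these indices on, the poles lie beyond the whole path, and their winding numbers
     are known for every rectangle without a connecting arc. *)
  destruct (large_index BL) as [k0 [_ Hk0]].
  destruct (large_index (BL + Cmod a)) as [j0 [_ Hj0]].
  set (W := fun p v T1 T2 X => wind (contour L sigma T1 T2 X) p = v).
  destruct (uniform_threshold (fun k => W (INR k) (- (2 * PI * Ci))) k0) as [B1 HB1].
  { intros k _. destruct (wind_right _ _ _ HL (Hk k)) as [B HB]. exists B.
    intros T1 T2 X X1 X2 X3. apply (HB T1 T2 X X1 X2 X3). }
  destruct (uniform_threshold (fun j => W (- a - INR j) (- (2 * PI * Ci))) J) as [B2 HB2].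
  { intros j Hj. destruct (wind_right _ _ _ HL (HjR j Hj)) as [B HB]. exists B.
    intros T1 T2 X X1 X2 X3. apply (HB T1 T2 X X1 X2 X3). }
  destruct (uniform_threshold (fun j T1 T2 X => (J <= j)%nat -> W (- a - INR j) 0 T1 T2 X) j0)
    as [B3 HB3].
  { intros j _. destruct (le_dec J j) as [Hj|Hj]; [|exists 0%R; intros; easy].
    destruct (wind_left _ _ _ HL (HjL j Hj)) as [B HB]. exists B.
    intros T1 T2 X X1 X2 X3 _. apply (HB T1 T2 X X1 X2 X3). }
  assert (Pa := Cmod_ge_0 a). assert (Ra := re_le_Cmod a). assert (Ia := Im_le_Cmod a).
  apply Rabs_le_between in Ra, Ia.
  assert (PBL : (0 <= BL)%R) by (eapply Rle_trans; [apply Rabs_pos|apply (HBL 0%R)]).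
  assert (PR := Rabs_pos sigma). assert (LR := Rle_abs sigma).
  assert (Q1 := Rabs_pos B1). assert (Q2 := Rabs_pos B2). assert (Q3 := Rabs_pos B3).
  assert (Q1' := Rle_abs B1). assert (Q2' := Rle_abs B2). assert (Q3' := Rle_abs B3).
  exists (Rabs B1 + Rabs B2 + Rabs B3 + TL + BL + Cmod a + Rabs sigma + INR k0 + 1)%R.
  intros T1 T2 N HT1 HT2 HN. set (X := (INR N + / 2)%R) in *.
  assert (Pk0 := pos_INR k0).
  assert (E1 : L (- T1)%R = (sigma, (- T1)%R)).
  { apply HTL. rewrite Rabs_Ropp, Rabs_right; lra. }
  assert (E2 : L T2 = (sigma, T2)) by (apply HTL; rewrite Rabs_right; lra).
  assert (HReL : forall u, (- BL <= Re (L u) <= BL)%R)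
    by (intros u; apply Rabs_le_between, HBL).
  assert (NLk : forall (k : nat) t, L t <> INR k) by (intros k; now apply right_of_path_off).
  assert (NLj : forall (j : nat) t, L t <> - a - INR j).
  { intros j. destruct (Nat.lt_ge_cases j J); [now apply right_of_path_off, HjR|].
    now apply left_of_path_off, HjL. }
  set (ch := contour L sigma T1 T2 X).
  assert (G : good_chain ch) by (apply contour_good; [apply HL|lra|lra]).
  assert (HC : closed_chain ch) by now apply contour_closed.
  assert (Rej : forall j : nat, (Re (- a - INR j) = - Re a - INR j)%R) by (intros; unfold Re, Im; simpl; ring).
  assert (Imj : forall j : nat, (Im (- a - INR j) = - Im a)%R) by (intros; unfold Re, Im; simpl; ring).
  assert (A1 : forall k : nat, avoids ch (INR k)).
  { intros k. apply contour_avoids; [apply NLk|simpl; lra|simpl; lra|].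
    simpl. apply not_eq_sym, half_not_INR. }
  assert (A2 : forall j : nat, avoids ch (- a - INR j)).
  { intros j. apply contour_avoids; [apply NLj|rewrite Imj; lra|rewrite Imj; lra|].
    rewrite Rej. generalize (pos_INR j). lra. }
  destruct (integrand_residues a c c' x y ch Ha Hc G HC) as [m0 Hm0].
  - intros P t HP. split; intros [j E].
    + apply (A2 j P HP t). replace (pfun P t) with (a + pfun P t - a) by ring. rewrite E, RtoC_opp. ring.
    + apply (A1 j P HP t). replace (pfun P t) with (- - pfun P t) by ring. rewrite E, RtoC_opp. ring.
  - easy.
  - easy.
  - set (m := (m0 + S N + J + j0)%nat). rewrite (Hm0 m) by (unfold m; lia).
    rewrite (csum_indicator (right_residue a c c' x y) _ (- (2 * PI * Ci)) (S N) m);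
      [|unfold m; lia| |].
    + rewrite (csum_indicator (left_residue a c c' x y) _ (- (2 * PI * Ci)) J m);
        [ring|unfold m; lia| |].
      * intros j Hj. apply (HB2 j T1 T2 X Hj); lra.
      * intros j Hj. destruct (Nat.lt_ge_cases j j0) as [L0|L0].
        -- apply (HB3 j T1 T2 X L0); try lra. lia.
        -- apply wind_far_left; try easy; [lra| |rewrite Imj; lra].
           intros u. rewrite Rej. apply le_INR in L0. specialize (HReL u). lra.
    + intros k Hk'. destruct (Nat.lt_ge_cases k k0) as [L0|L0].
      * apply (HB1 k T1 T2 X L0); lra.
      * apply wind_inside; try easy; rewrite ?re_RtoC, ?im_RtoC; try lra.
        -- intros u. apply le_INR in L0. specialize (HReL u). lra.
        -- assert (INR k <= INR N)%R by (apply le_INR; lia). unfold X. lra.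
    + intros k Hk'. apply wind_beyond; try easy; rewrite ?re_RtoC, ?im_RtoC; try lra.
      * assert (S1 : (INR (S N) <= INR k)%R) by (apply le_INR; lia). rewrite S_INR in S1.
        intros u. specialize (HReL u). unfold X in HN. lra.
      * assert (S1 : (INR (S N) <= INR k)%R) by (apply le_INR; lia). rewrite S_INR in S1.
        unfold X. lra.
Qed.

(** * The Mellin-Barnes integral *)

Lemma floor_strip (s0 r : R) : (s0 <= r)%R ->
  exists k : nat, (s0 <= r - INR k <= s0 + 1)%R.
Proof.
  intros H. destruct (nfloor_ex (r - s0)) as [k Hk]; [lra|]. exists k. lra.
Qed.

(** The factorial in [kernel_bound] beats the geometric growth of [(- y)^s]. *)
Lemma integrand_decay a c c' x y s0 delta : ~ nonpos_integer c -> (0 < delta)%R ->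
  (Rabs (Arg (- y)) <= PI / 2 - delta)%R ->
  exists A, (0 < A)%R /\ forall s, (s0 <= Re s)%R -> far_from_poles a s ->
    (Cmod (integrand a c c' x y s) <= A * exp (- Re s) * exp (- (delta / 2) * Rabs (Im s)))%R.
Proof.
  intros Hc Hd HA.
  destruct (kernel_bound a c c' x s0 (delta / 2) Hc) as [A [K [PA [PK HK]]]]; [lra|].
  set (l := ln (Cmod (- y))).
  set (E := exp ((Rabs s0 + 1) * Rabs l)).
  (* With the extra [3 >= exp 1], a factor [exp (- k)] remains. *)
  destruct (pow_le_fact (K * exp l * 3)) as [A2 [PA2 H2]].
  { assert (P := exp_pos l). nra. }
  exists (A * A2 * E * exp (s0 + 1))%R.
  assert (PE : (0 < E)%R) by apply exp_pos.
  split; [pos_prod|].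
  intros s Hs HF. destruct (floor_strip s0 (Re s) Hs) as [k Hk].
  set (w := s - INR k).
  assert (Ew : Re w = (Re s - INR k)%R) by (unfold w, Re; simpl; ring).
  assert (Iw : Im w = Im s) by (unfold w, Im; simpl; ring).
  assert (Es : s = w + INR k) by (unfold w; ring).
  assert (HW := HK k w). rewrite Ew, Iw, <- Es in HW. specialize (HW Hk HF).
  assert (HP := Cmod_Cpower_le (- y) s _ HA). fold l in HP.
  unfold integrand. rewrite Cmod_mult.
  assert (PF : (0 < INR (fact k))%R) by apply lt_0_INR, lt_O_fact.
  assert (PKk : (0 < K ^ k)%R) by now apply pow_lt.
  set (T := Rabs (Im s)) in *.
  eapply Rle_trans; [apply Rmult_le_compat; [apply Cmod_ge_0|apply Cmod_ge_0|exact HW|exact HP]|].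
  assert (Q1 : (exp (Re s * l) <= E * exp l ^ k)%R).
  { rewrite <- exp_INR_mult. unfold E. rewrite <- exp_plus. apply exp_le.
    assert (B : ((Re s - INR k) * l <= (Rabs s0 + 1) * Rabs l)%R).
    { eapply Rle_trans; [apply Rle_abs|]. rewrite Rabs_mult.
      apply Rmult_le_compat_r; [apply Rabs_pos|]. apply Rabs_le.
      generalize (Rle_abs s0) (Rle_abs (- s0)). rewrite Rabs_Ropp. lra. }
    lra. }
  assert (Q2 : (K ^ k * exp l ^ k / INR (fact k) <= A2 * (/ 6) ^ k)%R).
  { specialize (H2 k). rewrite !Rpow_mult_distr in H2.
    assert (P3 : (0 < 3 ^ k)%R) by (apply pow_lt; lra).
    apply Rmult_le_reg_r with (3 ^ k * INR (fact k))%R; [nra|].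
    replace (K ^ k * exp l ^ k / INR (fact k) * (3 ^ k * INR (fact k)))%R with
      (K ^ k * exp l ^ k * 3 ^ k)%R by (field; lra).
    eapply Rle_trans; [apply H2|]. right.
    replace (/ 6)%R with (/ 2 * / 3)%R by field. rewrite Rpow_mult_distr, (pow_inv 3). field. lra. }
  assert (Q3 : ((/ 6) ^ k <= exp (s0 + 1) * exp (- Re s))%R).
  { rewrite <- exp_plus. apply Rle_trans with (exp (- INR k)).
    - replace (- INR k)%R with (- (1) * INR k)%R by ring. rewrite exp_INR_mult.
      apply pow_incr. split; [lra|]. rewrite exp_Ropp.
      apply Rinv_le_contravar; [apply exp_pos|]. generalize exp_le_3. lra.
    - apply exp_le. lra. }
  set (e1 := exp (- (PI / 2 - delta / 2) * T)). set (e2 := exp ((PI / 2 - delta) * T)).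
  assert (P1 : (0 < e1)%R) by apply exp_pos. assert (P2 : (0 < e2)%R) by apply exp_pos.
  assert (E12 : (e1 * e2 = exp (- (delta / 2) * T))%R).
  { unfold e1, e2. rewrite <- exp_plus. f_equal. lra. }
  rewrite <- E12.
  apply Rle_trans with (A * E * (K ^ k * exp l ^ k / INR (fact k)) * (e1 * e2))%R.
  - replace (A * (K ^ k / INR (fact k)) * e1 * (exp (Re s * l) * e2))%R with
      (A * (K ^ k / INR (fact k)) * (e1 * e2) * exp (Re s * l))%R by ring.
    replace (A * E * (K ^ k * exp l ^ k / INR (fact k)) * (e1 * e2))%R with
      (A * (K ^ k / INR (fact k)) * (e1 * e2) * (E * exp l ^ k))%R by (field; lra).
    apply Rmult_le_compat_l; [|exact Q1].
    left. assert (0 < K ^ k / INR (fact k))%R by now apply Rdiv_lt_0_compat.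
    assert (0 < e1 * e2)%R by pos_prod. pos_prod.
  - replace (A * A2 * E * exp (s0 + 1) * exp (- Re s) * (e1 * e2))%R with
      (A * E * (e1 * e2) * (A2 * (exp (s0 + 1) * exp (- Re s))))%R by ring.
    replace (A * E * (K ^ k * exp l ^ k / INR (fact k)) * (e1 * e2))%R with
      (A * E * (e1 * e2) * (K ^ k * exp l ^ k / INR (fact k)))%R by ring.
    apply Rmult_le_compat_l; [left; assert (0 < e1 * e2)%R by pos_prod; pos_prod|].
    eapply Rle_trans; [exact Q2|]. apply Rmult_le_compat_l; [lra|exact Q3].
Qed.

Lemma far_high a s : (1 <= Rabs (Im s))%R -> (1 <= Rabs (Im a + Im s))%R -> far_from_poles a s.
Proof.
  intros H1 H2. split; intros n.
  - assert (I := Im_le_Cmod (s - INR n)).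
    replace (Im (s - INR n)) with (Im s) in I by (unfold Im; simpl; ring). lra.
  - assert (I := Im_le_Cmod (a + s + INR n)).
    replace (Im (a + s + INR n)) with (Im a + Im s)%R in I by (unfold Im; simpl; ring). lra.
Qed.

Lemma far_half a s N : Re s = (INR N + / 2)%R -> (Cmod a <= INR N)%R -> far_from_poles a s.
Proof.
  intros H1 H2. split; intros n.
  - eapply Rle_trans; [|apply re_le_Cmod].
    replace (Re (s - INR n)) with (Re s - INR n)%R by (unfold Re; simpl; ring). rewrite H1.
    destruct (Nat.le_gt_cases n N) as [L|L].
    + apply le_INR in L. rewrite Rabs_right; lra.
    + assert (INR (S N) <= INR n)%R by (apply le_INR; lia). rewrite S_INR in H.
      rewrite Rabs_left; lra.
  - eapply Rle_trans; [|apply Re_le_Cmod].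
    replace (Re (a + s + INR n)) with (Re a + Re s + INR n)%R by (unfold Re; simpl; ring).
    rewrite H1. assert (R1 := re_le_Cmod a). apply Rabs_le_between in R1.
    generalize (pos_INR n). lra.
Qed.

Lemma far_not_pole a s : far_from_poles a s -> ~ nonpos_integer (a + s) /\ ~ nonpos_integer (- s).
Proof.
  intros [H1 H2]. split; intros [j E].
  - specialize (H2 j). rewrite E, RtoC_opp in H2.
    replace (- INR j + INR j) with (RtoC 0) in H2 by ring. rewrite Cmod_0 in H2. lra.
  - specialize (H1 j). replace s with (- - s) in H1 by ring. rewrite E, RtoC_opp in H1.
    replace (- - INR j - INR j) with (RtoC 0) in H1 by ring. rewrite Cmod_0 in H1. lra.
Qed.

Lemma is_RInt_exp_neg (a b : R) : is_RInt (fun t => exp (- t)) a b (exp (- a) - exp (- b))%R.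
Proof.
  replace (exp (- a) - exp (- b))%R with (minus (- exp (- b)) (- exp (- a)))%R
    by (unfold minus, plus, opp; simpl; ring).
  apply (is_RInt_derive (V := R_CompleteNormedModule) (fun t => - exp (- t))%R).
  - intros t _. auto_derive; [easy|ring].
  - intros t _. apply (ex_derive_continuous (fun t => exp (- t))). auto_derive. easy.
Qed.

Lemma path_int_hline_bound (y sigma X M : R) (h : C -> C) : (sigma <= X)%R -> (0 <= M)%R ->
  along (hline y) h ->
  (forall t, (sigma <= t <= X)%R -> (Cmod (h (t, y)) <= M * exp (- t))%R) ->
  (Cmod (path_int (hline y) sigma X h) <= M * exp (- sigma))%R.
Proof.
  intros HX HM Ha Hb.
  apply Rle_trans with (M * (exp (- sigma) - exp (- X)))%R.
  - apply (CInt_bound _ (fun t => M * exp (- t))%R sigma X); [easy| | |].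
    + now apply along_pw_cont_C; [apply piecewise_C1_hline|].
    + intros t Ht. rewrite path_derive_hline, Cmult_1_r. now apply Hb.
    + apply (is_RInt_scal (V := R_NormedModule)), is_RInt_exp_neg.
  - apply Rmult_le_compat_l; [easy|]. generalize (exp_pos (- X)). lra.
Qed.

Lemma path_int_vline_bound (x a b M : R) (h : C -> C) : (a <= b)%R -> along (vline x) h ->
  (forall t, (a <= t <= b)%R -> (Cmod (h (x, t)) <= M)%R) ->
  (Cmod (path_int (vline x) a b h) <= (b - a) * M)%R.
Proof.
  intros HX Ha Hb.
  apply (CInt_bound _ (fun t => M)%R a b); [easy| | |].
  - now apply along_pw_cont_C; [apply piecewise_C1_vline|].
  - intros t Ht. rewrite Cmod_mult, path_derive_vline, Cmod_Ci, Rmult_1_r. now apply Hb.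
  - exact (is_RInt_const (V := R_NormedModule) a b M).
Qed.

Lemma exp_neg_small (eps : R) : (0 < eps)%R -> exists X0, forall X, (X0 <= X)%R -> (exp (- X) <= eps)%R.
Proof.
  intros He. exists (- ln eps)%R. intros X HX. rewrite <- (exp_ln eps He). apply exp_le. lra.
Qed.

(** The double series collects all residues at the poles of [Gamma (- s)]; the poles of
    [Gamma (a + s)] on the right of the path have to be compensated. *)
Definition barnes_value a c c' x y (J : nat) : C :=
  2 * PI * Ci * (RG c' * / RG a * Psi2 a c c' x y - csum (left_residue a c c' x y) J).

(** As the rectangle widens its right side contributes less and less, and the residues add
    up to the double series; only the two horizontal sides are left, and they decay
    exponentially with their height. *)
Lemma barnes_truncated a c c' x y delta sigma L (J : nat) :
  ~ nonpos_integer a -> ~ nonpos_integer c -> ~ nonpos_integer c' -> y <> RtoC 0 ->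
  (0 < delta)%R -> (Rabs (Arg (- y)) <= PI / 2 - delta)%R ->
  indented_vertical_line sigma L ->
  (forall k : nat, right_of_path L (INR k)) ->
  (forall j, (j < J)%nat -> right_of_path L (- a - INR j)) ->
  (forall j, (J <= j)%nat -> left_of_path L (- a - INR j)) ->
  exists A B, forall T1 T2, (B <= T1)%R -> (B <= T2)%R ->
    (Cmod (path_int L (- T1) T2 (integrand a c c' x y) - barnes_value a c c' x y J) <=
       A * (exp (- (delta / 2) * T1) + exp (- (delta / 2) * T2)))%R.
Proof.
  intros Ha Hc Hc' Hy Hd HA HL Hk HjR HjL.
  destruct (contour_value a c c' x y sigma L J Ha Hc HL Hk HjR HjL) as [B0 HB0].
  destruct (integrand_decay a c c' x y sigma delta Hc Hd HA) as [A [PA Hdec]].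
  set (f := integrand a c c' x y) in *.
  exists (A * exp (- sigma))%R, (Rabs B0 + Cmod a + 1)%R. intros T1 T2 HT1 HT2.
  assert (Pa := Cmod_ge_0 a). assert (PB := Rabs_pos B0). assert (LB := Rle_abs B0).
  assert (Ia := Im_le_Cmod a). apply Rabs_le_between in Ia.
  assert (FH : forall t, far_from_poles a (t, T2) /\ far_from_poles a (t, (- T1)%R)).
  { intros t. split; apply far_high; simpl.
    - rewrite Rabs_right; lra.
    - rewrite Rabs_right; unfold Im in *; lra.
    - rewrite Rabs_left; lra.
    - rewrite Rabs_left; unfold Im in *; lra. }
  assert (AH : forall T, (T = T2 \/ T = - T1)%R -> along (hline T) f).
  { intros T HT. apply along_Ccont; [apply piecewise_C1_hline|]. intros t.
    assert (F : far_from_poles a (hline T t)) by (destruct HT as [->| ->]; apply FH).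
    destruct (far_not_pole a _ F). now apply Ccont_integrand. }
  apply le_epsilon. intros eps He.
  set (e := (eps / 2)%R). assert (Pe : (0 < e)%R) by (unfold e; lra).
  set (c1 := 2 * PI * Ci * (RG c' * / RG a)).
  destruct (Psi2_series a c c' x y Hc Hc' (e / (Cmod c1 + 1))%R) as [N1 HN1].
  { apply Rdiv_lt_0_compat; [easy|]. generalize (Cmod_ge_0 c1). lra. }
  destruct (exp_neg_small (e / ((T2 + T1 + 1) * A))) as [X0 HX0].
  { apply Rdiv_lt_0_compat; [easy|]. apply Rmult_lt_0_compat; lra. }
  destruct (large_index (Rabs B0 + Cmod a + Rabs X0 + Rabs sigma)) as [N2 [_ HN2]].
  set (N := max N1 N2).
  assert (HN : (Rabs B0 + Cmod a + Rabs X0 + Rabs sigma < INR N)%R).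
  { eapply Rlt_le_trans; [exact HN2|]. apply le_INR. unfold N. lia. }
  assert (PX := Rabs_pos X0). assert (LX := Rle_abs X0).
  assert (PS := Rabs_pos sigma). assert (LS := Rle_abs sigma).
  set (X := (INR N + / 2)%R).
  assert (V := HB0 T1 T2 N ltac:(lra) ltac:(lra) ltac:(lra)). fold X in V.
  rewrite contour_int in V.
  assert (AV : along (vline X) f).
  { apply along_Ccont; [apply piecewise_C1_vline|]. intros t.
    assert (F : far_from_poles a (vline X t)) by (apply (far_half a _ N); [easy|lra]).
    destruct (far_not_pole a _ F). now apply Ccont_integrand. }
  assert (BT : forall T, (T = T2 \/ T = - T1)%R ->
    (Cmod (path_int (hline T) sigma X f) <= A * exp (- (delta / 2) * Rabs T) * exp (- sigma))%R).
  { intros T HT. apply path_int_hline_bound; [unfold X; lra| |now apply AH|].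
    - left. pos_prod.
    - intros t Ht. assert (F : far_from_poles a (t, T)) by (destruct HT as [->| ->]; apply FH).
      assert (D := Hdec (t, T) (proj1 Ht) F). simpl in D.
      rewrite Rmult_assoc, (Rmult_comm (exp _) (exp (- t))), <- Rmult_assoc. exact D. }
  assert (BV : (Cmod (path_int (vline X) (- T1) T2 f) <= e)%R).
  { apply Rle_trans with ((T2 - - T1) * (A * exp (- X)))%R.
    - apply path_int_vline_bound; [lra|easy|]. intros t _.
      assert (F : far_from_poles a (X, t)) by (apply (far_half a _ N); [easy|lra]).
      assert (D := Hdec (X, t)). simpl in D. specialize (D ltac:(unfold X; lra) F).
      eapply Rle_trans; [exact D|]. rewrite <- (Rmult_1_r (A * exp (- X))) at 2.
      apply Rmult_le_compat_l; [left; pos_prod|]. rewrite <- exp_0. apply exp_le.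
      generalize (Rabs_pos t). nra.
    - assert (HX := HX0 X ltac:(unfold X; lra)). set (q := exp (- X)) in *.
      assert (Pq : (0 < q)%R) by apply exp_pos.
      apply Rle_trans with ((T2 + T1 + 1) * A * q)%R; [nra|].
      apply Rmult_le_compat_l with (r := ((T2 + T1 + 1) * A)%R) in HX; [|nra].
      replace ((T2 + T1 + 1) * A * (e / ((T2 + T1 + 1) * A)))%R with e in HX
        by (field; split; lra). exact HX. }
  set (S := csum (psi2_coef a c c' x y) (S N)).
  assert (ES : csum (right_residue a c c' x y) (Datatypes.S N) = - (RG c' * / RG a) * S).
  { unfold S. rewrite <- csum_scal. apply csum_ext. intros k _. now apply right_residue_eq. }
  rewrite ES in V.
  assert (BS : (Cmod (c1 * (S - Psi2 a c c' x y)) <= e)%R).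
  { rewrite Cmod_mult. assert (P1 := Cmod_ge_0 c1).
    assert (Q := HN1 N ltac:(unfold N; lia)). fold S in Q.
    apply Rle_trans with (Cmod c1 * (e / (Cmod c1 + 1)))%R; [now apply Rmult_le_compat_l|].
    apply Rmult_le_reg_r with (Cmod c1 + 1)%R; [lra|].
    replace (Cmod c1 * (e / (Cmod c1 + 1)) * (Cmod c1 + 1))%R with (Cmod c1 * e)%R by (field; lra).
    nra. }
  assert (E : path_int L (- T1) T2 f - barnes_value a c c' x y J =
    c1 * (S - Psi2 a c c' x y) +
    (path_int (vline X) (- T1) T2 f + (path_int (hline (- T1)) sigma X f - path_int (hline T2) sigma X f))).
  { replace (path_int L (- T1) T2 f) with
      ((path_int L (- T1) T2 f + path_int (hline T2) sigma X f - path_int (vline X) (- T1) T2 f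
        - path_int (hline (- T1)) sigma X f) + (path_int (vline X) (- T1) T2 f +
          (path_int (hline (- T1)) sigma X f - path_int (hline T2) sigma X f))) by ring.
    rewrite V. unfold barnes_value, c1. ring. }
  rewrite E. eapply Rle_trans; [apply Cmod_triangle|].
  eapply Rle_trans; [apply Rplus_le_compat_l, Cmod_triangle|].
  assert (B1 := BT T2 (or_introl eq_refl)). assert (B2 := BT (- T1)%R (or_intror eq_refl)).
  rewrite Rabs_Ropp, (Rabs_right T1) in B2 by lra. rewrite (Rabs_right T2) in B1 by lra.
  assert (B3 := Cmod_triangle_sub (path_int (hline (- T1)) sigma X f) (path_int (hline T2) sigma X f)).
  unfold e in *. nra.
Qed.

Lemma exp_decay_small (k A eps : R) : (0 < k)%R -> (0 < eps)%R ->
  exists T0, forall T, (T0 <= T)%R -> (A * exp (- k * T) <= eps)%R.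
Proof.
  intros Hk He. destruct (exp_neg_small (eps / (Rabs A + 1))) as [X0 HX].
  { apply Rdiv_lt_0_compat; [easy|]. generalize (Rabs_pos A). lra. }
  exists (X0 / k)%R. intros T HT. assert (PA := Rabs_pos A). assert (LA := Rle_abs A).
  assert (Q : (exp (- k * T) <= eps / (Rabs A + 1))%R).
  { replace (- k * T)%R with (- (k * T))%R by ring. apply HX.
    apply Rmult_le_compat_l with (r := k) in HT; [|lra].
    replace (k * (X0 / k))%R with X0 in HT by (field; lra). easy. }
  assert (P := exp_pos (- k * T)).
  apply Rle_trans with ((Rabs A + 1) * exp (- k * T))%R; [nra|].
  apply Rmult_le_compat_l with (r := (Rabs A + 1)%R) in Q; [|lra].
  replace ((Rabs A + 1) * (eps / (Rabs A + 1)))%R with eps in Q by (field; lra). easy.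
Qed.

Lemma path_integral_of_truncated (f : C -> C) (L : R -> C) (V : C) (A B k : R) :
  piecewise_C1 L -> along L f -> (0 < k)%R ->
  (forall T1 T2, (B <= T1)%R -> (B <= T2)%R ->
    (Cmod (path_int L (- T1) T2 f - V) <= A * (exp (- k * T1) + exp (- k * T2)))%R) ->
  is_path_integral f L V.
Proof.
  intros HL Ha Hk H P [eps HP].
  assert (E4 : (0 < eps / 4)%R) by (generalize (cond_pos eps); lra).
  destruct (exp_decay_small k A (eps / 4) Hk E4) as [T0 HT0].
  set (M := (Rmax 0 (Rmax B T0))%R).
  assert (M0 : (0 <= M)%R) by apply Rmax_l.
  assert (M1 : (B <= M)%R) by (eapply Rle_trans; [apply Rmax_l|apply Rmax_r]).
  assert (M2 : (T0 <= M)%R) by (eapply Rle_trans; [apply Rmax_r|apply Rmax_r]).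
  exists (fun a => a < - M)%R (fun b => M < b)%R; [now exists (- M)%R|now exists M|].
  intros a b Ha' Hb. simpl fst. simpl snd.
  exists (path_int L a b f). split.
  - apply CInt_correct; [now apply along_pw_cont_C|lra].
  - apply HP. assert (Q := H (- a)%R b ltac:(lra) ltac:(lra)). rewrite Ropp_involutive in Q.
    assert (Q1 := HT0 (- a)%R ltac:(lra)). assert (Q2 := HT0 b ltac:(lra)).
    apply (C_NormedModule_mixin_compat1 V (path_int L a b f) eps).
    change (Cmod (path_int L a b f - V) < eps)%R. generalize (cond_pos eps). lra.
Qed.

Lemma integrand_along a c c' x y L : ~ nonpos_integer c -> piecewise_C1 L ->
  (forall k : nat, forall t, L t <> INR k) -> (forall j : nat, forall t, L t <> - a - INR j) ->
  along L (integrand a c c' x y).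
Proof.
  intros Hc HL H1 H2. apply along_Ccont; [easy|]. intros t. apply Ccont_integrand; [easy| |].
  - intros [j E]. apply (H2 j t). replace (L t) with (a + L t - a) by ring.
    rewrite E, RtoC_opp. ring.
  - intros [j E]. apply (H1 j t). replace (L t) with (- - L t) by ring.
    rewrite E, RtoC_opp. ring.
Qed.

Lemma barnes a c c' x y delta sigma L (J : nat) :
  ~ nonpos_integer a -> ~ nonpos_integer c -> ~ nonpos_integer c' -> y <> RtoC 0 ->
  (0 < delta)%R -> (Rabs (Arg (- y)) <= PI / 2 - delta)%R ->
  indented_vertical_line sigma L ->
  (forall k : nat, right_of_path L (INR k)) ->
  (forall j, (j < J)%nat -> right_of_path L (- a - INR j)) ->
  (forall j, (J <= j)%nat -> left_of_path L (- a - INR j)) ->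
  is_path_integral (integrand a c c' x y) L (barnes_value a c c' x y J).
Proof.
  intros Ha Hc Hc' Hy Hd HA HL Hk HjR HjL.
  destruct (barnes_truncated a c c' x y delta sigma L J Ha Hc Hc' Hy Hd HA HL Hk HjR HjL)
    as [A [B H]].
  apply (path_integral_of_truncated _ L _ A B (delta / 2)); [apply HL| |lra|exact H].
  apply integrand_along; [easy|apply HL| |].
  - intros k. now apply right_of_path_off.
  - intros j. destruct (Nat.lt_ge_cases j J); [now apply right_of_path_off, HjR|].
    now apply left_of_path_off, HjL.
Qed.

(** * The asymptotic expansion *)

Lemma poch_reflect (z : C) (j : nat) : poch (z - INR j) j = (- (1)) ^ j * poch (1 - z) j.
Proof.
  induction j as [|j IH]; [simpl; ring|].
  rewrite poch_first.
  replace (z - INR (S j) + 1) with (z - INR j) by (rewrite S_INR, RtoC_plus; ring).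
  rewrite IH. cbn [poch]. rewrite S_INR, RtoC_plus. simpl. ring.
Qed.

Lemma poch_reflect_fact (i j : nat) :
  poch (- INR (j + i))%R i * INR (fact j) = (- (1)) ^ i * INR (fact (j + i)).
Proof.
  replace (RtoC (- INR (j + i))) with (- INR j - INR i)
    by (rewrite RtoC_opp, plus_INR, RtoC_plus; ring).
  rewrite poch_reflect, <- (poch_1 (j + i)), poch_add, poch_1.
  replace (1 - - INR j) with (1 + INR j) by ring. ring.
Qed.

Definition asym_coef (a c c' x : C) (n : nat) : C :=
  Gamma c' / Gamma (c' - a) *
    (Hyp1F1 (- INR n) c x * (poch a n * poch (1 + a - c') n / INR (fact n))).

Definition asym_scale (a : C) (n : nat) (y : C) : C := Cpower (- y) (- a - INR n).

Lemma left_residue_eq a c c' x y j : ~ nonpos_integer a -> ~ nonpos_integer c' ->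
  left_residue a c c' x y j = RG c' * / RG a * (asym_coef a c c' x j * asym_scale a j y).
Proof.
  intros Ha Hc'. unfold left_residue, integrand_num, asym_coef, asym_scale, Cdiv.
  rewrite !Gamma_RG, Cinv_inv_total.
  replace (a + (- a - INR j)) with (- INR j) by ring.
  rewrite (RG_shift (c' + (- a - INR j)) j), (RG_shift a j), poch_neg_INR.
  replace (c' + (- a - INR j) + INR j) with (c' - a) by ring.
  replace (c' + (- a - INR j)) with ((c' - a) - INR j) by ring.
  rewrite poch_reflect. replace (1 - (c' - a)) with (1 + a - c') by ring.
  assert (N1 := sign_neq0 j). assert (N2 := fact_C_neq0 j). assert (N3 := RG_neq0 c' Hc').
  assert (N4 := poch_neq0 a j Ha). assert (N5 := RG_neq0 _ (not_nonpos_shift a j Ha)).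
  field. repeat split; easy.
Qed.

(** For [a = - k] the double series is a polynomial in [y], and the expansion is this
    polynomial read from its leading term downwards. *)
Lemma Psi2_polynomial (k : nat) c c' x y : ~ nonpos_integer c -> ~ nonpos_integer c' ->
  y <> RtoC 0 ->
  Psi2 (- INR k)%R c c' x y =
  csum (fun n => asym_coef (- INR k)%R c c' x n * asym_scale (- INR k)%R n y) (S k).
Proof.
  intros Hc Hc' Hy. set (a := RtoC (- INR k)).
  assert (Z : forall n, (k < n)%nat -> psi2_coef a c c' x y n = 0).
  { intros n Hn. unfold psi2_coef, a. rewrite poch_nonpos by easy. unfold Cdiv. ring. }
  transitivity (csum (psi2_coef a c c' x y) (S k)).
  - symmetry. apply C_eq_of_close. intros eps He.
    destruct (Psi2_series a c c' x y Hc Hc' eps He) as [N HN].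
    specialize (HN (k + N)%nat ltac:(lia)). rewrite <- Nat.add_succ_l, csum_split in HN.
    rewrite (csum_zero (fun i => psi2_coef a c c' x y (S k + i))), Cplus_0_r in HN; [easy|].
    intros i _. apply Z. lia.
  - rewrite csum_rev. apply csum_ext. intros j Hj.
    replace (S k - 1 - j)%nat with (k - j)%nat by lia. set (i := (k - j)%nat).
    assert (Ek : k = (j + i)%nat) by (unfold i; lia).
    unfold psi2_coef, asym_coef, asym_scale, Cdiv. rewrite !Gamma_RG, Cinv_inv_total.
    assert (Ea : a = - INR j - INR i)
      by (unfold a; rewrite Ek, RtoC_opp, plus_INR, RtoC_plus; ring).
    replace (- a - INR j) with (RtoC (INR i)) by (rewrite Ea; ring).
    rewrite Cpower_INR_exponent.
    2:{ intros E. apply Hy. replace y with (- - y) by ring. rewrite E. ring. }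
    replace (a + INR i) with (- INR j) by (rewrite Ea; ring).
    replace (c' - a) with (c' + INR (i + j)) by (rewrite Ea, plus_INR, RtoC_plus; ring).
    rewrite (RG_shift c' (i + j)), (poch_add c' i j).
    replace (poch (1 + a - c') j) with ((- (1)) ^ j * poch (c' + INR i) j).
    2:{ replace (1 + a - c') with ((1 - INR i - c') - INR j) by (rewrite Ea; ring).
        rewrite poch_reflect. do 2 f_equal. ring. }
    assert (F1 := poch_reflect_fact i j). assert (F2 := poch_reflect_fact j i).
    rewrite (Nat.add_comm i j) in F2. rewrite <- Ek in F1, F2. fold a in F1, F2.
    assert (N2 := fact_C_neq0 i). assert (N3 := fact_C_neq0 j).
    replace (poch a i) with ((- (1)) ^ i * INR (fact k) * / INR (fact j))
      by (rewrite <- F1; field; easy).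
    replace (poch a j) with ((- (1)) ^ j * INR (fact k) * / INR (fact i))
      by (rewrite <- F2; field; easy).
    replace (- y) with (- (1) * y) by ring. rewrite Cpow_mult_l.
    assert (N4 := poch_neq0 c' i Hc').
    assert (N5 := poch_neq0 _ j (not_nonpos_shift c' i Hc')).
    assert (N6 := RG_neq0 _ (not_nonpos_shift c' (i + j) Hc')).
    assert (Sq : (- RtoC 1) ^ j * (- (1)) ^ j = 1).
    { rewrite <- Cpow_mult_l. replace (- RtoC 1 * - (1)) with (RtoC 1) by ring. apply Cpow_1_l. }
    transitivity ((- (1)) ^ i * INR (fact k) * / INR (fact j) * / poch c' i *
      (y ^ i * / INR (fact i)) * Hyp1F1 (- INR j) c x * ((- (1)) ^ j * (- (1)) ^ j)).
    + rewrite Sq. ring.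
    + field. repeat split; easy.
Qed.

Lemma vline_indented x : indented_vertical_line x (vline x).
Proof.
  split; [apply piecewise_C1_vline|]. split.
  - intros t u E. now injection E.
  - exists 0%R. intros t _. easy.
Qed.

Lemma vline_left x p : (Re p < x)%R -> left_of_path (vline x) p.
Proof.
  intros H. exists p. split; [intros u; exact H|]. exists (fun _ => p).
  repeat split; try easy.
  - intros t. apply continuous_const.
  - intros t u _ E. rewrite E in H. simpl in H. lra.
Qed.

Lemma vline_right x p : (x < Re p)%R -> right_of_path (vline x) p.
Proof.
  intros H. exists p. split; [intros u; exact H|]. exists (fun _ => p).
  repeat split; try easy.
  - intros t. apply continuous_const.
  - intros t u _ E. rewrite E in H. simpl in H. lra.
Qed.

Lemma is_RInt_exp_abs (k T : R) : (0 < k)%R -> (0 <= T)%R ->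
  exists I, is_RInt (fun t => exp (- k * Rabs t)) (- T) T I /\ (I <= 2 / k)%R.
Proof.
  intros Hk HT.
  assert (R1 : is_RInt (fun t => exp (- k * Rabs t)) 0 T ((1 - exp (- k * T)) / k)%R).
  { apply (is_RInt_ext (fun t => exp (- k * t))).
    - rewrite Rmin_left, Rmax_right by lra. intros t Ht. rewrite Rabs_right by lra. easy.
    - replace ((1 - exp (- k * T)) / k)%R with
        (minus (- exp (- k * T) / k) (- exp (- k * 0) / k))%R.
      + apply (is_RInt_derive (V := R_CompleteNormedModule) (fun t => - exp (- k * t) / k)%R).
        * intros t _. auto_derive; [easy|]. field. lra.
        * intros t _. apply (ex_derive_continuous (fun t => exp (- k * t))). auto_derive. easy.
      + rewrite Rmult_0_r, exp_0. unfold minus, plus, opp; simpl. field. lra. }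
  assert (R2 : is_RInt (fun t => exp (- k * Rabs t)) (- T) 0 ((1 - exp (- k * T)) / k)%R).
  { apply (is_RInt_ext (fun t => exp (k * t))).
    - rewrite Rmin_left, Rmax_right by lra. intros t Ht. rewrite Rabs_left by lra. f_equal. ring.
    - replace ((1 - exp (- k * T)) / k)%R with
        (minus (exp (k * 0) / k) (exp (k * - T) / k))%R.
      + apply (is_RInt_derive (V := R_CompleteNormedModule) (fun t => exp (k * t) / k)%R).
        * intros t _. auto_derive; [easy|]. field. lra.
        * intros t _. apply (ex_derive_continuous (fun t => exp (k * t))). auto_derive. easy.
      + rewrite Rmult_0_r, exp_0. replace (k * - T)%R with (- k * T)%R by ring.
        unfold minus, plus, opp; simpl. field. lra. }
  eexists. split; [apply (is_RInt_Chasles (V := R_NormedModule) _ _ 0 _ _ _ R2 R1)|].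
  unfold plus; simpl.
  replace ((1 - exp (- k * T)) / k + (1 - exp (- k * T)) / k)%R with
    (2 / k - 2 * exp (- k * T) / k)%R by (field; lra).
  assert (0 < 2 * exp (- k * T) / k)%R; [|lra].
  apply Rdiv_lt_0_compat; [|easy]. generalize (exp_pos (- k * T)). lra.
Qed.

(** The line [Re s = - Re a - n - 1/2] leaves exactly the first [n + 1] poles of
    [Gamma (a + s)] on its right; on it, [(- y)^s] has the size of the error term. *)
Lemma remainder_bound a c c' x delta (n : nat) :
  ~ nonpos_integer a -> ~ nonpos_integer c -> ~ nonpos_integer c' -> (0 < delta)%R ->
  (Cmod a <= INR n)%R ->
  exists K, forall y, V_Psi2 delta x y ->
    (Cmod (Psi2 a c c' x y - csum (fun j => asym_coef a c c' x j * asym_scale a j y)%C (S n)) <=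
      K * exp ((- Re a - INR n - / 2) * ln (Cmod y)))%R.
Proof.
  intros Ha Hc Hc' Hd Hn. set (s0 := (- Re a - INR n - / 2)%R).
  assert (Ra := re_le_Cmod a). apply Rabs_le_between in Ra.
  destruct (kernel_bound a c c' x s0 (delta / 2) Hc) as [A [K0 [PA [_ HK]]]]; [lra|].
  set (q := RG a * / RG c' * / (2 * PI * Ci)).
  exists (Cmod q * (A * (2 / (delta / 2))))%R. intros y (Hx & Hy & _ & HA).
  destruct (barnes_truncated a c c' x y delta s0 (vline s0) (S n) Ha Hc Hc' Hy Hd HA
     (vline_indented s0)) as [A1 [B1 HB]].
  { intros k. apply vline_right. rewrite re_RtoC. unfold s0. generalize (pos_INR k). lra. }
  { intros j Hj. apply vline_right.
    replace (Re (- a - INR j)) with (- Re a - INR j)%R by (unfold Re; simpl; ring).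
    assert (INR j <= INR n)%R by (apply le_INR; lia). unfold s0. lra. }
  { intros j Hj. apply vline_left.
    replace (Re (- a - INR j)) with (- Re a - INR j)%R by (unfold Re; simpl; ring).
    apply le_INR in Hj. rewrite S_INR in Hj. unfold s0. lra. }
  set (V := barnes_value a c c' x y (S n)) in *.
  set (l := ln (Cmod y)).
  assert (Far : forall t, far_from_poles a (s0, t)).
  { intros t. split; intros m.
    - eapply Rle_trans; [|apply re_le_Cmod].
      replace (Re ((s0, t) - INR m)) with (s0 - INR m)%R by (unfold Re; simpl; ring).
      generalize (pos_INR m). intros Pm. rewrite Rabs_left; unfold s0; lra.
    - eapply Rle_trans; [|apply re_le_Cmod].
      replace (Re (a + (s0, t) + INR m)) with (INR m - INR n - / 2)%R
        by (unfold s0, Re; simpl; ring).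
      destruct (Nat.le_gt_cases m n) as [L|L].
      + apply le_INR in L. rewrite Rabs_left; lra.
      + assert (L' : (INR (S n) <= INR m)%R) by (apply le_INR; lia). rewrite S_INR in L'.
        rewrite Rabs_right; lra. }
  assert (Bd : forall t, (Cmod (integrand a c c' x y (s0, t)) <=
     A * exp (s0 * l) * exp (- (delta / 2) * Rabs t))%R).
  { intros t. unfold integrand. rewrite Cmod_mult.
    assert (Q1 := HK O (s0, t)). simpl (INR 0) in Q1. rewrite Cplus_0_r in Q1.
    specialize (Q1 ltac:(simpl; lra) (Far t)). simpl in Q1.
    assert (Q2 := Cmod_Cpower_le (- y) (s0, t) _ HA). rewrite Cmod_opp in Q2. fold l in Q2.
    simpl in Q2.
    eapply Rle_trans; [apply Rmult_le_compat; [apply Cmod_ge_0|apply Cmod_ge_0|exact Q1|exact Q2]|].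
    right.
    replace (A * (1 / 1) * exp (- (PI / 2 - delta / 2) * Rabs t) *
      (exp (s0 * l) * exp ((PI / 2 - delta) * Rabs t)))%R with
      (A * exp (s0 * l) * (exp (- (PI / 2 - delta / 2) * Rabs t) * exp ((PI / 2 - delta) * Rabs t)))%R
      by field.
    rewrite <- exp_plus. do 2 f_equal. field. }
  assert (BV : (Cmod V <= A * exp (s0 * l) * (2 / (delta / 2)))%R).
  { apply le_epsilon. intros eps He.
    destruct (exp_decay_small (delta / 2) (2 * A1) eps) as [T0 HT0]; [lra|easy|].
    set (T := Rmax 0 (Rmax B1 T0)).
    assert (M0 : (0 <= T)%R) by apply Rmax_l.
    assert (M1 : (B1 <= T)%R) by (eapply Rle_trans; [apply Rmax_l|apply Rmax_r]).
    assert (M2 : (T0 <= T)%R) by (eapply Rle_trans; [apply Rmax_r|apply Rmax_r]).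
    destruct (is_RInt_exp_abs (delta / 2) T) as [I [HI1 HI2]]; [lra|easy|].
    assert (BI : (Cmod (path_int (vline s0) (- T) T (integrand a c c' x y)) <=
       A * exp (s0 * l) * I)%R).
    { apply (CInt_bound _ (fun t => A * exp (s0 * l) * exp (- (delta / 2) * Rabs t))%R (- T) T).
      - lra.
      - apply along_pw_cont_C; [apply piecewise_C1_vline|].
        apply along_Ccont; [apply piecewise_C1_vline|]. intros t.
        destruct (far_not_pole a _ (Far t)). now apply Ccont_integrand.
      - intros t _. rewrite Cmod_mult, path_derive_vline, Cmod_Ci, Rmult_1_r. apply Bd.
      - now apply (is_RInt_scal (V := R_NormedModule)). }
    specialize (HB T T M1 M1). specialize (HT0 T M2).
    assert (T1 := Cmod_triangle_rev V (path_int (vline s0) (- T) T (integrand a c c' x y))).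
    rewrite Cmod_sub_comm in T1.
    assert (P : (0 < A * exp (s0 * l))%R) by pos_prod.
    assert (A * exp (s0 * l) * I <= A * exp (s0 * l) * (2 / (delta / 2)))%R
      by (apply Rmult_le_compat_l; lra).
    lra. }
  assert (E : Psi2 a c c' x y - csum (fun j => asym_coef a c c' x j * asym_scale a j y)%C (S n) =
     q * V).
  { unfold V, barnes_value, q.
    rewrite (csum_ext (left_residue a c c' x y)
      (fun j => RG c' * / RG a * (asym_coef a c c' x j * asym_scale a j y)))
      by (intros; now apply left_residue_eq).
    rewrite csum_scal. assert (N1 := RG_neq0 a Ha). assert (N2 := RG_neq0 c' Hc').
    assert (N3 := two_PI_Ci_neq0).
    set (w := 2 * PI * Ci) in *. clearbody w. field. repeat split; easy. }
  rewrite E, Cmod_mult, Rmult_assoc. apply Rmult_le_compat_l; [apply Cmod_ge_0|].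
  eapply Rle_trans; [exact BV|]. right. ring.
Qed.

Definition negligible (a x : C) (delta : R) (n : nat) (g : C -> C) : Prop :=
  forall eps : R, (0 < eps)%R -> exists M : R, forall y, (M < Cmod y)%R -> V_Psi2 delta x y ->
    (Cmod (g y) <= eps * Cmod (asym_scale a n y))%R.

Lemma negligible_is_domin a x delta n g : negligible a x delta n g ->
  is_domin (U := C_NormedModule) (V := C_NormedModule)
    (within (fun y => V_Psi2 delta x y) Cmod_infty) (asym_scale a n) g.
Proof.
  intros H eps. destruct (H eps (cond_pos eps)) as [M HM]. exists M. intros y H1 H2.
  exact (HM y H1 H2).
Qed.

Lemma negligible_plus a x delta n g h : negligible a x delta n g -> negligible a x delta n h ->
  negligible a x delta n (fun y => g y + h y).
Proof.
  intros Hg Hh eps He. destruct (Hg (eps / 2)%R) as [M HM]; [lra|].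
  destruct (Hh (eps / 2)%R) as [M' HM']; [lra|].
  exists (Rmax M M'). intros y H1 H2. eapply Rle_trans; [apply Cmod_triangle|].
  specialize (HM y (Rle_lt_trans _ _ _ (Rmax_l _ _) H1) H2).
  specialize (HM' y (Rle_lt_trans _ _ _ (Rmax_r _ _) H1) H2). lra.
Qed.

Lemma negligible_scal a x delta n c g : negligible a x delta n g ->
  negligible a x delta n (fun y => c * g y).
Proof.
  intros Hg eps He. assert (P := Cmod_ge_0 c).
  destruct (Hg (eps / (Cmod c + 1))%R) as [M HM]; [apply Rdiv_lt_0_compat; lra|].
  exists M. intros y H1 H2. specialize (HM y H1 H2). rewrite Cmod_mult.
  assert (P' := Cmod_ge_0 (asym_scale a n y)).
  apply Rle_trans with ((Cmod c + 1) * (eps / (Cmod c + 1) * Cmod (asym_scale a n y)))%R.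
  - apply Rmult_le_compat; auto using Cmod_ge_0. lra.
  - right. field. lra.
Qed.

Lemma negligible_csum a x delta n (g : nat -> C -> C) m :
  (forall i, negligible a x delta n (g i)) ->
  negligible a x delta n (fun y => csum (fun i => g i y) m).
Proof.
  intros H. induction m as [|m IH]; simpl.
  - intros eps He. exists 0%R. intros y _ _. rewrite Cmod_0.
    apply Rmult_le_pos; [lra|apply Cmod_ge_0].
  - now apply negligible_plus.
Qed.

(** Powers of [|y|] with a smaller exponent are negligible: the argument of [- y] is
    bounded, so [|(- y)^s|] and [|y|^(Re s)] are comparable. *)
Lemma negligible_power a x delta n g K d : (0 < d)%R -> (0 < delta)%R ->
  (forall y, V_Psi2 delta x y -> (Cmod (g y) <= K * exp ((- Re a - INR n - d) * ln (Cmod y)))%R) ->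
  negligible a x delta n g.
Proof.
  intros Hd Hdelta H eps He. set (w := (Rabs (Im a) * (PI / 2))%R).
  assert (PK := Rabs_pos K). assert (LK := Rle_abs K).
  destruct (exp_neg_small (eps * exp (- w) / (Rabs K + 1))) as [X0 HX0].
  { apply Rdiv_lt_0_compat; [|lra]. pos_prod. }
  exists (exp (X0 / d)). intros y H1 Hy. eapply Rle_trans; [now apply H|].
  destruct Hy as (_ & Hy0 & _ & HA). set (l := ln (Cmod y)).
  assert (L : (X0 / d < l)%R) by (rewrite <- (ln_exp (X0 / d)); apply ln_increasing; [apply exp_pos|easy]).
  assert (Ld : (X0 <= d * l)%R).
  { apply Rmult_lt_compat_l with (r := d) in L; [|easy].
    replace (d * (X0 / d))%R with X0 in L by (field; lra). lra. }
  assert (Sc : (exp ((- Re a - INR n) * l) * exp (- w) <= Cmod (asym_scale a n y))%R).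
  { unfold asym_scale, Cpower. rewrite Cmod_Cexp, <- exp_plus. apply exp_le.
    rewrite re_mult. change (Re (Clog (- y))) with (ln (Cmod (- y))).
    change (Im (Clog (- y))) with (Arg (- y)). rewrite Cmod_opp. fold l.
    replace (Re (- a - INR n)) with (- Re a - INR n)%R by (unfold Re; simpl; ring).
    replace (Im (- a - INR n)) with (- Im a)%R by (unfold Im; simpl; ring).
    assert (Q : (Rabs (Im a * Arg (- y)) <= w)%R).
    { rewrite Rabs_mult. apply Rmult_le_compat_l; [apply Rabs_pos|lra]. }
    apply Rabs_le_between in Q. lra. }
  assert (Q := HX0 (d * l)%R Ld).
  apply Rle_trans with (eps * (exp ((- Re a - INR n) * l) * exp (- w)))%R;
    [|apply Rmult_le_compat_l; lra].
  replace ((- Re a - INR n - d) * l)%R with ((- Re a - INR n) * l + - (d * l))%R by ring.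
  rewrite exp_plus. set (e1 := exp ((- Re a - INR n) * l)) in *.
  assert (P1 : (0 < e1)%R) by apply exp_pos.
  set (e2 := exp (- (d * l))) in *. assert (P2 : (0 < e2)%R) by apply exp_pos.
  apply Rmult_le_compat_l with (r := (Rabs K + 1)%R) in Q; [|lra].
  replace ((Rabs K + 1) * (eps * exp (- w) / (Rabs K + 1)))%R with (eps * exp (- w))%R in Q
    by (field; lra).
  apply Rle_trans with (e1 * ((Rabs K + 1) * e2))%R.
  - replace (K * (e1 * e2))%R with (e1 * (K * e2))%R by ring.
    apply Rmult_le_compat_l; [lra|]. apply Rmult_le_compat_r; lra.
  - replace (eps * (e1 * exp (- w)))%R with (e1 * (eps * exp (- w)))%R by ring.
    apply Rmult_le_compat_l; lra.
Qed.

Lemma negligible_scale a x delta n m : (0 < delta)%R -> (n < m)%nat ->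
  negligible a x delta n (asym_scale a m).
Proof.
  intros Hdelta Hnm.
  apply (negligible_power a x delta n _ (exp (Rabs (Im a) * (PI / 2))) (INR m - INR n)).
  - apply lt_INR in Hnm. lra.
  - easy.
  - intros y (_ & Hy0 & _ & HA). unfold asym_scale, Cpower. rewrite Cmod_Cexp, <- exp_plus.
    apply exp_le. rewrite re_mult. change (Re (Clog (- y))) with (ln (Cmod (- y))).
    change (Im (Clog (- y))) with (Arg (- y)). rewrite Cmod_opp.
    replace (Re (- a - INR m)) with (- Re a - INR m)%R by (unfold Re; simpl; ring).
    replace (Im (- a - INR m)) with (- Im a)%R by (unfold Im; simpl; ring).
    assert (Q : (Rabs (Im a * Arg (- y)) <= Rabs (Im a) * (PI / 2))%R).
    { rewrite Rabs_mult. apply Rmult_le_compat_l; [apply Rabs_pos|lra]. }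
    apply Rabs_le_between in Q. lra.
Qed.

(** Some remainder of order at least [n] is small enough; the terms in between are
    negligible one by one. *)
Lemma remainder_negligible a c c' x delta n :
  ~ nonpos_integer c -> ~ nonpos_integer c' -> (0 < delta)%R ->
  negligible a x delta n (fun y =>
    Psi2 a c c' x y - csum (fun j => asym_coef a c c' x j * asym_scale a j y)%C (S n)).
Proof.
  intros Hc Hc' Hd.
  assert (R : exists m K, forall y, V_Psi2 delta x y ->
    (Cmod (Psi2 a c c' x y - csum (fun j => asym_coef a c c' x j * asym_scale a j y)%C (S (n + m)))
      <= K * exp ((- Re a - INR (n + m) - / 2) * ln (Cmod y)))%R).
  { destruct (classic (nonpos_integer a)) as [[k ->]|Ha].
    - exists k, 0%R. intros y (_ & Hy & _).
      rewrite (Psi2_polynomial k c c' x y Hc Hc' Hy).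
      replace (S (n + k)) with (S k + n)%nat by lia. rewrite csum_split.
      rewrite (csum_zero (fun i => asym_coef (- INR k)%R c c' x (S k + i) * _)).
      + rewrite Cplus_0_r, Rmult_0_l.
        match goal with |- (Cmod (?z - ?z) <= _)%R => replace (z - z) with (RtoC 0) by ring end.
        rewrite Cmod_0. lra.
      + intros i _. unfold asym_coef. rewrite poch_nonpos by lia. unfold Cdiv. ring.
    - destruct (large_index (Cmod a)) as [m [_ Hm]]. exists m.
      apply remainder_bound; try easy. rewrite plus_INR. generalize (pos_INR n). lra. }
  destruct R as [m [K HK]].
  assert (N1 : negligible a x delta n (fun y => Psi2 a c c' x y -
     csum (fun j => asym_coef a c c' x j * asym_scale a j y)%C (S (n + m)))).
  { apply (negligible_power a x delta n _ K (INR m + / 2)); [generalize (pos_INR m); lra|easy|].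
    intros y Hy. specialize (HK y Hy). rewrite plus_INR in HK.
    replace (- Re a - INR n - (INR m + / 2))%R with (- Re a - (INR n + INR m) - / 2)%R by ring.
    exact HK. }
  assert (N2 : negligible a x delta n (fun y =>
     csum (fun i => asym_coef a c c' x (S n + i) * asym_scale a (S n + i) y) m)).
  { apply (negligible_csum a x delta n
      (fun i y => asym_coef a c c' x (S n + i) * asym_scale a (S n + i) y)).
    intros i. apply negligible_scal, negligible_scale; [easy|lia]. }
  intros eps He. destruct (negligible_plus _ _ _ _ _ _ N1 N2 eps He) as [M HM].
  exists M. intros y H1 H2. specialize (HM y H1 H2). cbv beta in HM.
  rewrite <- Nat.add_succ_l, csum_split in HM.
  match goal with H : (Cmod ?u <= _)%R |- (Cmod ?v <= _)%R => replace v with u by ring end.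
  exact HM.
Qed.

Theorem theorem4p1 :
  (forall (a c c' : C) (delta : R),
     ~ nonpos_integer c -> ~ nonpos_integer c' ->
     (0 < delta <= PI / 2)%R ->
     forall (x y : C), V_Psi2 delta x y ->
     forall (sigma : R) (L : R -> C),
       indented_vertical_line sigma L -> separates_poles a L ->
       exists I : C,
         is_path_integral
           (fun s => Hyp1F1 (a + s) c x * (Gamma (a + s) / Gamma (c' + s))
                       * Gamma (- s) * Cpower (- y) s)
           L I /\
         Psi2 a c c' x y = / (2 * PI * Ci) * (Gamma c' / Gamma a) * I)
  /\
  (forall (a c c' : C) (delta : R),
     ~ nonpos_integer c -> ~ nonpos_integer c' -> ~ nonpos_integer (c' - a) ->
     (0 < delta <= PI / 2)%R ->
     forall x : C,
       asymptotic_expansion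
         (within (fun y => V_Psi2 delta x y) Cmod_infty)
         (fun y => Psi2 a c c' x y)
         (fun n => Gamma c' / Gamma (c' - a)
                     * (Hyp1F1 (- INR n) c x
                          * (poch a n * poch (1 + a - c') n / INR (fact n))))
         (fun n y => Cpower (- y) (- a - INR n))).
Proof.
  split.
  - intros a c c' delta Hc Hc' Hd x y HV sigma L HL [Hleft Hright].
    assert (HR : forall k : nat, right_of_path L (INR k)).
    { intros k. apply Hright. exists k. now rewrite RtoC_opp. }
    assert (HLf : forall j : nat, left_of_path L (- a - INR j)).
    { intros j. apply Hleft. exists j. rewrite RtoC_opp. ring. }
    destruct (classic (nonpos_integer a)) as [[k ->]|Ha].
    + exfalso. apply (not_left_and_right sigma L (INR k) HL); [|apply HR].
      apply Hleft. exists O. rewrite !RtoC_opp. simpl. ring.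
    + exists (barnes_value a c c' x y 0).
      destruct HV as (_ & Hy & _ & HA). split.
      * apply (barnes a c c' x y delta sigma L 0 Ha Hc Hc' Hy (proj1 Hd) HA HL HR).
        -- intros j Hj. lia.
        -- intros j _. apply HLf.
      * unfold barnes_value, Cdiv. rewrite !Gamma_RG, Cinv_inv_total. simpl csum.
        assert (N1 := RG_neq0 a Ha). assert (N2 := RG_neq0 c' Hc').
        assert (N3 := two_PI_Ci_neq0). set (w := 2 * PI * Ci) in *. clearbody w.
        field. repeat split; easy.
  - intros a c c' delta Hc Hc' _ Hd x. split; intros n; apply negligible_is_domin.
    + apply negligible_scale; [easy|lia].
    + assert (H := remainder_negligible a c c' x delta n Hc Hc' (proj1 Hd)).
      intros eps He. destruct (H eps He) as [M HM]. exists M. intros y H1 H2.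
      specialize (HM y H1 H2). rewrite <- sum_n_csum in HM. exact HM.
Qed.
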